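(* Let $\underline{\mathcal V}$ be an unscaled wave profile with $\underline{\mathcal V}\cdot\underline{\mathcal V}_x\not\equiv 0$, with period $\underline X_x$ and rotational shift $\underline\xi_\phi$. Then the corresponding Evans function expands, as $(\lambda,\eta)\to(0,0)$, $(\lambda,\eta)\in\mathbb C\times\mathbb R^{d-1}$, uniformly in $\xi\in[-\pi,\pi]$, as $$D_\xi(\lambda,\eta)=\det\Big(\lambda\,\Sigma_t-(e^{i\xi}-1)\,\mathrm I_4+\frac{\|\eta\|^2}{\lambda}\,\Sigma_{y}\Big)+\mathcal O\Big((|\lambda|+|\xi|+\|\eta\|^2)\,(|\lambda|^2+|\xi|^2+\|\eta\|^2)\,\big(|\lambda|(|\lambda|+|\xi|)+\|\eta\|^2\big)\Big),$$ where $\Sigma_t$ is the $4\times4$ matrix whose columns are indexed by $a=\omega_\phi,c_x,\mu_\phi,\mu_x$ (in this order), $$\Sigma_t=\begin{pmatrix}\partial_a\xi_\phi\\ \partial_aX_x\\ \int_0^{\underline X_x}L\mathscr M[\underline{\mathcal V}]\,\partial_a\mathcal V+\mathscr M[\underline{\mathcal V}](0)\,\partial_aX_x\\ \int_0^{\underline X_x}L\mathscr Q_1[\underline{\mathcal V}]\,\partial_a\mathcal V+\mathscr Q_1[\underline{\mathcal V}](0)\,\partial_aX_x\end{pmatrix}_{a=\omega_\phi,c_x,\mu_\phi,\mu_x}$$ (derivatives evaluated at the parameters of $\underline{\mathcal V}$), and $$\Sigma_y=\begin{pmatrix}0&0&0&0\\0&0&0&0\\ \int_0^{\underline X_x}\kappa(\|\underline{\mathcal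 V}\|^2)\|\underline{\mathcal V}\|^2&-\int_0^{\underline X_x}\kappa(\|\underline{\mathcal V}\|^2)\,J\underline{\mathcal V}\cdot\underline{\mathcal V}_x&0&0\\ \int_0^{\underline X_x}\kappa(\|\underline{\mathcal V}\|^2)\,\underline{\mathcal V}_x\cdot J\underline{\mathcal V}&-\int_0^{\underline X_x}\kappa(\|\underline{\mathcal V}\|^2)\|\underline{\mathcal V}_x\|^2&0&0\end{pmatrix}.$$ (The determinant is a polynomial in $(\lambda,e^{i\xi}-1,\|\eta\|^2)$, extended by continuity at $\lambda=0$.)
   Context: Let $d\ge1$, let $\kappa,W:[0,\infty)\to\mathbb R$ be smooth with $\kappa$ positive and bounded away from $0$, and $J=\begin{pmatrix}0&1\\-1&0\end{pmatrix}$. For $U=U(t,x,y)\in\mathbb R^2$, $(x,y)\in\mathbb R\times\mathbb R^{d-1}$, consider the Schrödinger equation $\partial_tU=J\,\delta\mathscr H_0[U]$ with $\mathscr H_0[U]=\frac12\kappa(\|U\|^2)\|\nabla U\|^2+W(\|U\|^2)$. Here, for a functional density $\mathcal A[U]=\mathcal A(U,\nabla U)$, $\delta\mathcal A[U]=\nabla_U\mathcal A-\mathrm{div}(\nabla_{\nabla U}\mathcal A)$ is the variational gradient, $L\mathcal A[U]V=\frac{d}{ds}\mathcal A[U+sV]|_{s=0}$ the linearization, and $\mathrm{Hess}\,\mathcal A=L\delta\mathcal A$. Set $\mathscr M[U]=\frac12\|U\|^2$ and $\mathscr Q_1[U]=\frac12JU\cdot\partial_xU$. Unscaled wave profiles: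 given $(\omega_\phi,c_x)\in\mathbb R^2$, an unscaled (periodic) wave profile is a smooth $\mathcal V:\mathbb R\to\mathbb R^2$, function of $x$ only, with $\delta\mathscr H_{\rm u}[\mathcal V]=0$, $\mathscr H_{\rm u}=\mathscr H_0-\omega_\phi\mathscr M+c_x\mathscr Q_1$, and $\mathcal V(\cdot+X_x)=e^{\xi_\phi J}\mathcal V$, where $X_x>0$ is the period and $\xi_\phi$ the rotational shift (then $e^{\omega_\phi tJ}\mathcal V(x-c_xt)$ solves the equation). The following are constant along the profile: $\mu_\phi=\kappa(\|\mathcal V\|^2)J\mathcal V\cdot\mathcal V_x+\frac{c_x}2\|\mathcal V\|^2$ and $\mu_x=\frac12\kappa(\|\mathcal V\|^2)\|\mathcal V_x\|^2-W(\|\mathcal V\|^2)+\frac{\omega_\phi}2\|\mathcal V\|^2$. When $\mathcal V\cdot\mathcal V_x\not\equiv0$, $X_x$ is the fundamental period of $\|\mathcal V\|^2$, $\mathcal V$ does not vanish, and $\xi_\phi=\int_0^{X_x}\|\mathcal V\|^{-2}J\mathcal V\cdot\mathcal V_x\,dx$. Near a given profile with $\mathcal V\cdot\mathcal V_x\not\equiv0$, wave profiles identified up to rotations $\mathcal V\mapsto e^{\varphi J}\mathcal V$ and translations $\mathcal V\mapsto\mathcal V(\cdot+s)$ are smoothly parametrized by $(\omega_\phi,c_x,\mu_\phi,\mu_x)$; thus $\mathcal V,X_x,\xi_\phi$ are smooth functions of these parameters (a smooth choice of rotation/translation representatives being fixed). Evans function: for $\lambda\in\mathbb C$, $\eta\in\mathbb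 R^{d-1}$, let $R(\cdot,0;\lambda,\eta)$ (with $R(0,0;\lambda,\eta)=\mathrm I_4$) be the solution operator of the first-order $4$-dimensional ODE system for $(\psi,\psi_x)$ equivalent to $J\,\mathrm{Hess}\,\mathscr H_{\rm u}[\underline{\mathcal V}]\psi+\|\eta\|^2\kappa(\|\underline{\mathcal V}\|^2)J\psi=\lambda\psi$, $\psi:\mathbb R\to\mathbb C^2$. Then $$D_\xi(\lambda,\eta)=\det\Big(R(\underline X_x,0;\lambda,\eta)-e^{i\xi}\,\mathrm{diag}(e^{\underline\xi_\phi J},e^{\underline\xi_\phi J})\Big).$$ *)

(* Defs.v *)
From HB Require Import structures.
From mathcomp Require Import all_boot all_order all_algebra.
From mathcomp Require Import complex.
From mathcomp Require Import all_classical all_reals all_analysis.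

Set Implicit Arguments.
Unset Strict Implicit.
Unset Printing Implicit Defensive.

Import Order.TTheory GRing.Theory Num.Theory.
Import numFieldNormedType.Exports.

Local Open Scope ring_scope.
Local Open Scope complex_scope.
Local Open Scope classical_set_scope.

Section Smoothness.
Variable R : realType.

(* Quantifying over all directions v makes this the usual C^k class on an open
   subset D of a finite-dimensional E. *)
Fixpoint class_C (k : nat) (E F : normedModType R) (D : set E) (f : E -> F)
    : Prop :=
  (forall z, D z -> {for z, continuous f}) /\
  (if k is k'.+1 then
     forall v, (forall z, D z -> derivable f z v) /\ class_C k' D ('D_v f)
   else True).

Definition smooth_in (E F : normedModType R) (D : set E) (f : E -> F) :=
  forall k, class_C k D f.

Definition smooth_nonneg (f : R -> R) :=
  exists2 g : R -> R, smooth_in setT g & forall r, 0 <= r -> f r = g r.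

End Smoothness.

Section Euclidean.
Variable R : realType.

(* The squared Euclidean norm; MathComp-Analysis' norm `|M| on matrices is the
   sup norm. *)
Definition sqnorm m n (M : 'M[R]_(m, n)) : R := \sum_i \sum_j M i j ^+ 2.

Definition dot m (u v : 'cV[R]_m) : R := \sum_i u i 0 * v i 0.

Definition J : 'M[R]_2 :=
  \matrix_(i, j) (nth [::] [:: [:: 0; 1]; [:: -1; 0]] i)`_j.

(* exp(theta J), in closed form since J^2 = -1 *)
Definition expJ (theta : R) : 'M[R]_2 := (cos theta)%:M + sin theta *: J.

End Euclidean.

Arguments J {R}.

(* Points of R x R^(d-1) are z : 'rV_n.+1 with n = d - 1, and x = z 0 0. *)
Section Functionals.
Variables (R : realType) (n : nat).

Definition state := 'rV[R]_n.+1 -> 'cV[R]_2.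

Definition density := 'cV[R]_2 -> 'M[R]_(2, n.+1) -> R.

Definition grad (U : state) (z : 'rV[R]_n.+1) : 'M[R]_(2, n.+1) :=
  \matrix_(i, j) 'D_(delta_mx 0 j) (fun z' => U z' i 0) z.

Definition functional (A : density) (U : state) (z : 'rV[R]_n.+1) : R :=
  A (U z) (grad U z).

Definition grad_U (A : density) (u : 'cV[R]_2) (G : 'M[R]_(2, n.+1))
    : 'cV[R]_2 :=
  \col_i 'D_(delta_mx i 0) (fun u' => A u' G) u.

Definition grad_nablaU (A : density) (u : 'cV[R]_2) (G : 'M[R]_(2, n.+1))
    : 'M[R]_(2, n.+1) :=
  \matrix_(i, j) 'D_(delta_mx i j) (fun G' => A u G') G.

Definition div (M : 'rV[R]_n.+1 -> 'M[R]_(2, n.+1)) (z : 'rV[R]_n.+1)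
    : 'cV[R]_2 :=
  \col_i \sum_j 'D_(delta_mx 0 j) (fun z' => M z' i j) z.

Definition vargrad (A : density) (U : state) : state := fun z =>
  grad_U A (U z) (grad U z) - div (fun z' => grad_nablaU A (U z') (grad U z')) z.

Definition lin (F : normedModType R) (T : state -> 'rV[R]_n.+1 -> F)
    (U V : state) (z : 'rV[R]_n.+1) : F :=
  derive1 (fun s : R => T (fun z' => U z' + s *: V z') z) 0.

Definition Hess (A : density) : state -> state -> state := lin (vargrad A).

Definition planar (V : R -> 'cV[R]_2) : state := fun z => V (z 0 0).

Definition on_axis (x : R) : 'rV[R]_n.+1 := x *: delta_mx 0 0.

Section Densities.
Variables kappa W : R -> R.

Definition H0 : density := fun u G =>
  2^-1 * kappa (sqnorm u) * sqnorm G + W (sqnorm u).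

Definition Mass : density := fun u _ => 2^-1 * sqnorm u.

Definition Q1 : density := fun u G => 2^-1 * dot (J *m u) (col 0 G).

Definition Hu (omega c : R) : density := fun u G =>
  H0 u G - omega * Mass u G + c * Q1 u G.

End Densities.
End Functionals.

Section Waves.
Variables (R : realType) (n : nat) (kappa W : R -> R).

Record wave_profile (omega c : R) (V : R -> 'cV[R]_2) (X xi : R) : Prop := {
  wp_smooth : smooth_in setT V ;
  wp_eq : forall z, vargrad (@Hu R n kappa W omega c) (planar V) z = 0 ;
  wp_period : 0 < X ;
  wp_shift : forall x, V (x + X) = expJ xi *m V x }.

(* A profile with nonconstant modulus, together with the standing conventions
   for such profiles. Nonvanishing is a genuine requirement: it excludes profiles
   like a sign-changing real V, for which mp_xi would make no sense. *)
Record modulated_profile (omega c : R) (V : R -> 'cV[R]_2) (X xi : R) : Prop := {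
  mp_wave : wave_profile omega c V X xi ;
  mp_nonconst : exists x, dot (V x) (derive1 V x) != 0 ;
  mp_nonzero : forall x, V x != 0 ;
  mp_periodic : forall x, sqnorm (V (x + X)) = sqnorm (V x) ;
  mp_fundamental : forall T, 0 < T < X ->
    exists x, sqnorm (V (x + T)) != sqnorm (V x) ;
  mp_xi : xi = \int[lebesgue_measure]_(x in `[0, X])
                 ((sqnorm (V x))^-1 * dot (J *m V x) (derive1 V x)) }.

Definition mu_phi (c : R) (V : R -> 'cV[R]_2) (x : R) : R :=
  kappa (sqnorm (V x)) * dot (J *m V x) (derive1 V x) + c / 2 * sqnorm (V x).

Definition mu_x (omega : R) (V : R -> 'cV[R]_2) (x : R) : R :=
  2^-1 * kappa (sqnorm (V x)) * sqnorm (derive1 V x) - W (sqnorm (V x))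
  + omega / 2 * sqnorm (V x).

(* The coordinates 0, 1, 2, 3 of a : 'rV_4 are omega_phi, c_x, mu_phi, mu_x. *)
Record wave_family (P : set 'rV[R]_4) (Vf : 'rV[R]_4 -> R -> 'cV[R]_2)
    (Xf xif : 'rV[R]_4 -> R) : Prop := {
  wf_open : open P ;
  wf_V_smooth :
    smooth_in (P `*` setT) (fun z : 'rV[R]_4 * R => Vf z.1 z.2) ;
  wf_X_smooth : smooth_in P Xf ;
  wf_xi_smooth : smooth_in P xif ;
  wf_profile : forall a, P a ->
    modulated_profile (a 0 0) (a 0 1) (Vf a) (Xf a) (xif a) ;
  wf_mu_phi : forall a, P a -> forall x,
    mu_phi (a 0 1) (Vf a) x = a 0 2 ;
  wf_mu_x : forall a, P a -> forall x,
    mu_x (a 0 0) (Vf a) x = a 0 3 }.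

Section Sigma.
Variables (V : R -> 'cV[R]_2) (X : R).

Definition Sigma_t (a0 : 'rV[R]_4) (Vf : 'rV[R]_4 -> R -> 'cV[R]_2)
    (Xf xif : 'rV[R]_4 -> R) : 'M[R]_4 :=
  \matrix_(i, j)
    let e : 'rV[R]_4 := delta_mx 0 j in
    let dV (x : R) := 'D_e (Vf ^~ x) a0 in
    let dX := 'D_e Xf a0 in
    let row (A : density R n) :=
      (\int[lebesgue_measure]_(x in `[0, X])
         lin (functional A) (planar V) (planar dV) (on_axis n x))
      + functional A (planar V) (on_axis n 0) * dX in
    [:: 'D_e xif a0; dX; row (@Mass R n); row (@Q1 R n)]`_i.

Definition Sigma_y : 'M[R]_4 :=
  let I (f : R -> R) :=
    \int[lebesgue_measure]_(x in `[0, X]) (kappa (sqnorm (V x)) * f x) in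
  \matrix_(i, j)
    (nth [::]
       [:: [:: 0; 0; 0; 0];
           [:: 0; 0; 0; 0];
           [:: I (fun x => sqnorm (V x));
               - I (fun x => dot (J *m V x) (derive1 V x)); 0; 0];
           [:: I (fun x => dot (derive1 V x) (J *m V x));
               - I (fun x => sqnorm (derive1 V x)); 0; 0]] i)`_j.

End Sigma.
End Waves.

Section Evans.
Variables (R : realType) (n : nat) (kappa W : R -> R).
Local Notation C := R[i].

Definition mxC p q (M : 'M[R]_(p, q)) : 'M[C]_(p, q) :=
  map_mx (fun r => r%:C) M.

(* The C-linear extension of a real operator T. *)
Definition extC (T : (R -> 'cV[R]_2) -> R -> 'cV[R]_2)
    (psi : R -> 'cV[C]_2) (x : R) : 'cV[C]_2 :=
  \col_i (T (fun y => map_mx (@complex.Re R) (psi y)) x i 0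
          +i* T (fun y => map_mx (@complex.Im R) (psi y)) x i 0).

Definition expi (theta : R) : C := cos theta +i* sin theta.

Section Profile.
Variables (omega c : R) (V : R -> 'cV[R]_2).

Definition HessV (psi : R -> 'cV[R]_2) (x : R) : 'cV[R]_2 :=
  Hess (@Hu R n kappa W omega c) (planar V) (planar psi) (on_axis n x).

Definition spectral_eq (lambda : C) (eta : 'rV[R]_n) (psi : R -> 'cV[C]_2)
    (x : R) : Prop :=
  mxC J *m extC HessV psi x
  + (sqnorm eta * kappa (sqnorm (V x)))%:C *: (mxC J *m psi x)
  = lambda *: psi x.

(* S x maps (psi 0, psi_x 0) to (psi x, psi_x x) for every solution psi. *)
Record solution_operator (lambda : C) (eta : 'rV[R]_n)
    (S : R -> 'M[C]_(2 + 2)) : Prop := {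
  so_init : S 0 = 1%:M ;
  so_derivable : forall i j x,
    derivable (fun y => complex.Re (S y i j)) x 1 /\
    derivable (fun y => complex.Im (S y i j)) x 1 ;
  so_deriv : forall (w : 'cV[C]_(2 + 2)) x,
    extC (@derive1 R 'cV[R]_2) (fun y => usubmx (S y *m w)) x
    = dsubmx (S x *m w) ;
  so_eq : forall (w : 'cV[C]_(2 + 2)) x,
    spectral_eq lambda eta (fun y => usubmx (S y *m w)) x }.

End Profile.

Definition Evans (X xi_phi : R) (S : R -> 'M[C]_(2 + 2)) (xi : R) : C :=
  \det (S X - expi xi *: block_mx (mxC (expJ xi_phi)) 0 0 (mxC (expJ xi_phi))).

End Evans.

(* Main.v *)
(** Write the spectral problem as y' = (A + lambda B + h D) y with h = |eta|^2.
   At (lambda, h) = (0, 0) it is solved by the rotation and translation modes Y1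
   and by the derivatives Y2 of the profile in (mu_phi, mu_x), while the
   derivatives Z in (omega_phi, c_x) solve Z' = A Z + B Y1. Hence Y1 + lambda Z and
   Y2 are solutions up to O(|lambda|^2 + h) and O(|lambda| + h). Differentiating
   V(X + .) = exp(xi J) V in the parameters gives the monodromy of Y1, Y2, Z in
   terms of the derivatives of xi and X: these are the first two rows of Sigma_t.
   The last two rows, and Sigma_y, come from the linearizations ell of mu_phi and
   mu_x, which are conserved by y' = A y, so that along the perturbed system they
   vary by integrals of ell (lambda B + h D) y. In the basis (Y1 + lambda Z, Y2)
   and with the rows weighted by ell, the matrix of the Evans function has 2 x 2
   blocks of sizes (r, 1; q, r), where r = |lambda| + |xi| + h and
   q = |lambda| (|lambda| + |xi|) + h, each known up to an error of sizes
   (q, r; r q, q). The Leibniz formula turns this into an error r q (r^2 + q) on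
   the determinant, and conjugating the main part by diag(1, 1, lambda, lambda)
   yields lambda Sigma_t - (e^{i xi} - 1) + (h / lambda) Sigma_y. *)

(* At lambda = h = 0, the monodromy with the rotation removed is unipotent, with matrix (1, Q; 0, 1)
   in the basis (Y1, Y2). A single error size for all sixteen entries would be too coarse for the
   determinant, hence the weights by blocks.

   The lower left block is of second order in lambda for two reasons: [ell] kills Y1, and the
   first-order contribution, the integral of [ell B Y1], vanishes. Indeed the entries of [ell B Y1]
   are 0 or derivatives of minus the mass, which is periodic because rotations preserve the modulus.

   The boundary terms of Sigma_t come from [ell] on Z, which is not 0: mu_phi and mu_x depend
   explicitly on c_x and omega_phi, and this leaves multiples of the mass. A row operation trades
   them for products of the mass with the derivatives of xi and X. In the row of Q1, an integration
   by parts replaces the boundary term in the derivative of X by one in the derivative of xi.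

   The basis (Y1 + lambda Z, Y2) moves with lambda, which produces a factor det(1 + O(lambda)). It
   is also put on the main part, and cancelled at the end since it stays away from 0. *)
Require Import Defs.
From HB Require Import structures.
From mathcomp Require Import all_boot all_order all_algebra.
From mathcomp Require Import perm ring lra.
From mathcomp Require Import complex.
From mathcomp Require Import all_classical all_reals all_analysis.

Set Implicit Arguments.
Unset Strict Implicit.
Unset Printing Implicit Defensive.

Import Order.TTheory GRing.Theory Num.Theory.
Import numFieldNormedType.Exports.

Local Open Scope ring_scope.
Local Open Scope complex_scope.
Local Open Scope classical_set_scope.

(** * Complex matrices and curves *)

Section ComplexMatrixNorm.
Variable R : realType.
Local Notation C := R[i].
Local Notation normc := (@Normc.normc R).

Lemma normc_ge0 (z : C) : 0 <= normc z.
Proof. by case: z => a b /=; exact: sqrtr_ge0. Qed.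

Lemma normcR (r : R) : normc r%:C = `|r|.
Proof. by rewrite /= expr0n /= addr0 sqrtr_sqr. Qed.

Lemma sqr_normc_ReIm (z : C) : normc z ^+ 2 = complex.Re z ^+ 2 + complex.Im z ^+ 2.
Proof. by case: z => a b /=; rewrite sqr_sqrtr // addr_ge0 ?sqr_ge0. Qed.

Lemma normc_sum (I : Type) (s : seq I) (P : pred I) (F : I -> C) :
  normc (\sum_(i <- s | P i) F i) <= \sum_(i <- s | P i) normc (F i).
Proof.
elim/big_ind2 : _ => [|x1 x2 y1 y2 h1 h2|//]; first by rewrite Normc.normc0.
exact: le_trans (le_normcD _ _) (lerD h1 h2).
Qed.

Lemma normc_conj (z : C) : normc z^* = normc z.
Proof. by case: z => a b /=; rewrite sqrrN. Qed.

Lemma Re_le_normc (z : C) : `|complex.Re z| <= normc z.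
Proof. by case: z => a b /=; rewrite -sqrtr_sqr ler_sqrt ?lerDl ?addr_ge0 ?sqr_ge0. Qed.

Lemma Im_le_normc (z : C) : `|complex.Im z| <= normc z.
Proof. by case: z => a b /=; rewrite -sqrtr_sqr ler_sqrt ?lerDr ?addr_ge0 ?sqr_ge0. Qed.

Lemma normc_le_ReIm (z : C) : normc z <= `|complex.Re z| + `|complex.Im z|.
Proof.
case: z => a b /=; rewrite -(@ger0_norm _ (`|a| + `|b|)) ?addr_ge0 // -sqrtr_sqr.
rewrite ler_sqrt ?sqr_ge0 // sqrrD !real_normK ?num_real //.
by have := mulr_ge0 (normr_ge0 a) (normr_ge0 b); lra.
Qed.

(** The entrywise sum norm: it is submultiplicative and bounds every entry, without dimensional
    factors. *)
Definition mnorm m n (M : 'M[C]_(m, n)) : R := \sum_i \sum_j normc (M i j).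

Lemma mnorm_ge0 m n (M : 'M[C]_(m, n)) : 0 <= mnorm M.
Proof. by apply: sumr_ge0 => i _; apply: sumr_ge0 => j _; exact: normc_ge0. Qed.

Lemma normc_le_mnorm m n (M : 'M[C]_(m, n)) i j : normc (M i j) <= mnorm M.
Proof.
rewrite /mnorm (bigD1 i) //= (bigD1 j) //= -addrA lerDl addr_ge0 //.
  by apply: sumr_ge0 => k _; exact: normc_ge0.
by apply: sumr_ge0 => k _; apply: sumr_ge0 => l _; exact: normc_ge0.
Qed.

Lemma mnormD m n (M N : 'M[C]_(m, n)) : mnorm (M + N) <= mnorm M + mnorm N.
Proof.
rewrite /mnorm -big_split /=; apply: ler_sum => i _.
by rewrite -big_split /=; apply: ler_sum => j _; rewrite mxE le_normcD.
Qed.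

Lemma mnormZ m n (z : C) (M : 'M[C]_(m, n)) : mnorm (z *: M) = normc z * mnorm M.
Proof.
rewrite /mnorm mulr_sumr; apply: eq_bigr => i _; rewrite mulr_sumr.
by apply: eq_bigr => j _; rewrite mxE Normc.normcM.
Qed.

Lemma mnormN m n (M : 'M[C]_(m, n)) : mnorm (- M) = mnorm M.
Proof.
by rewrite /mnorm; under eq_bigr do under eq_bigr do rewrite mxE normcN.
Qed.

Lemma mnormM m n p (M : 'M[C]_(m, n)) (N : 'M[C]_(n, p)) :
  mnorm (M *m N) <= mnorm M * mnorm N.
Proof.
rewrite /mnorm mulr_suml; apply: ler_sum => i _.
apply: (@le_trans _ _ (\sum_k \sum_j (normc (M i j) * normc (N j k)))).
  apply: ler_sum => k _; rewrite mxE; apply: le_trans (normc_sum _ _ _) _.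
  by apply: ler_sum => j _; rewrite Normc.normcM.
rewrite exchange_big mulr_suml; apply: ler_sum => j _ /=.
rewrite -mulr_sumr ler_wpM2l ?normc_ge0 // (bigD1 j) //= lerDl.
by apply: sumr_ge0 => l _; apply: sumr_ge0 => k _; exact: normc_ge0.
Qed.

End ComplexMatrixNorm.

Section ComplexCurves.
Variable R : realType.
Local Notation C := R[i].

(* R[i] carries no R-normed module structure in the library: derivatives of
   complex curves are taken on real and imaginary parts. *)
Definition cderiv (f : R -> C) (x : R) (l : C) :=
  is_derive x 1 (fun y => complex.Re (f y)) (complex.Re l) /\
  is_derive x 1 (fun y => complex.Im (f y)) (complex.Im l).

Lemma cderiv_ext (f g : R -> C) x l : f =1 g -> cderiv f x l -> cderiv g x l.
Proof. by move=> /funext ->. Qed.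

Lemma cderiv_cst (z : C) x : cderiv (fun=> z) x 0.
Proof. by split; exact: is_derive_cst. Qed.

Lemma cderivR (f : R -> R) (x l : R) : is_derive x 1 f l -> cderiv (fun y => (f y)%:C) x l%:C.
Proof. by move=> h; split => //=; exact: is_derive_cst. Qed.

Lemma cderivD (f g : R -> C) x k l :
  cderiv f x k -> cderiv g x l -> cderiv (fun y => f y + g y) x (k + l).
Proof.
move=> [f1 f2] [g1 g2]; split.
  have -> : (fun y => complex.Re (f y + g y)) =
    (fun y => complex.Re (f y)) + (fun y => complex.Re (g y)).
    by apply/funext => y; rewrite /= raddfD.
  by rewrite raddfD; exact: is_deriveD.
have -> : (fun y => complex.Im (f y + g y)) =
  (fun y => complex.Im (f y)) + (fun y => complex.Im (g y)).
  by apply/funext => y; rewrite /= raddfD.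
by rewrite raddfD; exact: is_deriveD.
Qed.

Lemma ReM (a b : C) :
  complex.Re (a * b) = complex.Re a * complex.Re b - complex.Im a * complex.Im b.
Proof. by case: a b => [? ?] [? ?]. Qed.

Lemma ImM (a b : C) :
  complex.Im (a * b) = complex.Re a * complex.Im b + complex.Im a * complex.Re b.
Proof. by case: a b => [? ?] [? ?]. Qed.

Lemma cderivM (f g : R -> C) x k l :
  cderiv f x k -> cderiv g x l -> cderiv (fun y => f y * g y) x (k * g x + f x * l).
Proof.
move=> [f1 f2] [g1 g2]; split.
  have -> : (fun y => complex.Re (f y * g y)) =
    (fun y => complex.Re (f y)) * (fun y => complex.Re (g y)) -
    (fun y => complex.Im (f y)) * (fun y => complex.Im (g y)).
    by apply/funext => y; rewrite /= ReM.
  rewrite raddfD /= !ReM.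
  apply: (is_derive_eq (is_deriveB (is_deriveM f1 g1) (is_deriveM f2 g2))).
  by rewrite /GRing.scale /=; ring.
have -> : (fun y => complex.Im (f y * g y)) =
  (fun y => complex.Re (f y)) * (fun y => complex.Im (g y)) +
  (fun y => complex.Im (f y)) * (fun y => complex.Re (g y)).
  by apply/funext => y; rewrite /= ImM.
rewrite raddfD /= !ImM.
apply: (is_derive_eq (is_deriveD (is_deriveM f1 g2) (is_deriveM f2 g1))).
by rewrite /GRing.scale /=; ring.
Qed.

Lemma cderiv_sum (I : Type) (s : seq I) (F : I -> R -> C) x (l : I -> C) :
  (forall i, cderiv (F i) x (l i)) ->
  cderiv (fun y => \sum_(i <- s) F i y) x (\sum_(i <- s) l i).
Proof.
move=> h; elim: s => [|i s IH].
  rewrite big_nil; apply: cderiv_ext (cderiv_cst 0 x) => y.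
  by rewrite big_nil.
rewrite big_cons; apply: cderiv_ext (cderivD (h i) IH) => y.
by rewrite big_cons.
Qed.

Definition mxderiv m n (F : R -> 'M[C]_(m, n)) (x : R) (F' : 'M[C]_(m, n)) :=
  forall i j, cderiv (fun y => F y i j) x (F' i j).

Lemma mxderiv_cst m n (M : 'M[C]_(m, n)) x : mxderiv (fun=> M) x 0.
Proof. by move=> i j; rewrite mxE; exact: cderiv_cst. Qed.

Lemma mxderivD m n (F G : R -> 'M[C]_(m, n)) x F' G' :
  mxderiv F x F' -> mxderiv G x G' -> mxderiv (fun y => F y + G y) x (F' + G').
Proof.
move=> hF hG i j; rewrite mxE; apply: cderiv_ext (cderivD (hF i j) (hG i j)) => y.
by rewrite mxE.
Qed.

Lemma mxderivM m n p (F : R -> 'M[C]_(m, n)) (G : R -> 'M[C]_(n, p)) x F' G' :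
  mxderiv F x F' -> mxderiv G x G' ->
  mxderiv (fun y => F y *m G y) x (F' *m G x + F x *m G').
Proof.
move=> hF hG i j; rewrite !mxE -big_split /=.
have := cderiv_sum (index_enum _) (fun k => cderivM (hF i k) (hG k j)).
by apply: cderiv_ext => y; rewrite mxE.
Qed.

Lemma mxderivZ m n (F : R -> 'M[C]_(m, n)) x F' (z : C) :
  mxderiv F x F' -> mxderiv (fun y => z *: F y) x (z *: F').
Proof.
move=> hF i j; rewrite mxE.
have := cderivM (cderiv_cst z x) (hF i j); rewrite mul0r add0r.
by apply: cderiv_ext => y; rewrite mxE.
Qed.

Lemma mxderivN m n (F : R -> 'M[C]_(m, n)) x F' :
  mxderiv F x F' -> mxderiv (fun y => - F y) x (- F').
Proof.
move=> /(mxderivZ (-1)); rewrite scaleN1r => h i j.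
by apply: cderiv_ext (h i j) => y; rewrite scaleN1r.
Qed.

Lemma mxderivB m n (F G : R -> 'M[C]_(m, n)) x F' G' :
  mxderiv F x F' -> mxderiv G x G' -> mxderiv (fun y => F y - G y) x (F' - G').
Proof. by move=> hF /mxderivN; exact: mxderivD. Qed.

End ComplexCurves.

(** * Mean value estimates and Gronwall's inequality *)

Section MeanValue.
Variable R : realType.
Local Notation C := R[i].
Local Notation normc := (@Normc.normc R).

Lemma is_derive_continuous (f : R -> R) (x l : R) : is_derive x 1 f l -> {for x, continuous f}.
Proof. by case=> h _; apply: differentiable_continuous; apply/derivable1_diffP. Qed.

Lemma mean_value (f f' : R -> R) (a b : R) : a <= b ->
  (forall x, a <= x <= b -> is_derive x 1 f (f' x)) ->
  exists2 c, a <= c <= b & f b - f a = f' c * (b - a).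
Proof.
move=> ab df; have [||c] := @MVT_segment R f f' a b ab.
- by move=> x; rewrite in_itv /= => /andP[ax xb]; apply: df; rewrite !ltW.
- apply/continuous_in_subspaceT => x; rewrite inE/= in_itv /= => xab.
  exact: is_derive_continuous (df x xab).
by rewrite in_itv /=; exists c.
Qed.

Lemma le_increment (f f' : R -> R) (e a b : R) : a <= b ->
  (forall x, a <= x <= b -> is_derive x 1 f (f' x)) ->
  (forall x, a <= x <= b -> `|f' x| <= e) -> `|f b - f a| <= (b - a) * e.
Proof.
move=> ab df hf; have [c cab ->] := mean_value ab df.
by rewrite normrM mulrC ger0_norm ?subr_ge0 // ler_wpM2l ?subr_ge0 // hf.
Qed.

(** The mean value theorem fails for complex curves, so it is applied to the real and imaginary
    parts of each entry; this costs the factors [2] and [m%:R * n%:R]. *)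
Lemma mnorm_increment m n (F F' : R -> 'M[C]_(m, n)) (e a b : R) : a <= b ->
  (forall x, a <= x <= b -> mxderiv F x (F' x)) ->
  (forall x, a <= x <= b -> mnorm (F' x) <= e) ->
  mnorm (F b - F a) <= m%:R * n%:R * (2 * (b - a)) * e.
Proof.
move=> ab dF hF; have bound i j : normc ((F b - F a) i j) <= 2 * (b - a) * e.
  apply: le_trans (normc_le_ReIm _) _; rewrite -mulrA mulr2n mulrDl mul1r.
  rewrite !mxE !raddfB /=; apply: lerD.
    apply: (le_increment ab (fun x hx => (dF x hx i j).1)) => x hx.
    by apply: le_trans (Re_le_normc _) _; apply: le_trans (normc_le_mnorm _ _ _) (hF x hx).
  apply: (le_increment ab (fun x hx => (dF x hx i j).2)) => x hx.
  by apply: le_trans (Im_le_normc _) _; apply: le_trans (normc_le_mnorm _ _ _) (hF x hx).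
rewrite /mnorm; apply: (@le_trans _ _ (\sum_(i < m) \sum_(j < n) 2 * (b - a) * e)).
  by apply: ler_sum => i _; apply: ler_sum => j _; exact: bound.
rewrite !sumr_const !card_ord -mulrnA -[leLHS]mulr_natl natrM.
rewrite le_eqVlt; apply/orP; left; apply/eqP; ring.
Qed.

Lemma is_derive_normc_sqr (f : R -> C) (x : R) (l : C) : cderiv f x l ->
  is_derive x 1 (fun y => normc (f y) ^+ 2) (2 * complex.Re ((f x)^* * l)).
Proof.
move=> [h1 h2].
have -> : (fun y => normc (f y) ^+ 2) =
  (fun y => complex.Re (f y)) * (fun y => complex.Re (f y)) +
  (fun y => complex.Im (f y)) * (fun y => complex.Im (f y)).
  by apply/funext => y; rewrite sqr_normc_ReIm !expr2.
apply: (is_derive_eq (is_deriveD (is_deriveM h1 h1) (is_deriveM h2 h2))).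
rewrite ReM /GRing.scale /=; case: (f x) => u v /=; ring.
Qed.

Lemma is_derive_fsum (I : finType) (f : I -> R -> R) (x : R) (l : I -> R) :
  (forall i, is_derive x 1 (f i) (l i)) ->
  is_derive x 1 (fun y => \sum_i f i y) (\sum_i l i).
Proof.
move=> h; have [H _] := cderiv_sum (index_enum I) (fun i => cderivR (h i)).
have -> : (fun y => \sum_i f i y) = (fun y => complex.Re (\sum_i (f i y)%:C)).
  by apply/funext => y; rewrite -rmorph_sum.
by move: H; rewrite -rmorph_sum.
Qed.

(** The squared Frobenius norm, differentiable along a curve where [mnorm] need not be. *)
Definition fnorm2 m n (M : 'M[C]_(m, n)) : R := \sum_i \sum_j normc (M i j) ^+ 2.

Lemma mnorm_le_fnorm2 m n (M : 'M[C]_(m, n)) :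
  mnorm M ^+ 2 <= (m%:R * n%:R) ^+ 2 * fnorm2 M.
Proof.
have f0 : 0 <= fnorm2 M.
  by apply: sumr_ge0 => i _; apply: sumr_ge0 => j _; exact: sqr_ge0.
have bound i j : normc (M i j) <= Num.sqrt (fnorm2 M).
  rewrite -(ger0_norm (normc_ge0 (M i j))) -sqrtr_sqr ler_sqrt // /fnorm2.
  rewrite (bigD1 i) //= (bigD1 j) //= -addrA lerDl addr_ge0 //.
    by apply: sumr_ge0 => k _; exact: sqr_ge0.
  by apply: sumr_ge0 => k _; apply: sumr_ge0 => l _; exact: sqr_ge0.
have : mnorm M <= m%:R * n%:R * Num.sqrt (fnorm2 M).
  apply: (@le_trans _ _ (\sum_(i < m) \sum_(j < n) Num.sqrt (fnorm2 M))).
    by apply: ler_sum => i _; apply: ler_sum => j _; exact: bound.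
  by rewrite !sumr_const !card_ord -mulrnA -[leLHS]mulr_natl natrM [n%:R * _]mulrC.
move=> h; rewrite -[fnorm2 M in leRHS]sqr_sqrtr // -exprMn.
by rewrite lerXn2r // ?nnegrE ?mulr_ge0 ?mnorm_ge0 ?sqrtr_ge0.
Qed.

(* Energy estimate: [fnorm2 D] satisfies the scalar inequality f' <= a f + e^2. *)
Lemma gronwall m n (X K : R) : 0 <= X -> 0 <= K -> exists2 K', 0 <= K' &
  forall (M : R -> 'M[C]_m) (D r : R -> 'M[C]_(m, n)) (e : R),
  (forall x, 0 <= x <= X -> mxderiv D x (M x *m D x + r x)) ->
  (forall x, 0 <= x <= X -> mnorm (M x) <= K) ->
  (forall x, 0 <= x <= X -> mnorm (r x) <= e) ->
  D 0 = 0 -> forall x, 0 <= x <= X -> mnorm (D x) <= K' * e.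
Proof.
move=> X0 K0; pose N : R := m%:R * n%:R.
(* With m = [mnorm (D y)], the derivative of [fnorm2 (D y)] is at most 2 m (K m + e), hence at most
   (2 K + 1) m^2 + e^2, where m^2 <= N^2 [fnorm2 (D y)]. The last [+ 1] gives 1 <= a, so that e^2 <=
   a e^2 and the inequality becomes homogeneous in [fnorm2 (D y)] + e^2. *)
pose a := (2 * K + 1) * N ^+ 2 + 1.
have a1 : 1 <= a by rewrite lerDr mulr_ge0 ?sqr_ge0 // addr_ge0 ?mulr_ge0.
have N0 : 0 <= N by rewrite mulr_ge0.
(* This depends on the dimensions, [X] and [K] only: one constant serves all lambda and eta. *)
exists (N * expR (a * X)); first by rewrite mulr_ge0 ?expR_ge0.
move=> M D r e dD hM hr D0 x /andP[x0 xX].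
have e0 : 0 <= e by apply: le_trans (mnorm_ge0 _) (hr 0 _); rewrite lexx.
pose f y := fnorm2 (D y).
pose g y := \sum_i \sum_j 2 * complex.Re ((D y i j)^* * (M y *m D y + r y) i j).
have df y : 0 <= y <= X -> is_derive y 1 f (g y).
  move=> hy; apply: is_derive_fsum => i; apply: is_derive_fsum => j.
  exact: is_derive_normc_sqr (dD y hy i j).
have gle y : 0 <= y <= X -> g y <= a * f y + e ^+ 2.
  move=> hy.
  have : g y <= 2 * (mnorm (D y) * (K * mnorm (D y) + e)).
    rewrite /g [mnorm (D y) in X in _ <= 2 * (X * _)]/mnorm mulr_suml mulr_sumr.
    apply: ler_sum => i _; rewrite mulr_suml mulr_sumr; apply: ler_sum => j _.
    rewrite ler_wpM2l //; apply: le_trans (ler_norm _) _.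
    apply: le_trans (Re_le_normc _) _; rewrite Normc.normcM normc_conj.
    rewrite ler_wpM2l ?normc_ge0 //; apply: le_trans (normc_le_mnorm _ _ _) _.
    apply: le_trans (mnormD _ _) _; apply: lerD (hr y hy).
    by apply: le_trans (mnormM _ _) _; rewrite ler_wpM2r ?mnorm_ge0 ?hM.
  move=> /le_trans; apply; have := mnorm_le_fnorm2 (D y); rewrite -/(f y) -/N => hN.
  have := sqr_ge0 (mnorm (D y) - e).
  have f0 : 0 <= f y.
    by apply: sumr_ge0 => i _; apply: sumr_ge0 => j _; exact: sqr_ge0.
  have : (2 * K + 1) * mnorm (D y) ^+ 2 <= (2 * K + 1) * (N ^+ 2 * f y).
    by rewrite ler_wpM2l // addr_ge0 ?mulr_ge0.
  rewrite /a => h1 h2; rewrite !mulrDl mul1r -mulrA.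
  by move: h1 h2 f0; rewrite !expr2; nra.
have fX y : 0 <= y <= X -> f y <= e ^+ 2 * expR (a * X).
  move=> /andP[y0 yX].
  (* Integrating factor: [G] is nonincreasing by the choice of [a]. *)
  pose G z := (f z + e ^+ 2) * expR (- (a * z)).
  have dG z : 0 <= z <= y -> is_derive z 1 G ((g z - a * (f z + e ^+ 2)) * expR (- (a * z))).
    move=> /andP[z0 zy]; have hz : 0 <= z <= X by rewrite z0 (le_trans zy).
    have dz := df z hz.
    have de : is_derive z 1 (fun z => expR (- (a * z))) (- a * expR (- (a * z))).
      have hl : is_derive z 1 (fun z : R => - (a * z)) (- a).
        have -> : (fun z : R => - (a * z)) = (- a) \*: (id : R -> R).
          by apply/funext => w; rewrite /= /GRing.scale /= mulNr.
        apply: is_derive_eq (is_deriveZ (- a) (is_derive_id z 1)) _.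
        by rewrite /GRing.scale /= mulr1.
      by apply: is_derive_eq (is_derive1_comp (is_derive_expR _) hl) _; rewrite mulrC.
    have ds : is_derive z 1 (fun z => f z + e ^+ 2) (g z).
      by apply: is_derive_eq (is_deriveD dz (is_derive_cst (e ^+ 2) z 1)) _; rewrite addr0.
    apply: is_derive_eq (is_deriveM ds de) _; rewrite /GRing.scale /=; ring.
  have [c /andP[c0 cy] hc] := mean_value y0 dG.
  have hle : G y <= G 0.
    rewrite -subr_le0 hc subr0; apply: mulr_le0_ge0 => //.
    apply: mulr_le0_ge0; rewrite ?expR_ge0 //.
    have := gle c; rewrite c0 (le_trans cy yX) => /(_ isT) hg.
    rewrite subr_le0; apply: le_trans hg _; rewrite mulrDr lerD2l.
    by rewrite ler_peMl ?sqr_ge0.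
  have f00 : f 0 = 0.
    rewrite /f D0 /fnorm2; apply: big1 => i _; apply: big1 => j _.
    by rewrite mxE Normc.normc0 expr0n.
  move: hle; rewrite /G f00 mulr0 oppr0 expR0 mulr1 add0r expRN.
  rewrite ler_pdivrMr ?expR_gt0 // => h.
  have : expR (a * y) <= expR (a * X).
    by rewrite ler_expR ler_wpM2l // (le_trans ler01).
  move=> h2; apply: le_trans (le_trans h _); first by rewrite lerDl sqr_ge0.
  by rewrite ler_wpM2l ?sqr_ge0.
have := mnorm_le_fnorm2 (D x); rewrite -/N => h.
have hx : 0 <= x <= X by rewrite x0.
have E1 : 1 <= expR (a * X).
  by rewrite -expR0 ler_expR mulr_ge0 // (le_trans ler01).
rewrite -(ler_pXn2r (n := 2)) ?nnegrE ?mulr_ge0 ?mnorm_ge0 ?expR_ge0 //.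
apply: le_trans h _; apply: le_trans (ler_wpM2l (sqr_ge0 _) (fX x hx)) _.
rewrite !exprMn -mulrA ler_wpM2l ?sqr_ge0 // [leRHS]mulrC ler_wpM2l ?sqr_ge0 //.
by rewrite expr2 ler_peMl ?expR_ge0.
Qed.

End MeanValue.

(** * Perturbation of block determinants *)

Section DetPerturbation.
Variable R : realType.
Local Notation C := R[i].
Local Notation normc := (@Normc.normc R).

Lemma normc_prodB2 (a b c d : C) (w v dw dv : R) :
  normc a <= w -> normc d <= v -> normc (a - b) <= dw -> normc (c - d) <= dv ->
  normc (a * c - b * d) <= dw * v + w * dv.
Proof.
move=> ha hd hab hcd; have -> : a * c - b * d = (a - b) * d + a * (c - d) by ring.
apply: le_trans (le_normcD _ _) _; rewrite !Normc.normcM.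
by apply: lerD; apply: ler_pM; rewrite ?normc_ge0.
Qed.

(** Pairing the factors as (0, 1) and (2, 3) reduces this to three uses of [normc_prodB2]. *)
Lemma normc_prodB4 (a b : 'I_4 -> C) (w d : 'I_4 -> R) :
  (forall i, normc (a i) <= w i) -> (forall i, normc (b i) <= w i) ->
  (forall i, normc (a i - b i) <= d i) ->
  normc (\prod_i a i - \prod_i b i) <=
    (d 0 * w 1 + w 0 * d 1) * (w 2 * w 3) + (w 0 * w 1) * (d 2 * w 3 + w 2 * d 3).
Proof.
move=> ha hb hd; rewrite !(big_ord_recl _) !big_ord0 !mulr1.
have -> : lift ord0 ord0 = 1 :> 'I_4 by apply/val_inj.
have -> : lift ord0 (lift ord0 ord0) = 2 :> 'I_4 by apply/val_inj.
have -> : lift ord0 (lift ord0 (lift ord0 ord0)) = 3 :> 'I_4 by apply/val_inj.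
rewrite (mulrA (a _)) (mulrA (b _)).
have nM x y u v : normc x <= u -> normc y <= v -> normc (x * y) <= u * v.
  by move=> h1 h2; rewrite Normc.normcM; apply: ler_pM; rewrite ?normc_ge0.
by apply: normc_prodB2; (apply: nM || apply: normc_prodB2).
Qed.

(** The sum of the indicator of {0, 1} is unchanged under reindexing by [s]. *)
Lemma perm4_count (s : {perm 'I_4}) :
  ((s 0%R < 2) + (s 1%R < 2) + (s 2%R < 2) + (s 3%R < 2) = 2)%N.
Proof.
have : (\sum_(i < 4) (s i < 2) = \sum_(i < 4) (i < 2))%N.
  by rewrite [RHS](reindex_inj (@perm_inj _ s)).
rewrite !big_ord_recl !big_ord0 !addn0 !addnA => /=.
have -> : lift ord0 ord0 = 1 :> 'I_4 by apply/val_inj.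
have -> : lift ord0 (lift ord0 ord0) = 2 :> 'I_4 by apply/val_inj.
by have -> : lift ord0 (lift ord0 (lift ord0 ord0)) = 3 :> 'I_4 by apply/val_inj.
Qed.

(* By [perm4_count], a Leibniz term has as many factors in the upper right block (weight 1)
   as in the lower left one (weight q). *)
Definition block_weight (r q : R) (i j : nat) : R :=
  if (i < 2)%N then if (j < 2)%N then r else 1 else if (j < 2)%N then q else r.

(** Relative to [block_weight], the error is r in the off-diagonal blocks and q / r in the diagonal
    ones. Thus the weight r^4 of a term that stays in the diagonal blocks is perturbed by r^3 q
    only. *)
Definition block_error (r q : R) (i j : nat) : R :=
  if (i < 2)%N then if (j < 2)%N then q else r else if (j < 2)%N then r * q else q.

Lemma det_block_perturb (M N : 'M[C]_4) (K r q : R) : 0 <= K -> 0 <= r -> 0 <= q ->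
  (forall i j, normc (M i j) <= K * block_weight r q i j) ->
  (forall i j, normc (N i j) <= K * block_weight r q i j) ->
  (forall i j, normc (M i j - N i j) <= K * block_error r q i j) ->
  normc (\det M - \det N) <= 96 * K ^+ 4 * (r * q * (r ^+ 2 + q)).
Proof.
move=> K0 r0 q0 hM hN hMN; rewrite /determinant -sumrB.
apply: le_trans (normc_sum _ _ _) _.
(* 96 = 24 * 4: there are 24 permutations, and in each term four factors are replaced one at a
   time. *)
have -> : 96 * K ^+ 4 * (r * q * (r ^+ 2 + q)) =
    \sum_(s : {perm 'I_4}) 4 * K ^+ 4 * (r * q * (r ^+ 2 + q)).
  rewrite sumr_const card_Sn -[RHS]mulr_natl.
  have -> : 4`!%:R = 24 :> R by []; ring.
apply: ler_sum => s _; rewrite -mulrBr Normc.normcM.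
have -> : normc ((-1) ^+ s) = 1.
  by case: (odd_perm s); rewrite ?expr0 ?expr1 ?normcN Normc.normc1.
rewrite mul1r.
apply: le_trans (normc_prodB4 (fun i => hM i (s i)) (fun i => hN i (s i)) (fun i => hMN i (s i))) _.
have hr : 0 <= r * q ^+ 2 by rewrite mulr_ge0 ?sqr_ge0.
have hq : 0 <= r ^+ 3 * q by rewrite mulr_ge0 ?exprn_ge0.
have K4 : 0 <= K ^+ 4 by rewrite exprn_ge0.
have hr' := mulr_ge0 K4 hr; have hq' := mulr_ge0 K4 hq.
(* Of the sixteen patterns, the count leaves those of weight r^4, r^2 q and q^2; their perturbations
   are bounded by multiples of r^3 q and r q^2. *)
have := perm4_count s; rewrite /block_weight /block_error /=.
by case: (s 0%R < 2)%N; case: (s 1%R < 2)%N; case: (s 2%R < 2)%N; case: (s 3%R < 2)%N => //= _; nra.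
Qed.

End DetPerturbation.

(** * Solutions and invariants up to higher order *)

(* Linear identities between matrices, products being atoms. *)
Ltac mxatoms :=
  repeat match goal with |- context [@mulmx ?T ?m ?n ?p ?M ?N] =>
    lazymatch constr:((M, N)) with context [@mulmx _ _ _ _ _ _] => fail | _ => idtac end;
    let P := fresh "P" in
    pose P := @mulmx T m n p M N;
    repeat match goal with |- context [@mulmx ?T' ?m' ?n' ?p' M N] =>
      change (@mulmx T' m' n' p' M N) with P end;
    clearbody P
  end.
Ltac mxlin := mxatoms; apply/matrixP => i j; rewrite !mxE; ring.

Section UnfoldingMonodromy.
Variable R : realType.
Local Notation C := R[i].
Local Notation normc := (@Normc.normc R).

Lemma mnormM_le m n p (M : 'M[C]_(m, n)) (N : 'M[C]_(n, p)) a b :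
  mnorm M <= a -> mnorm N <= b -> mnorm (M *m N) <= a * b.
Proof.
move=> h1 h2; apply: le_trans (mnormM _ _) _.
by apply: ler_pM; rewrite ?mnorm_ge0.
Qed.

Lemma mnormD_le m n (M N : 'M[C]_(m, n)) a b :
  mnorm M <= a -> mnorm N <= b -> mnorm (M + N) <= a + b.
Proof. by move=> h1 h2; apply: le_trans (mnormD _ _) (lerD h1 h2). Qed.

Lemma mnormZ_le m n (M : 'M[C]_(m, n)) (z : C) t a :
  normc z <= t -> mnorm M <= a -> mnorm (z *: M) <= t * a.
Proof. by move=> h1 h2; rewrite mnormZ; apply: ler_pM; rewrite ?mnorm_ge0 ?normc_ge0. Qed.

Lemma mxderiv_eq m n (F : R -> 'M[C]_(m, n)) x F' F'' :
  mxderiv F x F' -> F' = F'' -> mxderiv F x F''.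
Proof. by move=> h <-. Qed.

Variables (X : R) (A B D : R -> 'M[C]_(2 + 2)).
Variables (Y1 Y2 Z : R -> 'M[C]_(2 + 2, 2)) (ell : R -> 'M[C]_(2, 2 + 2)).
Variables (K : R).
Local Notation "'on' x , P" := (forall x : R, 0 <= x <= X -> P)
  (at level 200, x name, only parsing).
Hypothesis X0 : 0 <= X.
Hypothesis K0 : 0 <= K.
Hypothesis dY1 : (on x, mxderiv Y1 x (A x *m Y1 x)).
Hypothesis dY2 : (on x, mxderiv Y2 x (A x *m Y2 x)).
Hypothesis dZ : (on x, mxderiv Z x (A x *m Z x + B x *m Y1 x)).
Hypothesis dell : (on x, mxderiv ell x (- (ell x *m A x))).
Hypothesis AK : (on x, mnorm (A x) <= K).
Hypothesis BK : (on x, mnorm (B x) <= K).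
Hypothesis DK : (on x, mnorm (D x) <= K).
Hypothesis Y1K : (on x, mnorm (Y1 x) <= K).
Hypothesis Y2K : (on x, mnorm (Y2 x) <= K).
Hypothesis ZK : (on x, mnorm (Z x) <= K).
Hypothesis ellK : (on x, mnorm (ell x) <= K).
Variables (J1 JZ J2 JD : R -> 'M[C]_2).
Hypothesis dJ1 : (on x, mxderiv J1 x (ell x *m B x *m Y1 x)).
Hypothesis dJZ : (on x, mxderiv JZ x (ell x *m B x *m Z x)).
Hypothesis dJ2 : (on x, mxderiv J2 x (ell x *m B x *m Y2 x)).
Hypothesis dJD : (on x, mxderiv JD x (ell x *m D x *m Y1 x)).
Hypothesis J1X : J1 X = J1 0.

Section Fixed.
Variables (lambda : C) (h : R) (S : R -> 'M[C]_(2 + 2)).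
Local Notation l := (normc lambda).
Hypothesis l1 : l <= 1.
Hypothesis h01 : 0 <= h <= 1.
Hypothesis S0 : S 0 = 1%:M.
Local Notation M x := (A x + lambda *: B x + h%:C *: D x).
Hypothesis dS : (on x, mxderiv S x (M x *m S x)).

Let W1 x := S x *m (Y1 0 + lambda *: Z 0).
Let W2 x := S x *m Y2 0.
Let D1 x := W1 x - (Y1 x + lambda *: Z x).
Let D2 x := W2 x - Y2 x.

Let hh : normc h%:C = h.
Proof. by rewrite normcR ger0_norm //; case/andP: h01. Qed.

Let l0 : 0 <= l. Proof. exact: normc_ge0. Qed.

Let MK : (on x, mnorm (M x) <= 3 * K).
Proof.
move=> x hx; have -> : 3 * K = K + 1 * K + 1 * K by ring.
apply: mnormD_le; first apply: mnormD_le; rewrite ?AK //.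
  by apply: mnormZ_le; rewrite ?BK.
by apply: mnormZ_le; rewrite ?DK // hh; case/andP: h01.
Qed.

Let dW m (V : 'M[C]_(2 + 2, m)) :
  (on x, mxderiv (fun y => S y *m V) x (M x *m (S x *m V))).
Proof.
move=> x hx; apply: mxderiv_eq (mxderivM (dS hx) (mxderiv_cst V x)) _.
by rewrite mulmx0 addr0 mulmxA.
Qed.

Let dD1 : (on x, mxderiv D1 x (M x *m D1 x +
  (lambda ^+ 2 *: (B x *m Z x) + h%:C *: (D x *m (Y1 x + lambda *: Z x))))).
Proof.
move=> x hx.
apply: mxderiv_eq (mxderivB (dW _ hx) (mxderivD (dY1 hx) (mxderivZ lambda (dZ hx)))) _.
rewrite /D1 -/(W1 x) mulmxBr.
rewrite !mulmxDl !mulmxDr -!scalemxAl -!scalemxAr.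
mxlin.
Qed.

Let dD2 : (on x, mxderiv D2 x (M x *m D2 x +
  (lambda *: (B x *m Y2 x) + h%:C *: (D x *m Y2 x)))).
Proof.
move=> x hx; apply: mxderiv_eq (mxderivB (dW _ hx) (dY2 hx)) _.
rewrite /D2 -/(W2 x) mulmxBr.
rewrite !mulmxDl -!scalemxAl; mxlin.
Qed.

Variable K' : R.
(** Assumed here rather than taken from [gronwall], so that [det_expansion] can fix [K'] before
    lambda, h and S. *)
Hypothesis gron : forall (M : R -> 'M[C]_(2 + 2)) (D r : R -> 'M[C]_(2 + 2, 2)) (e : R),
  (forall x, 0 <= x <= X -> mxderiv D x (M x *m D x + r x)) ->
  (forall x, 0 <= x <= X -> mnorm (M x) <= 3 * K) ->
  (forall x, 0 <= x <= X -> mnorm (r x) <= e) ->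
  D 0 = 0 -> forall x, 0 <= x <= X -> mnorm (D x) <= K' * e.

Hypothesis K'0 : 0 <= K'.

Let W1S x : W1 x = D1 x + (Y1 x + lambda *: Z x). Proof. by rewrite /D1 subrK. Qed.
Let W2S x : W2 x = D2 x + Y2 x. Proof. by rewrite /D2 subrK. Qed.

(** The forcing of [D1] has no term of order lambda: the contributions of [B Y1] cancel by the
    equation of [Z]. What remains is lambda^2 B Z + h D (Y1 + lambda Z). *)
Lemma D1_le : (on x, mnorm (D1 x) <= K' * (2 * K ^+ 2 * (l ^+ 2 + h))).
Proof.
have /andP[h0 h1] := h01.
apply: (gron dD1); first exact: MK.
- move=> x hx; apply: (@le_trans _ _ (l ^+ 2 * (K * K) + h * (K * (K + l * K)))).
    apply: mnormD_le; apply: mnormZ_le; rewrite ?hh ?expr2 ?Normc.normcM //.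
      by apply: mnormM_le; [exact: BK|exact: ZK].
    apply: mnormM_le; [exact: DK|].
    by apply: mnormD_le; [exact: Y1K|apply: mnormZ_le => //; exact: ZK].
  have := mulr_ge0 h0 (sqr_ge0 K); have := mulr_ge0 (sqr_ge0 l) (sqr_ge0 K).
  have := mulr_ge0 (mulr_ge0 h0 (sqr_ge0 K)) (eqbRL (subr_ge0 _ _) l1); nra.
by rewrite /D1 /W1 S0 mul1mx subrr.
Qed.

(** No corrector is attached to [Y2], so the forcing keeps the first-order term lambda B Y2; this
    block tolerates it. *)
Lemma D2_le : (on x, mnorm (D2 x) <= K' * (K ^+ 2 * (l + h))).
Proof.
have /andP[h0 h1] := h01.
apply: (gron dD2); first exact: MK.
- move=> x hx; apply: (@le_trans _ _ (l * (K * K) + h * (K * K))).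
    by apply: mnormD_le; apply: mnormZ_le; rewrite ?hh //; apply: mnormM_le;
      rewrite ?BK ?DK ?Y2K.
  by rewrite le_eqVlt; apply/orP; left; apply/eqP; ring.
by rewrite /D2 /W2 S0 mul1mx subrr.
Qed.

(** Since ell' = - ell A, the derivative of [ell W1] is ell (lambda B + h D) W1. With W1 = Y1 +
    lambda Z + D1, the leading terms are the derivatives of the J's, and every remaining one carries
    lambda D1, h lambda Z or h D1. *)
Lemma invariants_W1 : mnorm (ell X *m W1 X - ell 0 *m W1 0
    - lambda ^+ 2 *: (JZ X - JZ 0) - h%:C *: (JD X - JD 0)) <=
  8 * X * (K ^+ 3 + 4 * K' * K ^+ 4) * ((l + h) * (l ^+ 2 + h)).
Proof.
have /andP[h0 h1] := h01.
(* [J1] is subtracted although it is absent from the statement: [J1X] makes its increment vanish,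
   while its derivative removes the term of order lambda. *)
pose F x := ell x *m W1 x - lambda *: J1 x - lambda ^+ 2 *: JZ x - h%:C *: JD x.
have -> : ell X *m W1 X - ell 0 *m W1 0 - lambda ^+ 2 *: (JZ X - JZ 0)
    - h%:C *: (JD X - JD 0) = F X - F 0.
  rewrite /F J1X; mxlin.
pose F' x := lambda *: (ell x *m B x *m D1 x)
  + h%:C *: (ell x *m D x *m (lambda *: Z x + D1 x)).
have dF : (on x, mxderiv F x (F' x)).
  move=> x hx.
  apply: mxderiv_eq (mxderivB (mxderivB (mxderivB
    (mxderivM (dell hx) (dW (Y1 0 + lambda *: Z 0) hx))
    (mxderivZ lambda (dJ1 hx))) (mxderivZ (lambda ^+ 2) (dJZ hx)))
    (mxderivZ h%:C (dJD hx))) _.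
  rewrite -/(W1 x) W1S /F'.
  rewrite !(mulmxDl, mulmxDr, mulNmx) -?(scalemxAl, scalemxAr) !mulmxA.
  rewrite -?(scalemxAl, scalemxAr); mxlin.
have hF : (on x, mnorm (F' x) <= (K ^+ 3 + 4 * K' * K ^+ 4) * ((l + h) * (l ^+ 2 + h))).
  move=> x hx; have hBK := mnormM_le (ellK hx) (BK hx).
  have hDK := mnormM_le (ellK hx) (DK hx).
  apply: (@le_trans _ _ (l * (K * K * (K' * (2 * K ^+ 2 * (l ^+ 2 + h)))) +
     h * (K * K * (l * K + K' * (2 * K ^+ 2 * (l ^+ 2 + h)))))).
    apply: mnormD_le; apply: mnormZ_le; rewrite ?hh //.
      exact: mnormM_le hBK (D1_le hx).
    apply: mnormM_le hDK _; apply: mnormD_le; last exact: D1_le.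
    by apply: mnormZ_le => //; exact: ZK.
  have K3 := exprn_ge0 3 K0; have K4 := mulr_ge0 K'0 (exprn_ge0 4 K0).
  have a1 := mulr_ge0 l0 (sqr_ge0 l); have a2 := mulr_ge0 l0 h0.
  have a3 := mulr_ge0 h0 (sqr_ge0 l); have a4 := mulr_ge0 h0 h0.
  have b1 := mulr_ge0 K3 a1; have b2 := mulr_ge0 K3 a3; have b3 := mulr_ge0 K3 a4.
  have c1 := mulr_ge0 K4 a1; have c2 := mulr_ge0 K4 a2; have c3 := mulr_ge0 K4 a3.
  have c4 := mulr_ge0 K4 a4.
  rewrite -subr_ge0; set t := (X in 0 <= X).
  have -> : t = K ^+ 3 * (l * l ^+ 2) + K ^+ 3 * (h * l ^+ 2) + K ^+ 3 * (h * h)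
    + 2 * (K' * K ^+ 4 * (l * l ^+ 2)) + 2 * (K' * K ^+ 4 * (l * h))
    + 2 * (K' * K ^+ 4 * (h * l ^+ 2)) + 2 * (K' * K ^+ 4 * (h * h)) by rewrite /t; ring.
  by rewrite !addr_ge0 ?mulr_ge0.
apply: le_trans (mnorm_increment X0 dF hF) _.
by rewrite le_eqVlt; apply/orP; left; apply/eqP; ring.
Qed.

(** Same computation as for [W1], but here the term of order lambda is the main one and the whole of
    h D W2 is an error. *)
Lemma invariants_W2 : mnorm (ell X *m W2 X - ell 0 *m W2 0
    - lambda *: (J2 X - J2 0)) <=
  8 * X * (K ^+ 3 + 4 * K' * K ^+ 4) * (l ^+ 2 + h).
Proof.
have /andP[h0 h1] := h01.
pose F x := ell x *m W2 x - lambda *: J2 x.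
have -> : ell X *m W2 X - ell 0 *m W2 0 - lambda *: (J2 X - J2 0) = F X - F 0.
  rewrite /F; mxlin.
pose F' x := lambda *: (ell x *m B x *m D2 x) + h%:C *: (ell x *m D x *m W2 x).
have dF : (on x, mxderiv F x (F' x)).
  move=> x hx.
  apply: mxderiv_eq (mxderivB (mxderivM (dell hx) (dW (Y2 0) hx)) (mxderivZ lambda (dJ2 hx))) _.
  rewrite -/(W2 x) /F' W2S.
  rewrite !(mulmxDl, mulmxDr, mulNmx) -?(scalemxAl, scalemxAr) !mulmxA.
  rewrite -?(scalemxAl, scalemxAr); mxlin.
have hF : (on x, mnorm (F' x) <= (K ^+ 3 + 4 * K' * K ^+ 4) * (l ^+ 2 + h)).
  move=> x hx; have hBK := mnormM_le (ellK hx) (BK hx).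
  have hDK := mnormM_le (ellK hx) (DK hx).
  apply: (@le_trans _ _ (l * (K * K * (K' * (K ^+ 2 * (l + h)))) +
     h * (K * K * (K' * (K ^+ 2 * (l + h)) + K)))).
    apply: mnormD_le; apply: mnormZ_le; rewrite ?hh //.
      exact: mnormM_le hBK (D2_le hx).
    by rewrite W2S; apply: mnormM_le hDK _; apply: mnormD_le; [exact: D2_le|exact: Y2K].
  have K3 := exprn_ge0 3 K0; have K4 := mulr_ge0 K'0 (exprn_ge0 4 K0).
  rewrite -subr_ge0; set t := (X in 0 <= X).
  (* The products l h and h^2 are absorbed by h, through the nonnegative factors 1 - l and 1 - h. *)
  have -> : t = K ^+ 3 * l ^+ 2 + K' * K ^+ 4 * (3 * l ^+ 2 + 2 * (h * (1 - l)) +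
     h * (1 - h) + h) by rewrite /t; ring.
  have [l1' h1'] : 0 <= 1 - l /\ 0 <= 1 - h by rewrite !subr_ge0.
  have l2 := sqr_ge0 l.
  by repeat (assumption || apply: addr_ge0 || apply: mulr_ge0).
apply: le_trans (mnorm_increment X0 dF hF) _.
by rewrite le_eqVlt; apply/orP; left; apply/eqP; ring.
Qed.

End Fixed.

End UnfoldingMonodromy.

(** * Reduction of the Evans determinant *)

Section MainBlocks.
Variables (T : comNzRingType) (P Q mS NZ N2 ND : 'M[T]_2) (lambda z h : T).

(* lambda Sigma_t - z + (h / lambda) Sigma_y, conjugated by diag(1, 1, lambda, lambda)
   to become polynomial in lambda; the upper right block is Q. *)
Definition main_ul : 'M[T]_2 := lambda *: P - z%:M.
Definition main_dl : 'M[T]_2 := lambda ^+ 2 *: (NZ + mS *m P) + h *: ND.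
Definition main_dr : 'M[T]_2 := lambda *: (N2 + mS *m Q) - z%:M.

End MainBlocks.

Section BlockReduction.
Variable F : fieldType.
Variables (E Ei SX : 'M[F]_(2 + 2)) (y1 y2 v y1X y2X vX : 'M[F]_(2 + 2, 2)).
Variables (ell0 ellX : 'M[F]_(2, 2 + 2)) (P Q mS NZ N2 ND : 'M[F]_2).
Hypothesis EEi : E *m Ei = 1%:M.
Hypothesis detE : \det E = 1.
Hypothesis y_unit : row_mx y1 y2 \in unitmx.
Hypothesis ell0_y1 : ell0 *m y1 = 0.
Hypothesis ell0_y2 : ell0 *m y2 = 1%:M.
Hypothesis ell0_v : ell0 *m v = - mS.
Hypothesis ellX_E : ellX *m E = ell0.
Hypothesis y1X_E : y1X = E *m y1.
Hypothesis y2X_E : y2X = E *m (y2 + y1 *m Q).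
Hypothesis vX_E : vX = E *m (v + y1 *m P).
Variables (lambda z h : F).

(** Coordinates along [y1] in the basis (y1, y2). Those along [y2] are read by [ell0], so that
    [coord_top] stacked on [ell0] is the inverse of [row_mx y1 y2]. *)
Definition coord_top : 'M[F]_(2, 2 + 2) := usubmx (invmx (row_mx y1 y2)).
Local Notation Tu := coord_top.
Local Notation W1 := (SX *m (y1 + lambda *: v)).
Local Notation W2 := (SX *m y2).
Local Notation Mul := (main_ul P lambda z).
Local Notation Mdl := (main_dl P mS NZ ND lambda h).
Local Notation Mdr := (main_dr Q mS N2 lambda z).

(** Exact remainders of the four blocks, not yet estimated. The last summands of [defect_dl] and
    [defect_dr] record the effect of the row operation on the upper remainders. *)
Definition defect_ul : 'M[F]_2 :=
  - ((z * lambda) *: (Tu *m v)) + Tu *m (Ei *m (W1 - (y1X + lambda *: vX))).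
Definition defect_ur : 'M[F]_2 := Tu *m (Ei *m (W2 - y2X)).
Definition defect_dl : 'M[F]_2 :=
  ellX *m W1 - ell0 *m (y1 + lambda *: v) - lambda ^+ 2 *: NZ - h *: ND
  + lambda *: (mS *m defect_ul).
Definition defect_dr : 'M[F]_2 :=
  ellX *m W2 - ell0 *m y2 - lambda *: N2 + lambda *: (mS *m defect_ur).

Let Tu_y : Tu *m row_mx y1 y2 = row_mx 1%:M 0.
Proof.
have := mulVmx y_unit; rewrite -[invmx _ in X in X -> _]vsubmxK mul_col_mx.
by rewrite (@scalar_mx_block _ 2 2) block_mxEv => /eq_col_mx[].
Qed.

Let Tu_y1 : Tu *m y1 = 1%:M.
Proof. by have := Tu_y; rewrite mul_mx_row => /eq_row_mx[]. Qed.

Let Tu_y2 : Tu *m y2 = 0.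
Proof. by have := Tu_y; rewrite mul_mx_row => /eq_row_mx[]. Qed.

Let EiE : Ei *m E = 1%:M. Proof. exact: mulmx1C EEi. Qed.

Let ellX_Ei : ellX = ell0 *m Ei.
Proof. by rewrite -ellX_E -mulmxA EEi mulmx1. Qed.

(** The matrix is written in the basis (y1 + lambda v, y2) on the right and in the dual frame of
    (y1, y2) on the left. These frames are dual to each other only at lambda = 0, which explains the
    extra determinant. *)
Lemma det_block_reduction :
  \det (SX - (1 + z) *: E) * \det (1%:M + lambda *: (Tu *m v)) =
  \det (block_mx (Mul + defect_ul) (Q + defect_ur)
                 (Mdl + defect_dl) (Mdr + defect_dr)).
Proof.
(* By [ell0_v], the lower left block contains z lambda mS. Adding lambda mS times the upper rows
   cancels it and produces lambda^2 mS P and lambda mS Q, the boundary terms of Sigma_t. *)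
pose L : 'M[F]_(2 + 2) := block_mx 1%:M 0 (lambda *: mS) 1%:M.
pose T : 'M[F]_(2 + 2) := col_mx Tu ell0.
pose y : 'M[F]_(2 + 2) := row_mx (y1 + lambda *: v) y2.
have detL : \det L = 1 by rewrite det_lblock !det1 mulr1.
have detEi : \det Ei = 1.
  by have := congr1 (fun M => \det M) EEi; rewrite det_mulmx detE mul1r det1.
have detTy : \det T * \det y = \det (1%:M + lambda *: (Tu *m v)).
  rewrite -det_mulmx mul_col_row !mulmxDr -!scalemxAr Tu_y1 Tu_y2 ell0_y1 ell0_y2.
  by rewrite det_lblock det1 mulr1.
have -> : block_mx (Mul + defect_ul) (Q + defect_ur)
    (Mdl + defect_dl) (Mdr + defect_dr) =
    L *m (T *m (Ei *m ((SX - (1 + z) *: E) *m y))).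
  have ev W : Ei *m ((SX - (1 + z) *: E) *m W) = Ei *m (SX *m W) - (1 + z) *: W.
    by rewrite mulmxBl mulmxBr -scalemxAl -scalemxAr [Ei *m (E *m _)]mulmxA EiE mul1mx.
  have eul : Mul + defect_ul = Tu *m (Ei *m ((SX - (1 + z) *: E) *m (y1 + lambda *: v))).
    rewrite ev /main_ul /defect_ul y1X_E vX_E [lambda *: (E *m _)]scalemxAr -[E *m y1 + _]mulmxDr [Ei *m (_ - _)]mulmxBr [Ei *m (E *m _)]mulmxA EiE mul1mx.
    rewrite !mulmxBr -!scalemxAr !mulmxDr -!scalemxAr !mulmxDr [Tu *m (y1 *m P)]mulmxA.
    rewrite Tu_y1 mul1mx -scalemx1.
    mxlin.
  have eur : Q + defect_ur = Tu *m (Ei *m ((SX - (1 + z) *: E) *m y2)).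
    rewrite ev /defect_ur y2X_E mulmxBr [Ei *m (E *m _)]mulmxA EiE mul1mx.
    rewrite !mulmxBr -!scalemxAr !mulmxDr [Tu *m (y1 *m Q)]mulmxA Tu_y1 Tu_y2 mul1mx.
    mxlin.
  rewrite /y mul_mx_row mul_mx_row /T mul_col_row /L.
  rewrite mulmx_block !mul1mx !mul0mx !addr0 -eul -eur !ev.
  congr block_mx.
    rewrite /main_dl /defect_dl; move: defect_ul => e1.
    rewrite [ell0 *m (Ei *m _ - _)]mulmxBr [ell0 *m (Ei *m _)]mulmxA -ellX_Ei.
    rewrite -[ell0 *m (_ *: _)]scalemxAr [ell0 *m (y1 + _)]mulmxDr ell0_y1.
    rewrite -[ell0 *m (_ *: _)]scalemxAr ell0_v.
    rewrite -[(lambda *: mS) *m _]scalemxAl /main_ul [mS *m (_ + e1)]mulmxDr.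
    rewrite [mS *m (_ - _)]mulmxBr -[mS *m (lambda *: P)]scalemxAr mul_mx_scalar.
    mxlin.
  rewrite /main_dr /defect_dr; move: defect_ur => e2.
  rewrite [ell0 *m (Ei *m _ - _)]mulmxBr [ell0 *m (Ei *m _)]mulmxA -ellX_Ei.
  rewrite -[ell0 *m (_ *: _)]scalemxAr ell0_y2 -[(lambda *: mS) *m _]scalemxAl.
  rewrite [mS *m (_ + e2)]mulmxDr -[z%:M]scalemx1.
  mxlin.
by rewrite !det_mulmx detL mul1r detEi mul1r -detTy; ring.
Qed.

End BlockReduction.

Lemma det_mx2 (T : comNzRingType) (M : 'M[T]_2) : \det M = M 0 0 * M 1 1 - M 0 1 * M 1 0.
Proof.
rewrite (expand_det_row _ ord0) !big_ord_recl big_ord0 /cofactor !det_mx11 !mxE /=.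
have -> : lift ord0 ord0 = 1 :> 'I_2 by apply/val_inj.
have -> : lift 1 ord0 = 0 :> 'I_2 by apply/val_inj.
by rewrite /= /bump /=; ring.
Qed.

(** * Estimates of the remainders of the blocks *)

Section BlockEstimate.
Variable R : realType.
Local Notation C := R[i].
Local Notation normc := (@Normc.normc R).

Lemma mnorm_scalar2 (z : C) : mnorm (z%:M : 'M[C]_2) = 2 * normc z.
Proof.
rewrite /mnorm !big_ord_recl !big_ord0 !mxE -!val_eqE /= expr0n /= !addr0 sqrtr0.
by ring.
Qed.

Lemma ord22P (i : 'I_(2 + 2)) :
  (exists i', i = lshift 2 i' /\ (i < 2)%N) \/ (exists i', i = rshift 2 i' /\ (i < 2)%N = false).
Proof.
case: (split_ordP i) => i' ->; [left|right]; exists i'; split=> //=.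
Qed.

Lemma det_block_perturb_mnorm (a b c d a' b' c' d' : 'M[C]_2) (K r q : R) :
  0 <= K -> 0 <= r -> 0 <= q ->
  mnorm a <= K * r -> mnorm b <= K -> mnorm c <= K * q -> mnorm d <= K * r ->
  mnorm a' <= K * r -> mnorm b' <= K -> mnorm c' <= K * q -> mnorm d' <= K * r ->
  mnorm (a - a') <= K * q -> mnorm (b - b') <= K * r ->
  mnorm (c - c') <= K * (r * q) -> mnorm (d - d') <= K * q ->
  normc (\det (block_mx a b c d) - \det (block_mx a' b' c' d')) <=
    96 * K ^+ 4 * (r * q * (r ^+ 2 + q)).
Proof.
move=> K0 r0 q0 ha hb hc hd ha' hb' hc' hd' ka kb kc kd.
have le (M : 'M[C]_2) x i j : mnorm M <= x -> normc (M i j) <= x.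
  exact: le_trans (normc_le_mnorm _ _ _).
have leB (M N : 'M[C]_2) x i j : mnorm (M - N) <= x -> normc (M i j - N i j) <= x.
  by move/(le _ _ i j); rewrite !mxE.
apply: det_block_perturb => // i j; rewrite /block_weight /block_error;
  case: (ord22P i) => -[i' [-> ->]]; case: (ord22P j) => -[j' [-> ->]];
  rewrite ?mulr1 ?(block_mxEul a b c d) ?(block_mxEur a b c d)
    ?(block_mxEdl a b c d) ?(block_mxEdr a b c d)
    ?(block_mxEul a' b' c' d') ?(block_mxEur a' b' c' d')
    ?(block_mxEdl a' b' c' d') ?(block_mxEdr a' b' c' d');
  solve [exact: le | exact: leB].
Qed.

Section Estimate.
Variables (E Ei SX : 'M[C]_(2 + 2)) (y1 y2 v y1X y2X vX : 'M[C]_(2 + 2, 2)).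
Variables (ell0 ellX : 'M[C]_(2, 2 + 2)) (P Q mS NZ N2 ND : 'M[C]_2).
Hypothesis EEi : E *m Ei = 1%:M.
Hypothesis detE : \det E = 1.
Hypothesis y_unit : row_mx y1 y2 \in unitmx.
Hypothesis ell0_y1 : ell0 *m y1 = 0.
Hypothesis ell0_y2 : ell0 *m y2 = 1%:M.
Hypothesis ell0_v : ell0 *m v = - mS.
Hypothesis ellX_E : ellX *m E = ell0.
Hypothesis y1X_E : y1X = E *m y1.
Hypothesis y2X_E : y2X = E *m (y2 + y1 *m Q).
Hypothesis vX_E : vX = E *m (v + y1 *m P).
Variables (lambda z : C) (h t c : R).
Local Notation l := (normc lambda).
Local Notation Tu := (coord_top y1 y2).
Hypothesis c1 : 1 <= c.
Hypothesis hP : mnorm P <= c.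
Hypothesis hQ : mnorm Q <= c.
Hypothesis hmS : mnorm mS <= c.
Hypothesis hNZ : mnorm NZ <= c.
Hypothesis hN2 : mnorm N2 <= c.
Hypothesis hND : mnorm ND <= c.
Hypothesis hTu : mnorm Tu <= c.
Hypothesis hEi : mnorm Ei <= c.
Hypothesis hn : mnorm (Tu *m v) <= c.
Hypothesis h01 : 0 <= h <= 1.
Hypothesis zt : normc z <= t.
Hypothesis t4 : t <= 4.
Hypothesis small : 8 * c ^+ 2 * l <= 1.
Local Notation W1 := (SX *m (y1 + lambda *: v)).
Local Notation W2 := (SX *m y2).
Hypothesis hd1 : mnorm (W1 - (y1X + lambda *: vX)) <= c * (l ^+ 2 + h).
Hypothesis hd2 : mnorm (W2 - y2X) <= c * (l + h).
Hypothesis hr1 : mnorm (ellX *m W1 - ell0 *m (y1 + lambda *: v)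
    - lambda ^+ 2 *: NZ - h%:C *: ND) <= c * ((l + h) * (l ^+ 2 + h)).
Hypothesis hr2 : mnorm (ellX *m W2 - ell0 *m y2 - lambda *: N2) <= c * (l ^+ 2 + h).

Local Notation r := (l + t + h).
Local Notation q := (l * (l + t) + h).

Let l0 : 0 <= l. Proof. exact: normc_ge0. Qed.
Let h0 : 0 <= h. Proof. by case/andP: h01. Qed.
Let h1 : h <= 1. Proof. by case/andP: h01. Qed.
Let t0 : 0 <= t. Proof. exact: le_trans (normc_ge0 _) zt. Qed.
Let c0 : 0 <= c. Proof. exact: le_trans ler01 c1. Qed.
Let hh : normc h%:C = h. Proof. by rewrite normcR ger0_norm. Qed.
Let l1 : l <= 1.
Proof.
apply: le_trans small; rewrite -[leLHS]mul1r ler_wpM2r //.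
have : 1 <= c ^+ 2 by exact: exprn_ege1.
lra.
Qed.
Let r0 : 0 <= r. Proof. by rewrite !addr_ge0. Qed.
Let q0 : 0 <= q. Proof. by rewrite addr_ge0 ?mulr_ge0 ?addr_ge0. Qed.
Let qr : q <= r.
Proof. by rewrite lerD2r ler_piMl // addr_ge0. Qed.
(** A factor lambda turns the size r of a diagonal block into q, because l h <= h. *)
Let rlq : l * r <= q.
Proof. by rewrite mulrDr lerD2l ler_piMl. Qed.
Let r6 : r <= 6. Proof. by move: l1 t4 h1; lra. Qed.
Let lhq : l ^+ 2 + h <= q.
Proof. by rewrite lerD2r expr2 mulrDr lerDl mulr_ge0. Qed.
Let lhr : l + h <= r. Proof. by move: t0; lra. Qed.

Let cX n : 1 <= c ^+ n. Proof. exact: exprn_ege1. Qed.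
Let cXle m n : (m <= n)%N -> c ^+ m <= c ^+ n.
Proof. by move=> mn; apply: ler_weXn2l. Qed.

Local Notation eul := (defect_ul Ei SX y1 y2 v y1X vX lambda z).
Local Notation eur := (defect_ur Ei SX y1 y2 y2X).
Local Notation edl := (defect_dl Ei SX y1 y2 v y1X vX ell0 ellX mS NZ ND lambda z h%:C).
Local Notation edr := (defect_dr Ei SX y1 y2 y2X ell0 ellX mS N2 lambda).
Local Notation mul := (main_ul P lambda z).
Local Notation mdl := (main_dl P mS NZ ND lambda h%:C).
Local Notation mdr := (main_dr Q mS N2 lambda z).

Let facts : [/\ 0 <= l, 0 <= h, h <= 1, 0 <= t & [/\ 0 <= c, 1 <= c & l <= 1]].
Proof. by []. Qed.

(** The term in z lambda is absorbed by the product l t contained in q. *)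
Let heul : mnorm eul <= 2 * c ^+ 3 * q.
Proof.
have [fl fh fh1 ft [fc fc1 fl1]] := facts.
apply: (@le_trans _ _ (t * l * c + c * (c * (c * (l ^+ 2 + h))))).
  apply: mnormD_le.
    by rewrite mnormN; apply: mnormZ_le; rewrite // Normc.normcM ler_wpM2r.
  by apply: mnormM_le => //; apply: mnormM_le.
have c13 := cXle (isT : (1 <= 3)%N); rewrite expr1 in c13.
have a1 : t * l * c <= q * c ^+ 3.
  apply: ler_pM; rewrite ?mulr_ge0 //.
  by rewrite mulrDr [l * t]mulrC -addrA [_ + h]addrC addrA lerDr addr_ge0 ?mulr_ge0.
have a2 : c ^+ 3 * (l ^+ 2 + h) <= c ^+ 3 * q by rewrite ler_wpM2l ?exprn_ge0.
have -> : c * (c * (c * (l ^+ 2 + h))) = c ^+ 3 * (l ^+ 2 + h) by ring.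
by apply: le_trans (lerD a1 a2) _; rewrite le_eqVlt; apply/orP; left; apply/eqP; ring.
Qed.

Let heur : mnorm eur <= c ^+ 3 * r.
Proof.
have [fl fh fh1 ft [fc fc1 fl1]] := facts.
apply: (@le_trans _ _ (c * (c * (c * (l + h))))).
  by apply: mnormM_le => //; apply: mnormM_le.
have -> : c * (c * (c * (l + h))) = c ^+ 3 * (l + h) by ring.
by rewrite ler_wpM2l ?exprn_ge0.
Qed.

Let hedl : mnorm edl <= 3 * c ^+ 4 * (r * q).
Proof.
have [fl fh fh1 ft [fc fc1 fl1]] := facts.
apply: (@le_trans _ _ (c * ((l + h) * (l ^+ 2 + h)) + l * (c * (2 * c ^+ 3 * q)))).
  apply: mnormD_le => //; apply: mnormZ_le => //; exact: mnormM_le.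
have c14 := cXle (isT : (1 <= 4)%N); rewrite expr1 in c14.
have a1 : c * ((l + h) * (l ^+ 2 + h)) <= c ^+ 4 * (r * q).
  have lh0 : 0 <= l + h by rewrite addr_ge0.
  have lh20 : 0 <= l ^+ 2 + h by rewrite addr_ge0 ?sqr_ge0.
  by apply: ler_pM => //; [rewrite mulr_ge0|apply: ler_pM].
have a2 : 2 * c ^+ 4 * (l * q) <= 2 * c ^+ 4 * (r * q).
  rewrite ler_wpM2l ?mulr_ge0 ?exprn_ge0 // ler_wpM2r //; lra.
have -> : l * (c * (2 * c ^+ 3 * q)) = 2 * c ^+ 4 * (l * q) by ring.
by apply: le_trans (lerD a1 a2) _; rewrite le_eqVlt; apply/orP; left; apply/eqP; ring.
Qed.

Let hedr : mnorm edr <= 2 * c ^+ 4 * q.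
Proof.
have [fl fh fh1 ft [fc fc1 fl1]] := facts.
apply: (@le_trans _ _ (c * (l ^+ 2 + h) + l * (c * (c ^+ 3 * r)))).
  apply: mnormD_le => //; apply: mnormZ_le => //; exact: mnormM_le.
have c14 := cXle (isT : (1 <= 4)%N); rewrite expr1 in c14.
have a1 : c * (l ^+ 2 + h) <= c ^+ 4 * q.
  by apply: ler_pM => //; rewrite addr_ge0 ?sqr_ge0.
have a2 : c ^+ 4 * (l * r) <= c ^+ 4 * q by rewrite ler_wpM2l ?exprn_ge0.
have -> : l * (c * (c ^+ 3 * r)) = c ^+ 4 * (l * r) by ring.
by apply: le_trans (lerD a1 a2) _; rewrite le_eqVlt; apply/orP; left; apply/eqP; ring.
Qed.

Let hmul : mnorm mul <= 2 * c * r.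
Proof.
have [fl fh fh1 ft [fc fc1 fl1]] := facts.
apply: (@le_trans _ _ (l * c + 2 * t)).
  apply: mnormD_le; first exact: mnormZ_le.
  by rewrite mnormN mnorm_scalar2 ler_wpM2l.
have a1 : l * c <= r * c by rewrite ler_wpM2r //; lra.
have a2 : t * 1 <= r * c by apply: ler_pM => //; lra.
have a3 : c * l <= c * r by rewrite ler_wpM2l //; lra.
have a4 : c * t <= c * (t + h + (l - l)).
  by rewrite ler_wpM2l //; lra.
have a5 : t <= c * t by rewrite ler_peMl.
nra.
Qed.

Let hmdl : mnorm mdl <= 2 * c ^+ 2 * q.
Proof.
have [fl fh fh1 ft [fc fc1 fl1]] := facts.
apply: (@le_trans _ _ (l ^+ 2 * (c + c * c) + h * c)).
  apply: mnormD_le; apply: mnormZ_le; rewrite ?hh ?expr2 ?Normc.normcM //.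
  by apply: mnormD_le => //; exact: mnormM_le.
have c2 := cXle (isT : (1 <= 2)%N); rewrite expr1 in c2.
have a1 : l ^+ 2 * (c + c * c) <= l ^+ 2 * (2 * c ^+ 2).
  by rewrite ler_wpM2l ?sqr_ge0 // -expr2; lra.
have a2 : h * c <= h * (2 * c ^+ 2) by rewrite ler_wpM2l //; have := sqr_ge0 c; lra.
have a3 : (l ^+ 2 + h) * (2 * c ^+ 2) <= q * (2 * c ^+ 2).
  by rewrite ler_wpM2r // mulr_ge0 ?sqr_ge0.
by apply: le_trans (lerD a1 a2) _; rewrite -mulrDl [leRHS]mulrC.
Qed.

Let hmdr : mnorm mdr <= 2 * c ^+ 2 * r.
Proof.
have [fl fh fh1 ft [fc fc1 fl1]] := facts.
apply: (@le_trans _ _ (l * (c + c * c) + 2 * t)).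
  apply: mnormD_le; last by rewrite mnormN mnorm_scalar2 ler_wpM2l.
  by apply: mnormZ_le => //; apply: mnormD_le => //; exact: mnormM_le.
have c2 := cXle (isT : (1 <= 2)%N); rewrite expr1 in c2.
have a1 : l * (c + c * c) <= l * (2 * c ^+ 2).
  by rewrite ler_wpM2l // -expr2; lra.
have a2 : 2 * t <= t * (2 * c ^+ 2).
  by rewrite mulrC ler_wpM2l //; have := cX 2; lra.
have a3 : (l + t) * (2 * c ^+ 2) <= r * (2 * c ^+ 2).
  by rewrite ler_wpM2r ?mulr_ge0 ?sqr_ge0 //; lra.
by apply: le_trans (lerD a1 a2) _; rewrite -mulrDl [leRHS]mulrC.
Qed.

Let hn1 : mnorm (1%:M + lambda *: (Tu *m v)) <= 3 * c.
Proof.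
have [fl fh fh1 ft [fc fc1 fl1]] := facts.
apply: (@le_trans _ _ (2 + 1 * c)); last lra.
apply: mnormD_le; first by rewrite mnorm_scalar2 Normc.normc1; lra.
exact: mnormZ_le.
Qed.

Let mul_blockr (a b b' d m : 'M[C]_2) :
  block_mx a b b' d *m block_mx m 0 0 1%:M = block_mx (a *m m) b (b' *m m) d.
Proof. by rewrite mulmx_block !mulmx0 !mulmx1 !addr0 !add0r. Qed.

Let d := \det (1%:M + lambda *: (Tu *m v)).

(** Expanding the 2 x 2 determinant, d - 1 is at most l (2 c + 2 c^2) <= 4 c^2 l, and [small] makes
    this at most 1/2. *)
Let d_half : 2^-1 <= normc d.
Proof.
have [fl fh fh1 ft [fc fc1 fl1]] := facts.
have -> : d = 1 + lambda * ((Tu *m v) 0 0 + (Tu *m v) 1 1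
    + lambda * ((Tu *m v) 0 0 * (Tu *m v) 1 1 - (Tu *m v) 0 1 * (Tu *m v) 1 0)).
  rewrite /d det_mx2 !mxE /= !mulr0n !mulr1n; move: (\sum_j _) (\sum_j _) (\sum_j _) (\sum_j _) => a1 a2 a3 a4.
  ring.
set a := lambda * _.
have ha : normc a <= 2^-1.
  have e i j : normc ((Tu *m v) i j) <= c by exact: le_trans (normc_le_mnorm _ _ _) hn.
  have: normc a <= l * (c + c + 1 * (c * c + c * c)).
    rewrite /a Normc.normcM ler_wpM2l //; apply: le_trans (le_normcD _ _) _.
    apply: lerD; first by apply: le_trans (le_normcD _ _) (lerD _ _).
    rewrite Normc.normcM; apply: ler_pM; rewrite ?normc_ge0 //.
    apply: le_trans (le_normcD _ _) _; rewrite normcN !Normc.normcM.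
    by apply: lerD; apply: ler_pM; rewrite ?normc_ge0.
  move/le_trans; apply.
  have c2 := cXle (isT : (1 <= 2)%N); rewrite expr1 in c2.
  have : l * (c + c + 1 * (c * c + c * c)) <= l * (4 * c ^+ 2).
    by rewrite ler_wpM2l //; lra.
  by move: small; lra.
have := le_normcD (1 + a) (- a); rewrite normcN addrK Normc.normc1; lra.
Qed.

(** The identity of [det_block_reduction] controls the Evans determinant times [d]. The main
    determinant is multiplied by [d] as well, and [d_half] removes this factor at the price of the
    leading [2]. *)
Lemma det_block_estimate :
  normc (\det (SX - (1 + z) *: E) - \det (block_mx mul Q mdl mdr)) <=
  2 * (96 * (20 * c ^+ 4) ^+ 4) * (r * q * (r ^+ 2 + q)).
Proof.
have [fl fh fh1 ft [fc fc1 fl1]] := facts.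
have red := @det_block_reduction _ E Ei SX y1 y2 v y1X y2X vX ell0 ellX P Q mS NZ N2 ND
  EEi detE y_unit ell0_y1 ell0_y2 ell0_v ellX_E y1X_E y2X_E vX_E lambda z h%:C.
set G := block_mx _ _ _ _ in red; set Dt := \det (SX - _) in red *.
set n1 := 1%:M + lambda *: (Tu *m v) in red.
(* The factor [d] enters through the first two columns. This changes the upper left block by size l
   r <= q and the lower left one by size l q <= r q, within the allowed errors. *)
have mainE : \det (block_mx mul Q mdl mdr) * d = \det (block_mx (mul *m n1) Q (mdl *m n1) mdr).
  have -> : d = \det (block_mx n1 0 0 1%:M : 'M[C]_(2 + 2)).
    by rewrite det_ublock det1 mulr1.
  by rewrite -det_mulmx [_ *m block_mx _ _ _ _]mul_blockr.
have addDB (x y w : 'M[C]_2) : x + y - (x + w) = y - w.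
  by rewrite opprD addrACA subrr add0r.
(* The constant 20 = 2 + 3 * 6 is the one of the lower left block, where r <= 6 is used; the other
   blocks need less. *)
have key : normc (\det G - \det (block_mx (mul *m n1) Q (mdl *m n1) mdr)) <=
    96 * (20 * c ^+ 4) ^+ 4 * (r * q * (r ^+ 2 + q)).
  have k0 : 0 <= c ^+ 4 by rewrite exprn_ge0.
  have c34 := cXle (isT : (3 <= 4)%N); have c24 := cXle (isT : (2 <= 4)%N).
  have c14 := cXle (isT : (1 <= 4)%N); rewrite expr1 in c14.
  have c23 := cXle (isT : (2 <= 3)%N).
  have c4r := mulr_ge0 k0 r0; have c4q := mulr_ge0 k0 q0.
  have c4qr : c ^+ 4 * q <= c ^+ 4 * r by rewrite ler_wpM2l.
  have up m x : (m <= 4)%N -> 0 <= x -> c ^+ m * x <= c ^+ 4 * x.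
    by move=> m4 x0; rewrite ler_wpM2r // cXle.
  have r3 := up 3 r isT r0; have q3 := up 3 q isT q0.
  have r2 := up 2 r isT r0; have q2 := up 2 q isT q0.
  have r1 := up 1 r isT r0; have q1 := up 1 q isT q0; rewrite expr1 in r1 q1.
  have bn (M : 'M[C]_2) x y : mnorm M <= x -> 3 * c * x = y -> mnorm (M *m n1) <= y.
    by move=> hM <-; rewrite mulrC; exact: mnormM_le.
  have rq0 := mulr_ge0 r0 q0.
  have c4rq := mulr_ge0 k0 rq0.
  have lM (M : 'M[C]_2) : M *m n1 = M + lambda *: (M *m (Tu *m v)).
    by rewrite /n1 mulmxDr mulmx1 -scalemxAr.
  apply: det_block_perturb_mnorm; rewrite ?mulr_ge0 //.
  - apply: le_trans (mnormD_le hmul heul) _; lra.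
  - apply: le_trans (mnormD_le hQ heur) _.
    have : c ^+ 3 * r <= c ^+ 4 * 6 by apply: ler_pM; rewrite ?exprn_ge0.
    lra.
  - apply: le_trans (mnormD_le hmdl hedl) _.
    have : c ^+ 4 * (r * q) <= c ^+ 4 * (6 * q) by rewrite ler_wpM2l // ler_wpM2r.
    lra.
  - apply: le_trans (mnormD_le hmdr hedr) _; lra.
  - by apply: le_trans (bn _ _ (6 * (c ^+ 2 * r)) hmul _) _; [ring|lra].
  - by apply: le_trans hQ _; lra.
  - by apply: le_trans (bn _ _ (6 * (c ^+ 3 * q)) hmdl _) _; [ring|lra].
  - by apply: le_trans hmdr _; lra.
  - rewrite lM opprD addrACA subrr add0r addrC.
    have -> : - (lambda *: (mul *m (Tu *m v))) + eul = eul - lambda *: (mul *m (Tu *m v)) by rewrite addrC.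
    apply: le_trans (mnormD_le (N := - _) heul (_ : _ <= 2 * c ^+ 2 * (l * r))) _.
      rewrite mnormN; apply: le_trans (mnormZ_le (lexx l) (mnormM_le hmul hn)) _.
      by rewrite le_eqVlt; apply/orP; left; apply/eqP; ring.
    have : c ^+ 2 * (l * r) <= c ^+ 2 * q by rewrite ler_wpM2l ?exprn_ge0.
    lra.
  - by rewrite addrAC subrr add0r; apply: le_trans heur _; lra.
  - rewrite lM.
    have -> : mdl + edl - (mdl + lambda *: (mdl *m (Tu *m v))) = edl - lambda *: (mdl *m (Tu *m v)).
      exact: addDB.
    apply: le_trans (mnormD_le (N := - _) hedl (_ : _ <= 2 * c ^+ 3 * (l * q))) _.
      rewrite mnormN; apply: le_trans (mnormZ_le (lexx l) (mnormM_le hmdl hn)) _.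
      by rewrite le_eqVlt; apply/orP; left; apply/eqP; ring.
    have : c ^+ 3 * (l * q) <= c ^+ 4 * (r * q).
      apply: ler_pM; rewrite ?exprn_ge0 ?mulr_ge0 //.
      by rewrite ler_wpM2r //; lra.
    lra.
  - by rewrite addrAC subrr add0r; apply: le_trans hedr _; lra.
rewrite -red -mainE -mulrBl Normc.normcM -/d in key.
have := normc_ge0 (Dt - \det (block_mx mul Q mdl mdr)).
set u := normc _ in key *; set e := (r * q * _) in key *.
have hd := d_half; move: key; set w := 96 * _ ^+ 4 * e => key u0.
have -> : 2 * (96 * (20 * c ^+ 4) ^+ 4) * e = 2 * w by rewrite /w; ring.
have : u * 2^-1 <= u * normc d by rewrite ler_wpM2l.
lra.
Qed.

End Estimate.

End BlockEstimate.

Section ExpansionOfDeterminant.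
Variable R : realType.
Local Notation C := R[i].
Local Notation normc := (@Normc.normc R).
Variables (X : R) (A B D : R -> 'M[C]_(2 + 2)).
Variables (Y1 Y2 Z : R -> 'M[C]_(2 + 2, 2)) (ell : R -> 'M[C]_(2, 2 + 2)).
Variables (J1 JZ J2 JD : R -> 'M[C]_2) (E Ei : 'M[C]_(2 + 2)) (P Q mS : 'M[C]_2).
Variables (K : R).
Local Notation "'on' x , P" := (forall x : R, 0 <= x <= X -> P)
  (at level 200, x name, only parsing).
Hypothesis X0 : 0 <= X.
Hypothesis dY1 : (on x, mxderiv Y1 x (A x *m Y1 x)).
Hypothesis dY2 : (on x, mxderiv Y2 x (A x *m Y2 x)).
Hypothesis dZ : (on x, mxderiv Z x (A x *m Z x + B x *m Y1 x)).
Hypothesis dell : (on x, mxderiv ell x (- (ell x *m A x))).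
Hypothesis AK : (on x, mnorm (A x) <= K).
Hypothesis BK : (on x, mnorm (B x) <= K).
Hypothesis DK : (on x, mnorm (D x) <= K).
Hypothesis Y1K : (on x, mnorm (Y1 x) <= K).
Hypothesis Y2K : (on x, mnorm (Y2 x) <= K).
Hypothesis ZK : (on x, mnorm (Z x) <= K).
Hypothesis ellK : (on x, mnorm (ell x) <= K).
Hypothesis dJ1 : (on x, mxderiv J1 x (ell x *m B x *m Y1 x)).
Hypothesis dJZ : (on x, mxderiv JZ x (ell x *m B x *m Z x)).
Hypothesis dJ2 : (on x, mxderiv J2 x (ell x *m B x *m Y2 x)).
Hypothesis dJD : (on x, mxderiv JD x (ell x *m D x *m Y1 x)).
Hypothesis J1X : J1 X = J1 0.
Hypothesis EEi : E *m Ei = 1%:M.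
Hypothesis detE : \det E = 1.
Hypothesis y_unit : row_mx (Y1 0) (Y2 0) \in unitmx.
Hypothesis ell0_y1 : ell 0 *m Y1 0 = 0.
Hypothesis ell0_y2 : ell 0 *m Y2 0 = 1%:M.
Hypothesis ell0_v : ell 0 *m Z 0 = - mS.
Hypothesis ellX_E : ell X *m E = ell 0.
Hypothesis y1X_E : Y1 X = E *m Y1 0.
Hypothesis y2X_E : Y2 X = E *m (Y2 0 + Y1 0 *m Q).
Hypothesis vX_E : Z X = E *m (Z 0 + Y1 0 *m P).

Lemma det_expansion : exists K' delta : R, [/\ 0 <= K', 0 < delta &
  forall (lambda z : C) (h t : R) (S : R -> 'M[C]_(2 + 2)),
  normc lambda <= delta -> 0 <= h <= 1 -> normc z <= t -> t <= 4 -> S 0 = 1%:M ->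
  (on x, mxderiv S x ((A x + lambda *: B x + h%:C *: D x) *m S x)) ->
  let r := normc lambda + t + h in
  let q := normc lambda * (normc lambda + t) + h in
  normc (\det (S X - (1 + z) *: E)
    - \det (block_mx (main_ul P lambda z) Q
                     (main_dl P mS (JZ X - JZ 0) (JD X - JD 0) lambda h%:C)
                     (main_dr Q mS (J2 X - J2 0) lambda z)))
  <= K' * (r * q * (r ^+ 2 + q))].
Proof.
have K0 : 0 <= K by apply: le_trans (mnorm_ge0 _) (AK (x := 0) _); rewrite lexx.
have K30 : 0 <= 3 * K by rewrite mulr_ge0.
have [Kg Kg0 gron] := gronwall (2 + 2) 2 X0 K30.
set NZ := JZ X - JZ 0; set ND := JD X - JD 0; set N2 := J2 X - J2 0.
pose Tu := coord_top (Y1 0) (Y2 0).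
pose cs := [:: mnorm P; mnorm Q; mnorm mS; mnorm NZ; mnorm N2; mnorm ND; mnorm Tu;
  mnorm Ei; mnorm (Tu *m Z 0); Kg * (2 * K ^+ 2); Kg * K ^+ 2;
  8 * X * (K ^+ 3 + 4 * Kg * K ^+ 4)].
(* One number that is at least 1 and dominates each constant in the list. *)
pose c := 1 + \sum_(a <- cs) `|a|.
have c1 : 1 <= c by rewrite lerDl sumr_ge0.
have cc a : a \in cs -> a <= c.
  move=> ain; apply: le_trans (ler_norm _) _; rewrite /c (big_rem _ ain) /=.
  by rewrite addrCA lerDl addr_ge0 // sumr_ge0.
have c20 : 0 < 8 * c ^+ 2 by rewrite mulr_gt0 // exprn_gt0 // (lt_le_trans ltr01).
(* The second witness is the radius demanded by the hypothesis [small] of the block estimate. *)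
exists (2 * (96 * (20 * c ^+ 4) ^+ 4)), (8 * c ^+ 2)^-1; split.
- by rewrite !mulr_ge0 ?exprn_ge0 ?mulr_ge0 ?exprn_ge0 // (le_trans ler01).
- by rewrite invr_gt0.
move=> lambda z h t S hl h01 zt t4 S0 dS /=.
have small : 8 * c ^+ 2 * normc lambda <= 1.
  by rewrite -(ler_pdivlMl _ _ c20) mulr1.
have l1 : normc lambda <= 1.
  apply: le_trans small; rewrite -[leLHS]mul1r ler_wpM2r ?normc_ge0 //.
  have : 1 <= c ^+ 2 by exact: exprn_ege1.
  lra.
have h0 : 0 <= h by case/andP: h01.
have l0 := normc_ge0 lambda.
have X0X : 0 <= X <= X by rewrite X0 lexx.
apply: (det_block_estimate (Ei := Ei) EEi detE y_unit ell0_y1 ell0_y2 ell0_v ellX_E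
  y1X_E y2X_E vX_E c1) => //; try by apply: cc; rewrite /cs !inE eqxx ?orbT.
- have := D1_le dY1 dZ AK BK DK Y1K ZK l1 h01 S0 dS gron X0X.
  move=> /= /le_trans; apply; rewrite mulrA ler_wpM2r ?addr_ge0 ?sqr_ge0 //.
  by apply: cc; rewrite /cs !inE eqxx ?orbT.
- have := D2_le dY2 AK BK DK Y2K l1 h01 S0 dS gron X0X.
  move=> /= /le_trans; apply; rewrite mulrA ler_wpM2r ?addr_ge0 //.
  by apply: cc; rewrite /cs !inE eqxx ?orbT.
- have := invariants_W1 X0 K0 dY1 dZ dell AK BK DK Y1K ZK ellK dJ1 dJZ dJD J1X
    l1 h01 S0 dS gron Kg0.
  rewrite /= S0 mul1mx -/NZ -/ND => /le_trans; apply.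
  rewrite ler_wpM2r ?mulr_ge0 ?addr_ge0 ?sqr_ge0 //.
  by apply: cc; rewrite /cs !inE eqxx ?orbT.
- have := invariants_W2 X0 K0 dY2 dell AK BK DK Y2K ellK dJ2 l1 h01 S0 dS gron Kg0.
  rewrite /= S0 mul1mx -/N2 => /le_trans; apply.
  rewrite ler_wpM2r ?addr_ge0 ?sqr_ge0 //.
  by apply: cc; rewrite /cs !inE eqxx ?orbT.
Qed.

End ExpansionOfDeterminant.

(** * Real differential calculus *)

Section RealCalculus.
Variable R : realType.
Implicit Types (f g : R -> R) (x a b k : R).

(** This rule and the following ones are stated on explicit pointwise functions, the shape that
    [is_derive_auto] meets. *)
Lemma is_deriveFcst (c x : R) : is_derive x 1 (fun _ : R => c) 0.
Proof. exact: is_derive_cst. Qed.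

Lemma is_deriveFid x : is_derive x 1 (fun y : R => y) 1.
Proof. exact: is_derive_id. Qed.

Lemma is_deriveFD f g x a b : is_derive x 1 f a -> is_derive x 1 g b ->
  is_derive x 1 (fun y => f y + g y) (a + b).
Proof. exact: is_deriveD. Qed.

Lemma is_deriveFB f g x a b : is_derive x 1 f a -> is_derive x 1 g b ->
  is_derive x 1 (fun y => f y - g y) (a - b).
Proof. exact: is_deriveB. Qed.

Lemma is_deriveFN f x a : is_derive x 1 f a -> is_derive x 1 (fun y => - f y) (- a).
Proof. exact: is_deriveN. Qed.

Lemma is_deriveFM f g x a b : is_derive x 1 f a -> is_derive x 1 g b ->
  is_derive x 1 (fun y => f y * g y) (a * g x + f x * b).
Proof.
move=> hf hg; apply: is_derive_eq (is_deriveM hf hg) _.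
by rewrite /GRing.scale /=; ring.
Qed.

Lemma is_deriveFX2 f x a : is_derive x 1 f a ->
  is_derive x 1 (fun y => f y ^+ 2) (2 * (f x * a)).
Proof.
move=> hf; have -> : (fun y => f y ^+ 2) = (fun y => f y * f y).
  by apply/funext => y; rewrite expr2.
by apply: is_derive_eq (is_deriveFM hf hf) _; ring.
Qed.

Lemma is_deriveFV f x a : f x != 0 -> is_derive x 1 f a ->
  is_derive x 1 (fun y => (f y)^-1) (- (a * (f x)^-1 ^+ 2)).
Proof.
move=> fx hf; apply: is_derive_eq (is_deriveV fx hf) _.
by rewrite /GRing.scale /= -exprVn; ring.
Qed.

Lemma is_derive_fcomp f g x a b : is_derive (f x) 1 g b -> is_derive x 1 f a ->
  is_derive x 1 (fun y => g (f y)) (b * a).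
Proof. exact: is_derive1_comp. Qed.

End RealCalculus.

(** The derivative is an existential variable filled by the shape of the function, and is compared
    with the expected one afterwards. [eassumption] comes first, so that composites already
    differentiated in the context act as atoms. *)
Ltac is_derive_step :=
  first [ eassumption
        | eapply is_deriveFcst
        | eapply is_deriveFid
        | eapply is_deriveFX2
        | eapply is_deriveFB
        | eapply is_deriveFD
        | eapply is_deriveFN
        | eapply is_deriveFM
        ].
Ltac is_derive_auto := repeat is_derive_step.

Section DirectionalDerivatives.
Variable R : realType.

(** Both sides have the same difference quotient; every directional derivative thereby becomes a
    derivative in one real variable. *)
Lemma is_derive_lineP (E W : normedModType R) (f : E -> W) (x v : E) l :
  is_derive x v f l <-> is_derive (0 : R) 1 (fun h : R => f (h *: v + x)) l.
Proof.
have eqq : (fun h : R => h^-1 *: ((f \o shift x) (h *: v) - f x)) =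
  (fun h : R => h^-1 *: (((fun h : R => f (h *: v + x)) \o shift 0) (h *: 1) - f (0 *: v + x))).
  by apply/funext => h /=; rewrite addr0 scale0r add0r [_%:A]mulr1.
by split=> -[h1 h2]; (split; [move: h1; rewrite /derivable eqq|move: h2; rewrite /derive eqq]).
Qed.

Lemma is_derive_line (E W : normedModType R) (f : E -> W) (x v : E) (a : R) l :
  is_derive (a *: v + x) v f l -> is_derive a 1 (fun h : R => f (h *: v + x)) l.
Proof.
move=> /is_derive_lineP h.
suff: is_derive (0 : R) 1 (fun h : R => (fun h : R => f (h *: v + x)) (h *: 1 + a)) l.
  by move=> h'; apply/is_derive_lineP.
have -> : (fun h : R => f ((h *: 1 + a) *: v + x)) = (fun h : R => f (h *: v + (a *: v + x))).
  by apply/funext => y; rewrite scalerDl addrA [_%:A]mulr1.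
by [].
Qed.

End DirectionalDerivatives.

(** * Schwarz's theorem on mixed derivatives *)

Section MixedPartials.
Variable R : realType.

Lemma nbhs_plane (E : normedModType R) (z u v : E) (N : set E) : nbhs z N ->
  exists2 s : R, 0 < s & forall a b, `|a| <= s -> `|b| <= s -> N (a *: u + (b *: v + z)).
Proof.
move=> /nbhs_normP[e /= e0 eN].
have n0 : 0 < `|u| + `|v| + 1 by rewrite ltr_wpDl // addr_ge0.
exists (e / 2 / (`|u| + `|v| + 1)); first by rewrite !divr_gt0.
set s := e / 2 / _ => a b ha hb.
apply: eN; rewrite /= /ball_ /=.
have -> : z - (a *: u + (b *: v + z)) = - (a *: u + b *: v).
  by rewrite addrA [_ + z]addrC opprD addrA subrr add0r.
rewrite normrN; apply: le_lt_trans (ler_normD _ _) _; rewrite !normrZ.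
have s0 : 0 < s by rewrite !divr_gt0.
have h1 : `|a| * `|u| <= s * `|u| by rewrite ler_wpM2r.
have h2 : `|b| * `|v| <= s * `|v| by rewrite ler_wpM2r.
have : s * (`|u| + `|v| + 1) = e / 2 by rewrite /s divfK // gt_eqF.
lra.
Qed.

(** The mean value theorem, applied along u to the difference of [f] over a step in v, then along v
    to [f1]. *)
Lemma mixed_difference (E : normedModType R) (f f1 f2 : E -> R) (z u v : E) (s : R) :
  0 < s ->
  (forall a b, 0 <= a <= s -> 0 <= b <= s ->
     is_derive (a *: u + (b *: v + z)) u f (f1 (a *: u + (b *: v + z))) /\
     is_derive (b *: v + (a *: u + z)) v f1 (f2 (b *: v + (a *: u + z)))) ->
  exists a b, [/\ 0 <= a <= s, 0 <= b <= s &
    f (s *: u + (s *: v + z)) - f (s *: u + z) - (f (s *: v + z) - f z)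
      = f2 (b *: v + (a *: u + z)) * s * s].
Proof.
move=> s0 df; have s0' := ltW s0.
have perm a b : a *: u + (b *: v + z) = b *: v + (a *: u + z) by rewrite addrCA.
pose g a := f (a *: u + (s *: v + z)) - f (a *: u + z).
have dg a : 0 <= a <= s -> is_derive a 1 g
    (f1 (a *: u + (s *: v + z)) - f1 (a *: u + z)).
  move=> ha; apply: is_deriveFB; apply: is_derive_line.
    by apply: (df a s ha _).1; rewrite s0' lexx.
  by have := (df a 0 ha); rewrite lexx s0' scale0r add0r => /(_ isT)[].
have [a ha hg] := mean_value s0' dg.
have [b hb hb'] := @mean_value _ (fun b => f1 (b *: v + (a *: u + z)))
  (fun b => f2 (b *: v + (a *: u + z))) 0 s s0'
  (fun b hb => is_derive_line (df a b ha hb).2).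
exists a, b; split=> //; rewrite subr0 in hb' hg.
rewrite -hb' scale0r add0r -perm -hg.
by rewrite /g !scale0r !add0r.
Qed.

(** The second difference over a small square is symmetric in u and v, so it equals s^2 times a
    value of [fuv] and also s^2 times a value of [fvu], both taken near z. Continuity at z then
    forces equality. *)
Lemma mixed_partials (E : normedModType R) (D : set E) (f fu fv fuv fvu : E -> R) (z u v : E) :
  open D -> D z ->
  (forall w, D w -> is_derive w u f (fu w)) -> (forall w, D w -> is_derive w v f (fv w)) ->
  (forall w, D w -> is_derive w v fu (fuv w)) -> (forall w, D w -> is_derive w u fv (fvu w)) ->
  {for z, continuous fuv} -> {for z, continuous fvu} -> fuv z = fvu z.
Proof.
move=> oD Dz dfu dfv dfuv dfvu c1 c2.
apply/eqP; rewrite -subr_eq0 -normr_eq0; apply/negPn/negP => ne.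
have e0 : 0 < `|fuv z - fvu z| / 2 by rewrite divr_gt0 // lt_neqAle eq_sym ne normr_ge0.
set e := _ / 2 in e0.
have n1 : \forall w \near z, `|fuv z - fuv w| < e by move/cvgrPdist_lt : c1; apply.
have n2 : \forall w \near z, `|fvu z - fvu w| < e by move/cvgrPdist_lt : c2; apply.
have nD : \forall w \near z, D w by exact: open_nbhs_nbhs.
have [s s0 hs] := nbhs_plane u v (filterI nD (filterI n1 n2)).
have nb a : 0 <= a <= s -> `|a| <= s by case/andP=> a0 /(le_trans _); rewrite ger0_norm // => ->.
have perm a b : a *: u + (b *: v + z) = b *: v + (a *: u + z) by rewrite addrCA.
have [|a [b [ha hb]]] := @mixed_difference _ f fu fuv z u v s s0.
  move=> a b ha hb; rewrite -perm.
  by have [Dw _] := hs a b (nb _ ha) (nb _ hb); split; [exact: dfu|exact: dfuv].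
rewrite -perm; have [_ [+ _]] := hs a b (nb _ ha) (nb _ hb).
move: (fuv (_ + _)) => m1 h1 E1.
have [|b' [a' [hb' ha']]] := @mixed_difference _ f fv fvu z v u s s0.
  move=> b' a' hb' ha'; rewrite -!perm.
  by have [Dw _] := hs a' b' (nb _ ha') (nb _ hb'); split; [exact: dfv|exact: dfvu].
have [_ [_ +]] := hs a' b' (nb _ ha') (nb _ hb').
move: (fvu (_ + _)) => m2 h2 E2.
have E3 : m1 = m2.
  have ss : s * s != 0 by rewrite mulf_neq0 ?gt_eqF.
  apply: (mulIf ss); rewrite !mulrA; move: E1 E2; rewrite (perm s s).
  by move: (f _) (f _) (f _) (f _) => ? ? ? ? <- <-; ring.
have : `|fuv z - fvu z| < e + e.
  have -> : fuv z - fvu z = (fuv z - m1) - (fvu z - m2) by rewrite E3; ring.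
  by apply: le_lt_trans (ler_normB _ _) _; rewrite ltrD.
by rewrite /e; move: (`|_ - _|) => y; lra.
Qed.

End MixedPartials.

Section CurveDerivative.
Variable R : realType.

(** A chain rule from partial derivatives, needed because the profiles are evaluated at an endpoint,
    the period, that moves with the parameters. The increment in the second variable is a slope
    times [X s - X 0], and the mean value theorem identifies this slope with a nearby value of
    [psi]. *)
Lemma is_derive_along_curve (phi psi : R -> R -> R) (X : R -> R) (k X' : R) :
  nbhs (0 : R, X 0) (fun p : R * R => is_derive p.2 1 (phi p.1) (psi p.1 p.2)) ->
  {for (0, X 0), continuous (fun p : R * R => psi p.1 p.2)} ->
  is_derive (0 : R) 1 (fun s => phi s (X 0)) k -> is_derive (0 : R) 1 X X' ->
  is_derive (0 : R) 1 (fun s => phi s (X s)) (k + psi 0 (X 0) * X').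
Proof.
move=> dphi cpsi dk dX.
(* The value chosen where [X s = X 0] makes [q] continuous at 0. *)
pose q s := if X s == X 0 then psi 0 (X 0) else (phi s (X s) - phi s (X 0)) / (X s - X 0).
have qE s : phi s (X s) - phi s (X 0) = q s * (X s - X 0).
  rewrite /q; case: eqP => [->|/eqP ne]; first by rewrite !subrr mulr0.
  by rewrite divfK // subr_eq0.
have cq : q s @[s --> 0] --> psi 0 (X 0).
  apply/cvgrPdist_lt => e e0.
  have /cvgrPdist_lt /(_ e e0) ne := cpsi.
  have [[A B] /= [A0 BX] AB] := filterI dphi ne.
  have cX : X s @[s --> 0] --> X 0 by exact: (is_derive_continuous dX).
  have [r /= r0 rB] := (nbhs_ballP _ _).1 BX.
  have nX : \forall s \near (0 : R), ball (X 0) r (X s).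
    by move/cvg_ballP : cX => /(_ r r0).
  near=> s.
  rewrite /q; case: eqP => [_|/eqP XsX]; first by rewrite subrr normr0.
  have As : A s by near: s.
  have Bs : ball (X 0) r (X s) by near: s.
  have key x y : x <= y -> ball (X 0) r x -> ball (X 0) r y ->
      exists2 c, ball (X 0) r c & phi s y - phi s x = psi s c * (y - x).
    move=> xy; rewrite -ball_normE /= => Bx By.
    have inB c : x <= c <= y -> `|X 0 - c| < r.
      by move: Bx By; rewrite !ltr_norml => /andP[? ?] /andP[? ?] /andP[? ?]; lra.
    have [c hc hc'] := @mean_value _ (phi s) (psi s) x y xy
      (fun c hc => (AB (s, c) (conj As (rB _ (ltac:(rewrite -ball_normE; exact: (inB c hc)))))).1).
    by exists c => //; exact: inB.
  have Bc c : ball (X 0) r c -> `|psi 0 (X 0) - psi s c| < e.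
    by move=> hc; exact: (AB (s, c) (conj As (rB _ hc))).2.
  have dX0 : X s - X 0 != 0 by rewrite subr_eq0.
  have B0 : ball (X 0) r (X 0) by exact: ballxx.
  have [le|/ltW ge] := leP (X 0) (X s).
    have [c hc ->] := key _ _ le B0 Bs; rewrite mulfK //; exact: Bc.
  have [c hc hc'] := key _ _ ge Bs B0.
  have -> : phi s (X s) - phi s (X 0) = psi s c * (X s - X 0).
    by rewrite -[LHS]opprB hc' -mulrN opprB.
  by rewrite mulfK //; exact: Bc.
have E : (fun s => phi s (X s)) = (fun s => phi s (X 0) + (q s * (X s - X 0))).
  by apply/funext => s; rewrite -qE addrC subrK.
rewrite E; apply: is_deriveFD => //.
(* Continuity of [q] at 0 suffices here, since its cofactor [X s - X 0] vanishes at 0. *)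
suff cv : (fun h : R => h^-1 *: (((fun s => q s * (X s - X 0)) \o shift 0) (h *: 1) - q 0 * (X 0 - X 0)))
   @ 0^' --> psi 0 (X 0) * X'.
  by split; [apply/cvg_ex; exists (psi 0 (X 0) * X')|exact: cvg_lim cv].
have -> : (fun h : R => h^-1 *: (((fun s => q s * (X s - X 0)) \o shift 0) (h *: 1) - q 0 * (X 0 - X 0)))
  = (fun h => q h * (h^-1 *: ((X \o shift 0) (h *: 1) - X 0))).
  apply/funext => h /=; rewrite subrr mulr0 subr0 addr0 [_%:A]mulr1 /GRing.scale /=; ring.
apply: cvgM; first by apply: cvg_within_filter; exact: cq.
by case: dX => d1 <-.
Unshelve. all: by end_near. Qed.

End CurveDerivative.

Section SmoothMaps.
Variable R : realType.

(** Since [D] is open, equality on [D] is equality near each of its points, so limits and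
    derivatives agree. *)
Lemma class_C_ext (k : nat) (E F : normedModType R) (D : set E) (f g : E -> F) :
  open D -> (forall z, D z -> f z = g z) -> class_C k D f -> class_C k D g.
Proof.
move=> oD; elim: k f g => [|k IH] f g fg [cf df].
  split=> // z Dz; have nD : \forall w \near z, f w = g w.
    by apply: filterS (open_nbhs_nbhs (conj oD Dz)) => w; exact: fg.
  rewrite /prop_for /continuous_at -(fg z Dz).
  exact: cvg_trans (near_eq_cvg nD) (cf z Dz).
have near z : D z -> \forall w \near z, f w = g w.
  by move=> Dz; apply: filterS (open_nbhs_nbhs (conj oD Dz)) => w; exact: fg.
split=> [z Dz|v].
  rewrite /prop_for /continuous_at -(fg z Dz).
  exact: cvg_trans (near_eq_cvg (near z Dz)) (cf z Dz).
have [dfv cfv] := df v; split=> [z Dz|].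
  by apply: near_eq_derivable (dfv z Dz); exact: near.
by apply: IH cfv => z Dz; exact/near_eq_derive/near.
Qed.

Lemma class_C_coord (k : nat) (E : normedModType R) m n (D : set E) (f : E -> 'M[R]_(m, n)) i j :
  open D -> class_C k D f -> class_C k D (fun z => f z i j).
Proof.
move=> oD; elim: k f => [|k IH] f [cf df].
  split=> // z Dz; apply: (@continuous_comp _ _ _ f (fun M : 'M[R]_(m, n) => M i j)).
    exact: cf.
  exact: coord_continuous.
split=> [z Dz|v].
  apply: (@continuous_comp _ _ _ f (fun M : 'M[R]_(m, n) => M i j)); first exact: cf.
  exact: coord_continuous.
have [dfv cfv] := df v; split=> [z Dz|].
  by move/derivable_mxP : (dfv z Dz).
apply: class_C_ext oD _ (IH _ cfv) => z Dz.
by rewrite derive_mx ?mxE //; exact: dfv.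
Qed.

Lemma smooth_coord (E : normedModType R) m n (D : set E) (f : E -> 'M[R]_(m, n)) i j :
  open D -> smooth_in D f -> smooth_in D (fun z => f z i j).
Proof. by move=> oD sf k; exact: class_C_coord. Qed.

Lemma smooth_continuous (E F : normedModType R) (D : set E) (f : E -> F) z :
  smooth_in D f -> D z -> {for z, continuous f}.
Proof. by move=> /(_ 0%N)[cf _]; exact: cf. Qed.

Lemma smooth_is_derive (E F : normedModType R) (D : set E) (f : E -> F) z v :
  smooth_in D f -> D z -> is_derive z v f ('D_v f z).
Proof. by move=> /(_ 1%N)[_ /(_ v)[df _]] Dz; apply: derivableP; exact: df. Qed.

Lemma smooth_derive (E F : normedModType R) (D : set E) (f : E -> F) v :
  smooth_in D f -> smooth_in D ('D_v f).
Proof. by move=> sf k; have [_ /(_ v)[]] := sf k.+1. Qed.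

Lemma smooth_mixed (E : normedModType R) (D : set E) (f : E -> R) u v z :
  open D -> smooth_in D f -> D z -> 'D_v ('D_u f) z = 'D_u ('D_v f) z.
Proof.
move=> oD sf Dz; apply: (@mixed_partials _ E D f ('D_u f) ('D_v f) ('D_v ('D_u f))
  ('D_u ('D_v f)) z u v oD Dz) => [w Dw|w Dw|w Dw|w Dw||].
- exact: (smooth_is_derive _ sf).
- exact: (smooth_is_derive _ sf).
- exact: (smooth_is_derive _ (smooth_derive _ sf)).
- exact: (smooth_is_derive _ (smooth_derive _ sf)).
- exact: (smooth_continuous (smooth_derive _ (smooth_derive _ sf))).
- exact: (smooth_continuous (smooth_derive _ (smooth_derive _ sf))).
Qed.

End SmoothMaps.

Section PlaneVectors.
Variable R : realType.
Implicit Types u v : 'cV[R]_2.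

Lemma ord2P (i : 'I_2) : i = 0 \/ i = 1.
Proof. by case: i => [[|[|//]] hi]; [left|right]; apply/val_inj. Qed.

Lemma sqnorm2E u : sqnorm u = u 0 0 ^+ 2 + u 1 0 ^+ 2.
Proof.
rewrite /sqnorm !big_ord_recl !big_ord0 !addr0.
by have -> : lift ord0 ord0 = 1 :> 'I_2 by apply/val_inj.
Qed.

Lemma dot2E u v : dot u v = u 0 0 * v 0 0 + u 1 0 * v 1 0.
Proof.
rewrite /dot !big_ord_recl big_ord0 addr0.
by have -> : lift ord0 ord0 = 1 :> 'I_2 by apply/val_inj.
Qed.

Lemma J0E u : (J *m u) 0 0 = u 1 0.
Proof.
rewrite !mxE !big_ord_recl big_ord0 !mxE /= mul0r mul1r addr0 add0r.
by have -> : lift ord0 ord0 = 1 :> 'I_2 by apply/val_inj.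
Qed.

Lemma J1E u : (J *m u) 1 0 = - u 0 0.
Proof.
by rewrite !mxE !big_ord_recl big_ord0 !mxE /= mul0r mulN1r !addr0.
Qed.

Lemma sqnorm_ge0 m n (M : 'M[R]_(m, n)) : 0 <= sqnorm M.
Proof. by apply: sumr_ge0 => i _; apply: sumr_ge0 => j _; exact: sqr_ge0. Qed.

Lemma sqnorm_planar_grad n (p : 'cV[R]_2) (G : 'M[R]_(2, n.+1)) :
  (forall i j, G i j = if j == 0 then p i 0 else 0) -> sqnorm G = sqnorm p.
Proof.
move=> hG; rewrite /sqnorm; apply: eq_bigr => i _.
rewrite !big_ord_recl big_ord0 hG eqxx big1 // => j _.
by rewrite hG /= expr0n.
Qed.

End PlaneVectors.

(** * The profile equation and its linearization *)

Section EulerLagrange.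
Variables (R : realType) (n : nat) (kappa W g g1 w w1 : R -> R).
Hypothesis kappaE : forall r : R, 0 <= r -> kappa r = g r.
Hypothesis WE : forall r : R, 0 <= r -> W r = w r.
Hypothesis dg : forall r : R, is_derive r 1 g (g1 r).
Hypothesis dw : forall r : R, is_derive r 1 w (w1 r).
Local Notation Hu := (@Hu R n kappa W).

(** [kappa] and [W] are only controlled on the nonnegative half-line, where every [sqnorm] lies.
    Trading them for the extensions [g] and [w] makes two-sided differentiation at 0 legitimate. *)
Lemma HuE (omega c : R) (u : 'cV[R]_2) (G : 'M[R]_(2, n.+1)) :
  Hu omega c u G = 2^-1 * g (sqnorm u) * sqnorm G + w (sqnorm u)
    - omega * (2^-1 * sqnorm u) + c * (2^-1 * dot (J *m u) (col 0 G)).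
Proof. by rewrite /Defs.Hu /H0 /Mass /Q1 kappaE ?WE // sqnorm_ge0. Qed.

Lemma is_derive_sqnorm_line (u : 'cV[R]_2) i :
  is_derive (0 : R) 1 (fun h : R => sqnorm (h *: delta_mx i 0 + u)) (2 * u i 0).
Proof.
have [-> | ->] := ord2P i.
  have -> : (fun h : R => sqnorm (h *: delta_mx 0 0 + u)) =
      (fun h => (h + u 0 0) ^+ 2 + u 1 0 ^+ 2).
    by apply/funext => h; rewrite sqnorm2E !mxE /= mulr1 mulr0 add0r.
  by eapply is_derive_eq; [is_derive_auto|rewrite /=; ring].
have -> : (fun h : R => sqnorm (h *: delta_mx 1 0 + u)) =
    (fun h => u 0 0 ^+ 2 + (h + u 1 0) ^+ 2).
  by apply/funext => h; rewrite sqnorm2E !mxE /= mulr1 mulr0 add0r.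
by eapply is_derive_eq; [is_derive_auto|rewrite /=; ring].
Qed.

Lemma grad_U_Hu (omega c : R) (u : 'cV[R]_2) (G : 'M[R]_(2, n.+1)) i :
  grad_U (Hu omega c) u G i 0 =
    (g1 (sqnorm u) * sqnorm G + 2 * w1 (sqnorm u) - omega) * u i 0
    - c / 2 * (J *m col 0 G) i 0.
Proof.
rewrite mxE; apply: derive_val; apply/is_derive_lineP.
have ds := is_derive_sqnorm_line u i.
pose s h := sqnorm (h *: delta_mx i 0 + u : 'cV[R]_2).
have s0 : s 0 = sqnorm u by rewrite /s scale0r add0r.
have dgs : is_derive (0 : R) 1 (fun h : R => g (s h)) (g1 (sqnorm u) * (2 * u i 0)).
  by apply: is_derive_fcomp ds; rewrite -/(s 0) s0.
have dws : is_derive (0 : R) 1 (fun h : R => w (s h)) (w1 (sqnorm u) * (2 * u i 0)).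
  by apply: is_derive_fcomp ds; rewrite -/(s 0) s0.
have dd : is_derive (0 : R) 1 (fun h : R => dot (J *m (h *: delta_mx i 0 + u)) (col 0 G))
    (- (J *m col 0 G) i 0).
  have -> : (fun h : R => dot (J *m (h *: delta_mx i 0 + u)) (col 0 G)) =
    (fun h : R => h * (- (J *m col 0 G) i 0) + dot (J *m u) (col 0 G)).
    apply/funext => h; rewrite !dot2E.
    by have [-> | ->] := ord2P i; rewrite ?J0E ?J1E !mxE /=; ring.
  by eapply is_derive_eq; [is_derive_auto|rewrite /=; ring].
have -> : (fun h : R => Hu omega c (h *: delta_mx i 0 + u) G) =
  (fun h : R => 2^-1 * g (s h) * sqnorm G + w (s h) - omega * (2^-1 * s h)
     + c * (2^-1 * dot (J *m (h *: delta_mx i 0 + u)) (col 0 G))).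
  by apply/funext => h; rewrite HuE.
have ds' : is_derive (0 : R) 1 s (2 * u i 0) by [].
eapply is_derive_eq; first by is_derive_auto.
by rewrite /= s0; field.
Qed.

Lemma is_derive_sqnorm_mx (m p : nat) (G : 'M[R]_(m, p)) i j :
  is_derive (0 : R) 1 (fun h : R => sqnorm (h *: delta_mx i j + G)) (2 * G i j).
Proof.
have -> : 2 * G i j = \sum_k \sum_l 2 * (((k == i) && (l == j))%:R * G k l).
  rewrite (bigD1 i) //= (bigD1 j) //= !eqxx mul1r big1 ?big1 ?addr0 // => [k ki|k kj].
    by apply: big1 => l _; rewrite (negPf ki) mul0r mulr0.
  by rewrite (negPf kj) mul0r mulr0.
apply: is_derive_fsum => k; apply: is_derive_fsum => l.
have -> : (fun h : R => (h *: delta_mx i j + G) k l ^+ 2) =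
  (fun h => (h * ((k == i) && (l == j))%:R + G k l) ^+ 2).
  by apply/funext => h; rewrite !mxE.
by eapply is_derive_eq; [is_derive_auto|rewrite /=; ring].
Qed.

Lemma grad_nablaU_Hu (omega c : R) (u : 'cV[R]_2) (G : 'M[R]_(2, n.+1)) i j :
  grad_nablaU (Hu omega c) u G i j =
    g (sqnorm u) * G i j + (if j == 0 then c / 2 * (J *m u) i 0 else 0).
Proof.
rewrite mxE; apply: derive_val; apply/is_derive_lineP.
have ds := is_derive_sqnorm_mx G i j.
set e : R := if j == 0 then (J *m u) i 0 else 0.
have dd : is_derive (0 : R) 1 (fun h : R => dot (J *m u) (col 0 (h *: delta_mx i j + G))) e.
  have -> : (fun h : R => dot (J *m u) (col 0 (h *: delta_mx i j + G))) =
    (fun h : R => h * e + dot (J *m u) (col 0 G)).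
    apply/funext => h; rewrite /e !dot2E; move: (J *m u) => v; rewrite !mxE.
    rewrite [0 == j]eq_sym; case: ifP => _ /=; rewrite ?andbF ?andbT /=; last by ring.
    by have [-> | ->] := ord2P i; rewrite /= ?mulr1n ?mulr0n; ring.
  by eapply is_derive_eq; [is_derive_auto|rewrite /=; ring].
have -> : (fun h : R => Hu omega c u (h *: delta_mx i j + G)) =
  (fun h : R => 2^-1 * g (sqnorm u) * sqnorm (h *: delta_mx i j + G) + w (sqnorm u)
     - omega * (2^-1 * sqnorm u)
     + c * (2^-1 * dot (J *m u) (col 0 (h *: delta_mx i j + G)))).
  by apply/funext => h; rewrite HuE.
eapply is_derive_eq; first by is_derive_auto.
have -> : (if j == 0 then c / 2 * (J *m u) i 0 else 0) = c / 2 * e.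
  by rewrite /e; case: ifP => _; rewrite ?mulr0.
by field.
Qed.

(* The profile equation; [u], [p], [s] stand for U, U_x, U_xx. *)
Definition EL (omega c : R) (u p s : 'cV[R]_2) (i : 'I_2) : R :=
  (g1 (sqnorm u) * sqnorm p + 2 * w1 (sqnorm u) - omega) * u i 0
  - (g (sqnorm u) * s i 0 + 2 * g1 (sqnorm u) * dot u p * p i 0)
  - c * (J *m p) i 0.

Variables (omega c : R) (U p s : R -> 'cV[R]_2).
Hypothesis dU : forall (x : R) i, is_derive x 1 (fun y => U y i 0) (p x i 0).
Hypothesis dp : forall (x : R) i, is_derive x 1 (fun y => p y i 0) (s x i 0).

Lemma grad_planar z i j : grad (@planar R n U) z i j = if j == 0 then p (z 0 0) i 0 else 0.
Proof.
rewrite mxE; apply: derive_val; apply/is_derive_lineP.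
have -> : (fun h : R => planar U (h *: delta_mx 0 j + z) i 0) =
  (fun h : R => U (h * (j == 0)%:R + z 0 0) i 0).
  by apply/funext => h; rewrite /planar !mxE eqxx eq_sym.
have d1 : is_derive (0 : R) 1 (fun h : R => h * (j == 0)%:R + z 0 0) (j == 0)%:R.
  by eapply is_derive_eq; [is_derive_auto|rewrite /=; ring].
apply: is_derive_eq (@is_derive_fcomp R (fun h : R => h * (j == 0)%:R + z 0 0)
  (fun y => U y i 0) 0 _ _ (dU _ i) d1) _.
by rewrite mul0r add0r; case: ifP => _; rewrite ?mulr1 ?mulr0.
Qed.

Lemma is_derive_sqnorm_curve (x : R) : is_derive x 1 (fun y => sqnorm (U y)) (2 * dot (U x) (p x)).
Proof.
have d0 := dU x 0; have d1 := dU x 1.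
have -> : (fun y => sqnorm (U y)) = (fun y => U y 0 0 ^+ 2 + U y 1 0 ^+ 2).
  by apply/funext => y; rewrite sqnorm2E.
by eapply is_derive_eq; [is_derive_auto|rewrite dot2E; ring].
Qed.

(** The momentum term of the density contributes c / 2 times J U_x twice, once through the gradient
    in U and once through the divergence; this is the coefficient c in [EL]. *)
Lemma vargrad_planar z i : vargrad (Hu omega c) (@planar R n U) z i 0 =
  EL omega c (U (z 0 0)) (p (z 0 0)) (s (z 0 0)) i.
Proof.
rewrite /vargrad [LHS]mxE [X in _ + X]mxE grad_U_Hu.
rewrite (sqnorm_planar_grad (grad_planar z)).
have -> : col 0 (grad (@planar R n U) z) = p (z 0 0).
  by apply/colP => k; rewrite mxE grad_planar.
(* A planar state has no transverse gradient and the momentum only involves the first column, so the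
   transverse terms of the divergence are derivatives of 0. *)
rewrite [div _ _ _ _]mxE big_ord_recl big1 => [|j _]; last first.
  apply: derive_val; apply/is_derive_lineP.
  have -> : (fun h : R => grad_nablaU (Hu omega c) (planar U (h *: delta_mx 0 (lift ord0 j) + z))
      (grad (@planar R n U) (h *: delta_mx 0 (lift ord0 j) + z)) i (lift ord0 j)) = cst 0.
    by apply/funext => h; rewrite grad_nablaU_Hu grad_planar /= mulr0 addr0.
  exact: is_derive_cst.
have -> : 'D_(delta_mx 0 ord0) (fun z' => grad_nablaU (Hu omega c) (planar U z')
    (grad (@planar R n U) z') i ord0) z =
  g (sqnorm (U (z 0 0))) * s (z 0 0) i 0
  + 2 * g1 (sqnorm (U (z 0 0))) * dot (U (z 0 0)) (p (z 0 0)) * p (z 0 0) i 0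
  + c / 2 * (J *m p (z 0 0)) i 0.
  apply: derive_val; apply/is_derive_lineP.
  pose f y := g (sqnorm (U y)) * p y i 0 + c / 2 * (J *m U y) i 0.
  have -> : (fun h : R => grad_nablaU (Hu omega c) (planar U (h *: delta_mx 0 ord0 + z))
      (grad (@planar R n U) (h *: delta_mx 0 ord0 + z)) i ord0) = (fun h => f (h + z 0 0)).
    apply/funext => h; rewrite grad_nablaU_Hu grad_planar /planar eqxx.
    have -> : (h *: delta_mx 0 ord0 + z) 0 0 = h + z 0 0 by rewrite !mxE eqxx mulr1.
    by [].
  have d1 : is_derive (0 : R) 1 (fun h : R => h + z 0 0) 1.
    by eapply is_derive_eq; [is_derive_auto|rewrite /=; ring].
  have df (x : R) : is_derive x 1 f (g (sqnorm (U x)) * s x i 0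
    + 2 * g1 (sqnorm (U x)) * dot (U x) (p x) * p x i 0 + c / 2 * (J *m p x) i 0).
    have dq := is_derive_fcomp (dg (sqnorm (U x))) (is_derive_sqnorm_curve x).
    have dpi := dp x i.
    have dJ : is_derive x 1 (fun y => (J *m U y) i 0) ((J *m p x) i 0).
      have [-> | ->] := ord2P i.
        have -> : (fun y => (J *m U y) 0 0) = (fun y => U y 1 0) by apply/funext => y; rewrite J0E.
        by rewrite J0E.
      have -> : (fun y => (J *m U y) 1 0) = (fun y => - U y 0 0) by apply/funext => y; rewrite J1E.
      by rewrite J1E; exact: is_deriveFN.
    rewrite /f; eapply is_derive_eq; first by is_derive_auto.
    by rewrite /=; ring.
  apply: is_derive_eq (@is_derive_fcomp R (fun h : R => h + z 0 0) f 0 _ _ (df _) d1) _.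
  by rewrite add0r mulr1.
by rewrite /EL /=; field.
Qed.

End EulerLagrange.

Section Linearization.
Variables (R : realType) (n : nat) (kappa W g g1 g2 w w1 w2 : R -> R).
Hypothesis kappaE : forall r : R, 0 <= r -> kappa r = g r.
Hypothesis WE : forall r : R, 0 <= r -> W r = w r.
Hypothesis dg : forall r : R, is_derive r 1 g (g1 r).
Hypothesis dg1 : forall r : R, is_derive r 1 g1 (g2 r).
Hypothesis dw : forall r : R, is_derive r 1 w (w1 r).
Hypothesis dw1 : forall r : R, is_derive r 1 w1 (w2 r).
Local Notation EL := (EL g g1 w1).

Lemma is_derive_dot_curve (u v u' v' : R -> 'cV[R]_2) (x : R) :
  (forall i, is_derive x 1 (fun y => u y i 0) (u' x i 0)) ->
  (forall i, is_derive x 1 (fun y => v y i 0) (v' x i 0)) ->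
  is_derive x 1 (fun y => dot (u y) (v y)) (dot (u' x) (v x) + dot (u x) (v' x)).
Proof.
move=> du dv; have du0 := du 0; have du1 := du 1; have dv0 := dv 0; have dv1 := dv 1.
have -> : (fun y => dot (u y) (v y)) =
    (fun y => u y 0 0 * v y 0 0 + u y 1 0 * v y 1 0).
  by apply/funext => y; rewrite dot2E.
by eapply is_derive_eq; [is_derive_auto|rewrite !dot2E; ring].
Qed.

Lemma sqnorm_dot (u : 'cV[R]_2) : sqnorm u = dot u u.
Proof. by rewrite sqnorm2E dot2E !expr2. Qed.

Lemma is_derive_J_curve (u u' : R -> 'cV[R]_2) (x : R) i :
  (forall i, is_derive x 1 (fun y => u y i 0) (u' x i 0)) ->
  is_derive x 1 (fun y => (J *m u y) i 0) ((J *m u' x) i 0).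
Proof.
move=> du; have [-> | ->] := ord2P i.
  have -> : (fun y => (J *m u y) 0 0) = (fun y => u y 1 0) by apply/funext => y; rewrite J0E.
  by rewrite J0E.
have -> : (fun y => (J *m u y) 1 0) = (fun y => - u y 0 0) by apply/funext => y; rewrite J1E.
by rewrite J1E; exact: is_deriveFN.
Qed.

(* [LEL] linearizes [EL] in the direction ([a], [b], [d]) of (U, U_x, U_xx); [LEL0] is
   its part of order at most 1. *)
Definition LEL0 (omega c : R) (u p s a b : 'cV[R]_2) (i : 'I_2) : R :=
  (2 * g2 (sqnorm u) * dot u a * sqnorm p + 2 * g1 (sqnorm u) * dot p b
    + 4 * w2 (sqnorm u) * dot u a) * u i 0
  + (g1 (sqnorm u) * sqnorm p + 2 * w1 (sqnorm u) - omega) * a i 0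
  - (2 * g1 (sqnorm u) * dot u a * s i 0
     + 4 * g2 (sqnorm u) * dot u a * dot u p * p i 0
     + 2 * g1 (sqnorm u) * (dot a p + dot u b) * p i 0
     + 2 * g1 (sqnorm u) * dot u p * b i 0)
  - c * (J *m b) i 0.

Definition LEL (omega c : R) (u p s a b d : 'cV[R]_2) (i : 'I_2) : R :=
  LEL0 omega c u p s a b i - g (sqnorm u) * d i 0.

(** One chain rule with three uses: along a ray of states it gives the Hessian, along a line of
    parameters the equation of the derivatives of the family, and along x the equation of the
    translation mode. *)
Lemma is_derive_EL (omega c omega' c' : R -> R) (u p s u' p' s' : R -> 'cV[R]_2) (x : R) i :
  is_derive x 1 omega (omega' x) -> is_derive x 1 c (c' x) ->
  (forall i, is_derive x 1 (fun y => u y i 0) (u' x i 0)) ->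
  (forall i, is_derive x 1 (fun y => p y i 0) (p' x i 0)) ->
  (forall i, is_derive x 1 (fun y => s y i 0) (s' x i 0)) ->
  is_derive x 1 (fun y => EL (omega y) (c y) (u y) (p y) (s y) i)
    (LEL (omega x) (c x) (u x) (p x) (s x) (u' x) (p' x) (s' x) i
     - omega' x * u x i 0 - c' x * (J *m p x) i 0).
Proof.
move=> domega dc du dp ds.
have duu := is_derive_dot_curve du du; have dpp := is_derive_dot_curve dp dp.
have dup := is_derive_dot_curve du dp; have dJ := is_derive_J_curve i dp.
have dui := du i; have dpi := dp i; have dsi := ds i.
have q0 := is_derive_fcomp (dg _) duu; have q1 := is_derive_fcomp (dg1 _) duu.
have q2 := is_derive_fcomp (dw1 _) duu.
have -> : (fun y => EL (omega y) (c y) (u y) (p y) (s y) i) = (fun y =>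
  (g1 (dot (u y) (u y)) * dot (p y) (p y) + 2 * w1 (dot (u y) (u y)) - omega y) * u y i 0
  - (g (dot (u y) (u y)) * s y i 0 + 2 * g1 (dot (u y) (u y)) * dot (u y) (p y) * p y i 0)
  - c y * (J *m p y) i 0).
  by apply/funext => y; rewrite /EL !sqnorm_dot.
eapply is_derive_eq; first by is_derive_auto.
rewrite /LEL /LEL0 !sqnorm_dot /=.
rewrite !(dot2E (u' x)) !(dot2E (p' x)) !(dot2E (p x)) !(dot2E (u x) (u' x)) !(dot2E (u x) (p' x)).
rewrite !(dot2E (u x) (p x)).
ring.
Qed.

Variables (omega c : R) (V p s : R -> 'cV[R]_2).
Hypothesis dV : forall (x : R) i, is_derive x 1 (fun y => V y i 0) (p x i 0).
Hypothesis dp : forall (x : R) i, is_derive x 1 (fun y => p y i 0) (s x i 0).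

Lemma HessV_planar (psi psi' psi'' : R -> 'cV[R]_2) (x : R) i :
  (forall (x : R) i, is_derive x 1 (fun y => psi y i 0) (psi' x i 0)) ->
  (forall (x : R) i, is_derive x 1 (fun y => psi' y i 0) (psi'' x i 0)) ->
  HessV n kappa W omega c V psi x i 0 =
  LEL omega c (V x) (p x) (s x) (psi x) (psi' x) (psi'' x) i.
Proof.
move=> dpsi dpsi'; rewrite /HessV /Hess /lin derive1E.
have line (F F' G G' : R -> 'cV[R]_2) (t y : R) k :
    is_derive y 1 (fun y => F y k 0) (F' y k 0) -> is_derive y 1 (fun y => G y k 0) (G' y k 0) ->
    is_derive y 1 (fun y => (F y + t *: G y) k 0) ((F' y + t *: G' y) k 0).
  move=> h1 h2; have -> : (fun y => (F y + t *: G y) k 0) = (fun y => F y k 0 + t * G y k 0).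
    by apply/funext => z; rewrite !mxE.
  by eapply is_derive_eq; [is_derive_auto|rewrite !mxE /=; ring].
have Hx : (on_axis n x) 0 0 = x by rewrite /on_axis !mxE /= mulr1.
(* A planar state perturbed in a planar direction is again planar, so [vargrad_planar] applies for
   every t. *)
have E t : vargrad (@Hu R n kappa W omega c) (fun z' => planar V z' + t *: planar psi z') (on_axis n x) =
    \col_k EL omega c (V x + t *: psi x) (p x + t *: psi' x) (s x + t *: psi'' x) k.
  apply/colP => k; rewrite mxE.
  have := @vargrad_planar R n kappa W g g1 w w1 kappaE WE dg dw omega c
    (fun y => V y + t *: psi y) (fun y => p y + t *: psi' y) (fun y => s y + t *: psi'' y)
    (fun y k => line _ _ _ _ t y k (dV y k) (dpsi y k))
    (fun y k => line _ _ _ _ t y k (dp y k) (dpsi' y k)) (on_axis n x) k.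
  by rewrite Hx.
pose F t k := EL omega c (V x + t *: psi x) (p x + t *: psi' x) (s x + t *: psi'' x) k.
have -> : (fun t : R => vargrad (@Hu R n kappa W omega c)
    (fun z' => planar V z' + t *: planar psi z') (on_axis n x)) = (fun t => \col_k F t k).
  by apply/funext => t; rewrite E.
have key k : is_derive (0 : R) 1 (F ^~ k)
   (LEL omega c (V x) (p x) (s x) (psi x) (psi' x) (psi'' x) k).
  have dl (A B : 'cV[R]_2) l : is_derive (0 : R) 1 (fun t => (A + t *: B) l 0) (B l 0).
    have -> : (fun t => (A + t *: B) l 0) = (fun t => A l 0 + t * B l 0).
      by apply/funext => t; rewrite !mxE.
    by eapply is_derive_eq; [is_derive_auto|rewrite /=; ring].
  have := @is_derive_EL (fun=> omega) (fun=> c) (fun=> 0) (fun=> 0)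
    (fun t => V x + t *: psi x) (fun t => p x + t *: psi' x) (fun t => s x + t *: psi'' x)
    (fun=> psi x) (fun=> psi' x) (fun=> psi'' x) 0 k (is_deriveFcst _ _) (is_deriveFcst _ _)
    (dl _ _) (dl _ _) (dl _ _).
  by move=> h; apply: is_derive_eq h _; rewrite !scale0r !addr0 !mul0r !subr0.
have colE k l : (fun t => (\col_k F t k) k l) = F ^~ k by apply/funext => t; rewrite mxE.
have dmx : derivable (fun t : R => \col_k F t k : 'cV[R]_2) 0 1.
  by apply/derivable_mxP => k l; rewrite colE; have [] := key k.
by rewrite derive_mx // mxE colE; have [_] := key i.
Qed.

End Linearization.

Lemma addmxE (T : nmodType) m n (M N : 'M[T]_(m, n)) i j : (M + N) i j = M i j + N i j.
Proof. by rewrite mxE. Qed.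

Lemma scalemxE (T : pzRingType) m n (z : T) (M : 'M[T]_(m, n)) i j : (z *: M) i j = z * M i j.
Proof. by rewrite mxE. Qed.

Lemma mx0E (T : nmodType) m n i j : (0 : 'M[T]_(m, n)) i j = 0.
Proof. by rewrite mxE. Qed.

(** * First-order form of the spectral problem *)

Section FirstOrderSystem.
Variables (R : realType) (n : nat) (kappa W g g1 g2 w w1 w2 : R -> R).
Local Notation C := R[i].
Hypothesis kappaE : forall r : R, 0 <= r -> kappa r = g r.
Hypothesis WE : forall r : R, 0 <= r -> W r = w r.
Hypothesis dg : forall r : R, is_derive r 1 g (g1 r).
Hypothesis dg1 : forall r : R, is_derive r 1 g1 (g2 r).
Hypothesis dw : forall r : R, is_derive r 1 w (w1 r).
Hypothesis dw1 : forall r : R, is_derive r 1 w1 (w2 r).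
Hypothesis g_neq0 : forall u : 'cV[R]_2, g (sqnorm u) != 0.
Variables (omega c : R) (V p s : R -> 'cV[R]_2).
Hypothesis dV : forall (x : R) i, is_derive x 1 (fun y => V y i 0) (p x i 0).
Hypothesis dp : forall (x : R) i, is_derive x 1 (fun y => p y i 0) (s x i 0).
Local Notation L0 x := (LEL0 g1 g2 w1 w2 omega c (V x) (p x) (s x)).
Local Notation L x := (LEL g g1 g2 w1 w2 omega c (V x) (p x) (s x)).
Local Notation k x := (g (sqnorm (V x))).

(* The spectral equation for y = (psi, psi_x) reads
   y' = (Amx + lambda Bmx + |eta|^2 Dmx) y. *)
Definition Amx x : 'M[R]_(2 + 2) := block_mx 0 1%:M
  (\matrix_(i, j) (L0 x (delta_mx j 0) 0 i / k x))
  (\matrix_(i, j) (L0 x 0 (delta_mx j 0) i / k x)).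
Definition Bmx x : 'M[R]_(2 + 2) := block_mx 0 0 ((k x)^-1 *: J) 0.
Definition Dmx : 'M[R]_(2 + 2) := block_mx 0 0 1%:M 0.

Lemma mulmx2E m (M : 'M[R]_(m, 2)) (v : 'cV[R]_2) i :
  (M *m v) i 0 = M i 0 * v 0 0 + M i 1 * v 1 0.
Proof.
rewrite !mxE !big_ord_recl big_ord0 addr0.
by have -> : lift ord0 ord0 = 1 :> 'I_2 by apply/val_inj.
Qed.

Lemma Amx_col x (a b : 'cV[R]_2) :
  Amx x *m col_mx a b = col_mx b (\col_i (L0 x a b i / k x)).
Proof.
rewrite mul_block_col mul0mx add0r mul1mx; congr col_mx; apply/colP => i.
rewrite [LHS]mxE !mulmx2E !mxE /LEL0 !dot2E.
by have [-> | ->] := ord2P i; rewrite ?J0E ?J1E !mxE /=; field; exact: g_neq0.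
Qed.

Lemma Bmx_col x (a b : 'cV[R]_2) :
  Bmx x *m col_mx a b = col_mx 0 ((k x)^-1 *: (J *m a)).
Proof. by rewrite mul_block_col !mul0mx !addr0 -scalemxAl. Qed.

Lemma Dmx_col (a b : 'cV[R]_2) : Dmx *m col_mx a b = col_mx 0 a.
Proof. by rewrite mul_block_col !mul0mx !addr0 mul1mx. Qed.

Lemma Re_mxC m q (M : 'M[R]_(m, q)) r (y : 'M[C]_(q, r)) :
  map_mx (@complex.Re R) (mxC M *m y) = M *m map_mx (@complex.Re R) y.
Proof.
apply/matrixP => i j; rewrite !mxE raddf_sum; apply: eq_bigr => l _.
by rewrite !mxE [LHS]/= ReM /= mul0r subr0.
Qed.

Lemma Im_mxC m q (M : 'M[R]_(m, q)) r (y : 'M[C]_(q, r)) :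
  map_mx (@complex.Im R) (mxC M *m y) = M *m map_mx (@complex.Im R) y.
Proof.
apply/matrixP => i j; rewrite !mxE raddf_sum; apply: eq_bigr => l _.
by rewrite !mxE [LHS]/= ImM /= mul0r addr0.
Qed.

Lemma mxC_J0 (v : 'cV[C]_2) : (mxC J *m v) 0 0 = v 1 0.
Proof.
rewrite !mxE !big_ord_recl big_ord0 !mxE /= mul0r mul1r addr0 add0r.
by have -> : lift ord0 ord0 = 1 :> 'I_2 by apply/val_inj.
Qed.

Lemma mxC_J1 (v : 'cV[C]_2) : (mxC J *m v) 1 0 = - v 0 0.
Proof.
rewrite !mxE !big_ord_recl big_ord0 !mxE /= mul0r addr0 addr0.
have -> : ((-1 : R)%:C) = (-1 : C) by rewrite rmorphN1.
by rewrite mulN1r.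
Qed.

Variables (lambda : C) (eta : 'rV[R]_n) (S : R -> 'M[C]_(2 + 2)).
Hypothesis hS : solution_operator kappa W omega c V lambda eta S.
Local Notation h := (sqnorm eta).

(** [so_deriv] says that the lower half of a column is the derivative of the upper half, and [so_eq]
    is then solved for the second derivative, using that J is invertible and that g does not vanish.
    The argument runs on real and imaginary parts, on which the Hessian acts as a real operator. *)
Lemma solution_column (v : 'cV[C]_(2 + 2)) (x : R) :
  mxderiv (fun y => S y *m v) x
    ((mxC (Amx x) + lambda *: mxC (Bmx x) + h%:C *: mxC Dmx) *m (S x *m v)).
Proof.
have [S0 Sd Sder Seq] := hS.
pose y t := S t *m v.
have dS i j t : exists l, cderiv (fun y => S y i j) t l.
  have [d1 d2] := Sd i j t.
  by exists ('D_1 (fun y => complex.Re (S y i j)) t +i*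
    'D_1 (fun y => complex.Im (S y i j)) t); split => /=; exact: derivableP.
have dy i t : exists l, cderiv (fun t => y t i 0) t l.
  have /choice [l hl] : forall j, exists l, cderiv (fun y => S y i j) t l by move=> j; exact: dS.
  exists (\sum_j (l j * v j 0 + S t i j * 0)).
  have := cderiv_sum (index_enum _) (fun j => cderivM (hl j) (cderiv_cst (v j 0) t)).
  by apply: cderiv_ext => z; rewrite /y mxE.
pose re (f : C -> R) (t : R) := map_mx f (usubmx (y t)) : 'cV[R]_2.
pose de (f : C -> R) (t : R) := map_mx f (dsubmx (y t)) : 'cV[R]_2.
(* The second derivative of psi: it exists because the entries of [S], hence those of the lower
   half, are derivable. *)
pose dd (f : C -> R) (t : R) := \col_i 'D_1 (fun t => de f t i 0) t : 'cV[R]_2.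
have reE f i : (fun t => re f t i 0) = (fun t => f (y t (lshift 2 i) 0)).
  by apply/funext => t; rewrite /re !mxE.
have deE f i : (fun t => de f t i 0) = (fun t => f (y t (rshift 2 i) 0)).
  by apply/funext => t; rewrite /de !mxE.
have hre f : f = @complex.Re R \/ f = @complex.Im R ->
   (forall i t, derivable (fun t => re f t i 0) t 1) /\
   (forall (t : R) i, is_derive t 1 (fun t => de f t i 0) (dd f t i 0)).
  move=> hf.
  have dyf i t : derivable (fun t => f (y t i 0)) t 1.
    by have [l [[d1 _] [d2 _]]] := dy i t; case: hf => ->.
  split=> [i t|t i].
    by rewrite reE; exact: dyf.
  by rewrite mxE; apply: derivableP; rewrite deE; exact: dyf.
have hde f : f = @complex.Re R \/ f = @complex.Im R ->
    forall (t : R) i, is_derive t 1 (fun t => re f t i 0) (de f t i 0).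
  move=> hf t i; have [hd _] := hre f hf.
  have hmx : derivable (re f) t 1.
    by apply/derivable_mxP => i' j'; rewrite ord1; exact: hd.
  have -> : de f t i 0 = 'D_1 (fun t => re f t i 0) t; last exact: derivableP.
  have /colP /(_ i) := Sder v t; rewrite mxE -/(y t) => E.
  have := derive_mx hmx => /matrixP /(_ i 0); rewrite -derive1E [RHS]mxE => <-.
  by rewrite /de mxE -E; case: hf => ->.
have [cRe cIm] : ((@complex.Re R = @complex.Re R) \/ (@complex.Re R = @complex.Im R)) /\
  ((@complex.Im R = @complex.Re R) \/ (@complex.Im R = @complex.Im R)) by split; [left|right].
pose E i : C := L x (re (@complex.Re R) x) (de (@complex.Re R) x) (dd (@complex.Re R) x) i +i*
  L x (re (@complex.Im R) x) (de (@complex.Im R) x) (dd (@complex.Im R) x) i.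
have EE i : extC (HessV n kappa W omega c V) (fun y => usubmx (S y *m v)) x i 0 = E i.
  have H f (hf : f = @complex.Re R \/ f = @complex.Im R) :=
    @HessV_planar R n kappa W g g1 g2 w w1 w2 kappaE WE dg dg1 dw dw1 omega c V p s dV dp
      (re f) (de f) (dd f) x i (hde f hf) (hre f hf).2.
  by rewrite mxE /E -(H _ cRe) -(H _ cIm).
pose l0 i : C := L0 x (re (@complex.Re R) x) (de (@complex.Re R) x) i +i*
  L0 x (re (@complex.Im R) x) (de (@complex.Im R) x) i.
pose delta i : C := dd (@complex.Re R) x i 0 +i* dd (@complex.Im R) x i 0.
have kC : (k x)%:C != 0 :> C.
  by apply: contra (g_neq0 (V x)) => /eqP[/eqP].
have El i : E i = l0 i - (k x)%:C * delta i.
  by apply/eqP; rewrite eq_complex /E /l0 /delta /LEL /= !mul0r subr0 addr0 !eqxx.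
have yE : y x = col_mx (usubmx (y x)) (dsubmx (y x)) by rewrite vsubmxK.
have AE : mxC (Amx x) *m y x = col_mx (dsubmx (y x)) (\col_i (l0 i / (k x)%:C)).
  have key f : map_mx f (y x) = col_mx (re f x) (de f x) by rewrite /re /de -map_col_mx vsubmxK.
  apply/colP => i.
  suff [h1 h2] : complex.Re ((mxC (Amx x) *m y x) i 0) =
     complex.Re (col_mx (dsubmx (y x)) (\col_i (l0 i / (k x)%:C)) i 0) /\
     complex.Im ((mxC (Amx x) *m y x) i 0) =
     complex.Im (col_mx (dsubmx (y x)) (\col_i (l0 i / (k x)%:C)) i 0).
    by apply/eqP; rewrite eq_complex h1 h2 !eqxx.
  have hr := congr1 (fun M : 'cV__ => M i 0) (Re_mxC (Amx x) (y x)).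
  have hi := congr1 (fun M : 'cV__ => M i 0) (Im_mxC (Amx x) (y x)).
  rewrite key Amx_col mxE in hr; rewrite key Amx_col mxE in hi.
  rewrite hr hi -fmorphV; case: (split_ordP i) => i' ->.
    by rewrite !col_mxEu /de ![map_mx _ _ _ _]mxE.
  rewrite !col_mxEd ![(\col__ _) _ _]mxE ReM ImM /=.
  by rewrite !mulr0 subr0 add0r.
have BE : mxC (Bmx x) *m y x = col_mx 0 ((k x)^-1%:C *: (mxC J *m usubmx (y x))).
  rewrite {1}yE /mxC (@map_block_mx _ _ _ 2 2 2 2) mul_block_col !map_mx0 !mul0mx !addr0.
  by rewrite map_mxZ -scalemxAl.
have DE : mxC Dmx *m y x = col_mx 0 (usubmx (y x)).
  rewrite {1}yE /mxC (@map_block_mx _ _ _ 2 2 2 2) mul_block_col !map_mx0 !mul0mx !addr0.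
  by rewrite map_mx1 mul1mx.
have yd i : cderiv (fun t => y t (rshift 2 i) 0) x (delta i).
  by split; rewrite /= -deE; [exact: (hre _ cRe).2 | exact: (hre _ cIm).2].
have yu i : cderiv (fun t => y t (lshift 2 i) 0) x (dsubmx (y x) i 0).
  by split; rewrite -reE; [have := hde _ cRe x i | have := hde _ cIm x i];
    rewrite /de [map_mx _ _ _ _]mxE.
move=> i j; rewrite ord1 -/(y x) !mulmxDl -!scalemxAl AE BE DE.
rewrite !addmxE !scalemxE.
case: (split_ordP i) => i' ->.
  by rewrite !col_mxEu mx0E !mulr0 !addr0; exact: yu.
rewrite !col_mxEd.
suff <- : delta i' = (\col_i (l0 i / (k x)%:C)) i' 0
    + lambda * ((k x)^-1%:C *: (mxC J *m usubmx (y x))) i' 0 + h%:C * usubmx (y x) i' 0.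
  exact: yd.
have /colP sp := Seq v x.
have := (sp 0, sp 1); rewrite !addmxE !scalemxE mxC_J0 mxC_J1 !EE.
rewrite mxC_J0 mxC_J1 -/(y x) !El kappaE ?sqnorm_ge0 // => -[e0 e1].
rewrite ![(\col__ _) _ _]mxE ?scalemxE fmorphV.
apply: (mulfI kC).
rewrite rmorphM in e0 e1.
have -> : (k x)%:C * (l0 i' / (k x)%:C + lambda * ((k x)%:C^-1 * (mxC J *m usubmx (y x)) i' 0)
    + h%:C * usubmx (y x) i' 0) =
  l0 i' + lambda * (mxC J *m usubmx (y x)) i' 0 + h%:C * (k x)%:C * usubmx (y x) i' 0.
  by field.
(* J exchanges the two components, so component i' of the second derivative is found in the other
   scalar equation. *)
move: e0 e1; have [-> | ->] := ord2P i'; rewrite ?mxC_J0 ?mxC_J1.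
  move=> _ e1; apply/eqP; rewrite -subr_eq0 -[X in _ == X](subrr (lambda * usubmx (y x) 1 0)).
  by rewrite -{1}e1; apply/eqP; ring.
move=> e0 _; apply/eqP; rewrite -subr_eq0 -[X in _ == X](subrr (lambda * usubmx (y x) 0 0)).
by rewrite -{2}e0; apply/eqP; ring.
Qed.

Lemma solution_mxderiv (x : R) :
  mxderiv S x ((mxC (Amx x) + lambda *: mxC (Bmx x) + h%:C *: mxC Dmx) *m S x).
Proof.
move=> i j; have := solution_column (delta_mx j 0) x i 0.
have E (M : 'M[C]_(2 + 2)) l : (M *m (delta_mx j 0 : 'cV_(2 + 2))) l 0 = M l j.
  by rewrite -colE mxE.
by rewrite mulmxA E; apply: cderiv_ext => z; rewrite E.
Qed.

End FirstOrderSystem.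

(** * Derivatives of a family of profiles *)

Section WaveFamily.
Variables (R : realType) (n : nat) (kappa W g g1 g2 w w1 w2 : R -> R).
Hypothesis kappaE : forall r : R, 0 <= r -> kappa r = g r.
Hypothesis WE : forall r : R, 0 <= r -> W r = w r.
Hypothesis dg : forall r : R, is_derive r 1 g (g1 r).
Hypothesis dg1 : forall r : R, is_derive r 1 g1 (g2 r).
Hypothesis dw : forall r : R, is_derive r 1 w (w1 r).
Hypothesis dw1 : forall r : R, is_derive r 1 w1 (w2 r).
Variables (P : set 'rV[R]_4) (Vf : 'rV[R]_4 -> R -> 'cV[R]_2) (Xf xif : 'rV[R]_4 -> R).
Hypothesis hfam : wave_family n kappa W P Vf Xf xif.
Variable a0 : 'rV[R]_4.
Hypothesis Pa0 : P a0.

Let f i (z : 'rV[R]_4 * R) : R := Vf z.1 z.2 i 0.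
Let D : set ('rV[R]_4 * R) := P `*` setT.
Let ex : 'rV[R]_4 * R := (0, 1).
Let e (j : 'I_4) : 'rV[R]_4 := delta_mx 0 j.
Let ej j : 'rV[R]_4 * R := (e j, 0).

Let oD : open D. Proof.
move=> [a x] [/= Pa _]; exists (P, setT); last by [].
by split; [exact: open_nbhs_nbhs (conj (wf_open hfam) Pa)|exact: filterT].
Qed.

Let sf i : smooth_in D (f i).
Proof. by apply: (@smooth_coord R _ _ _ D _ i 0 oD); exact: wf_V_smooth hfam. Qed.

Definition fam_x a x : 'cV[R]_2 := \col_i 'D_ex (f i) (a, x).
Definition fam_xx a x : 'cV[R]_2 := \col_i 'D_ex ('D_ex (f i)) (a, x).
Definition fam_xxx a x : 'cV[R]_2 := \col_i 'D_ex ('D_ex ('D_ex (f i))) (a, x).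
Definition var j x : 'cV[R]_2 := \col_i 'D_(ej j) (f i) (a0, x).
Definition var_x j x : 'cV[R]_2 := \col_i 'D_ex ('D_(ej j) (f i)) (a0, x).
Definition var_xx j x : 'cV[R]_2 := \col_i 'D_ex ('D_ex ('D_(ej j) (f i))) (a0, x).

Let DP a x : P a -> D (a, x). Proof. by []. Qed.

Let dx (h : 'rV[R]_4 * R -> R) a (x : R) : smooth_in D h -> P a ->
  is_derive x 1 (fun y => h (a, y)) ('D_ex h (a, x)).
Proof.
move=> sh Pa; have := smooth_is_derive ex sh (DP x Pa) => /is_derive_lineP hd.
apply/is_derive_lineP.
have -> : (fun s : R => h (a, s *: 1 + x)) = (fun s : R => h (s *: ex + (a, x))).
  by apply/funext => s; congr (h (_, _)); rewrite /= scaler0 add0r.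
exact: hd.
Qed.

Let da (h : 'rV[R]_4 * R -> R) j x : smooth_in D h ->
  is_derive (0 : R) 1 (fun t : R => h (t *: e j + a0, x)) ('D_(ej j) h (a0, x)).
Proof.
move=> sh; have := smooth_is_derive (ej j) sh (DP x Pa0) => /is_derive_lineP hd.
have -> : (fun t : R => h (t *: e j + a0, x)) = (fun t : R => h (t *: ej j + (a0, x))).
  by apply/funext => s; congr (h (_, _)); rewrite /= scaler0 add0r.
exact: hd.
Qed.

Lemma fam_dx a (x : R) i : P a -> is_derive x 1 (fun y => Vf a y i 0) (fam_x a x i 0).
Proof. by move=> Pa; rewrite [fam_x _ _ _ _]mxE; exact: (dx x (sf i) Pa). Qed.

Lemma fam_dxx a (x : R) i : P a -> is_derive x 1 (fun y => fam_x a y i 0) (fam_xx a x i 0).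
Proof.
move=> Pa; have -> : (fun y => fam_x a y i 0) = (fun y => 'D_ex (f i) (a, y)).
  by apply/funext => y; rewrite mxE.
by apply: is_derive_eq (dx x (smooth_derive ex (sf i)) Pa) _; rewrite mxE.
Qed.

Lemma fam_dxxx a (x : R) i : P a -> is_derive x 1 (fun y => fam_xx a y i 0) (fam_xxx a x i 0).
Proof.
move=> Pa; have -> : (fun y => fam_xx a y i 0) = (fun y => 'D_ex ('D_ex (f i)) (a, y)).
  by apply/funext => y; rewrite mxE.
by apply: is_derive_eq (dx x (smooth_derive ex (smooth_derive ex (sf i))) Pa) _; rewrite mxE.
Qed.

Lemma var_dx j (x : R) i : is_derive x 1 (fun y => var j y i 0) (var_x j x i 0).
Proof.
have -> : (fun y => var j y i 0) = (fun y => 'D_(ej j) (f i) (a0, y)).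
  by apply/funext => y; rewrite mxE.
by apply: is_derive_eq (dx x (smooth_derive (ej j) (sf i)) Pa0) _; rewrite mxE.
Qed.

Lemma var_dxx j (x : R) i : is_derive x 1 (fun y => var_x j y i 0) (var_xx j x i 0).
Proof.
have -> : (fun y => var_x j y i 0) = (fun y => 'D_ex ('D_(ej j) (f i)) (a0, y)).
  by apply/funext => y; rewrite mxE.
by apply: is_derive_eq (dx x (smooth_derive ex (smooth_derive (ej j) (sf i))) Pa0) _; rewrite mxE.
Qed.

Lemma fam_da j (x : R) i :
  is_derive (0 : R) 1 (fun t : R => Vf (t *: e j + a0) x i 0) (var j x i 0).
Proof. by rewrite [var j x i 0]mxE; exact: (da j x (sf i)). Qed.

Lemma fam_x_da j (x : R) i :
  is_derive (0 : R) 1 (fun t : R => fam_x (t *: e j + a0) x i 0) (var_x j x i 0).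
Proof.
have -> : (fun t : R => fam_x (t *: e j + a0) x i 0) =
  (fun t : R => 'D_ex (f i) (t *: e j + a0, x)) by apply/funext => y; rewrite mxE.
apply: is_derive_eq (da j x (smooth_derive ex (sf i))) _; rewrite mxE.
exact: (@smooth_mixed R _ D (f i) ex (ej j) (a0, x) oD (sf i) (DP x Pa0)).
Qed.

Lemma fam_xx_da j (x : R) i :
  is_derive (0 : R) 1 (fun t : R => fam_xx (t *: e j + a0) x i 0) (var_xx j x i 0).
Proof.
have -> : (fun t : R => fam_xx (t *: e j + a0) x i 0) =
  (fun t : R => 'D_ex ('D_ex (f i)) (t *: e j + a0, x)) by apply/funext => y; rewrite mxE.
apply: is_derive_eq (da j x (smooth_derive ex (smooth_derive ex (sf i)))) _; rewrite mxE.
apply: etrans (@smooth_mixed R _ D ('D_ex (f i)) ex (ej j) (a0, x) oD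
  (smooth_derive ex (sf i)) (DP x Pa0)) _.
(* Differentiating once more the first exchange of derivatives requires it on a whole neighbourhood,
   which the openness of [D] provides. *)
apply: near_eq_derive; apply: filterS (open_nbhs_nbhs (conj oD (DP x Pa0))) => z Dz.
exact: (@smooth_mixed R _ D (f i) ex (ej j) z oD (sf i) Dz).
Qed.

Lemma fam_derive1 a (x : R) : P a -> derive1 (Vf a) x = fam_x a x.
Proof.
move=> Pa; have d : derivable (Vf a) x 1.
  by apply/derivable_mxP => i j; rewrite ord1; have [] := fam_dx x i Pa.
rewrite derive1E derive_mx //; apply/colP => i; rewrite [LHS]mxE.
by have [_] := fam_dx x i Pa.
Qed.

Lemma var_derive j x : 'D_(e j) (Vf ^~ x) a0 = var j x.
Proof.
have d i : is_derive a0 (e j) (fun a => Vf a x i 0) (var j x i 0).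
  by apply/is_derive_lineP; exact: fam_da.
have dm : derivable (Vf ^~ x) a0 (e j).
  by apply/derivable_mxP => i k; rewrite ord1; have [] := d i.
by rewrite derive_mx //; apply/colP => i; rewrite [LHS]mxE; have [_] := d i.
Qed.

Lemma near_P j : \forall t \near (0 : R), P (t *: e j + a0).
Proof.
have [s s0 hs] := nbhs_plane (e j) (0 : 'rV[R]_4) (open_nbhs_nbhs (conj (wf_open hfam) Pa0)).
apply/nbhs_ballP; exists s => //= t; rewrite -ball_normE /= sub0r normrN => ht.
have := hs t 0 (ltW ht); rewrite normr0 => /(_ (ltW s0)).
by rewrite scaler0 add0r.
Qed.

Lemma fam_EL a x i : P a ->
  EL g g1 w1 (a 0 0) (a 0 1) (Vf a x) (fam_x a x) (fam_xx a x) i = 0.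
Proof.
move=> Pa; have := wp_eq (mp_wave (wf_profile hfam Pa)) (on_axis n x).
move/colP/(_ i).
rewrite (@vargrad_planar R n kappa W g g1 w w1 kappaE WE dg dw (a 0 0) (a 0 1) (Vf a)
  (fam_x a) (fam_xx a) (fun y k => fam_dx y k Pa) (fun y k => fam_dxx y k Pa)).
have -> : on_axis n x 0 0 = x by rewrite /on_axis !mxE /= mulr1.
by move=> ->; rewrite mxE.
Qed.

Let param j k : is_derive (0 : R) 1 (fun t : R => (t *: e j + a0) 0 k) (j == k)%:R.
Proof.
have -> : (fun t : R => (t *: e j + a0) 0 k) = (fun t : R => t * (j == k)%:R + a0 0 k).
  by apply/funext => t; rewrite !mxE eqxx eq_sym.
by eapply is_derive_eq; [is_derive_auto|rewrite /=; ring].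
Qed.

Let at0 j : 0 *: e j + a0 = a0. Proof. by rewrite scale0r add0r. Qed.

(** Differentiating the profile equation in the parameter a_j: the right-hand side comes from the
    explicit dependence on omega_phi and c_x, and vanishes for j = 2, 3. *)
Lemma var_LEL j x i :
  LEL g g1 g2 w1 w2 (a0 0 0) (a0 0 1) (Vf a0 x) (fam_x a0 x) (fam_xx a0 x)
    (var j x) (var_x j x) (var_xx j x) i =
  (j == 0)%:R * Vf a0 x i 0 + (j == 1)%:R * (J *m fam_x a0 x) i 0.
Proof.
have := @is_derive_EL R g g1 g2 w1 w2 dg dg1 dw1
  (fun t => (t *: e j + a0) 0 0) (fun t => (t *: e j + a0) 0 1)
  (fun=> (j == 0)%:R) (fun=> (j == 1)%:R)
  (fun t => Vf (t *: e j + a0) x) (fun t => fam_x (t *: e j + a0) x)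
  (fun t => fam_xx (t *: e j + a0) x)
  (fun=> var j x) (fun=> var_x j x) (fun=> var_xx j x) 0 i
  (param j 0) (param j 1) (fam_da j x) (fam_x_da j x) (fam_xx_da j x).
rewrite at0 => H.
have H0 : is_derive (0 : R) 1 (fun=> 0 : R)
  (LEL g g1 g2 w1 w2 (a0 0 0) (a0 0 1) (Vf a0 x) (fam_x a0 x) (fam_xx a0 x)
    (var j x) (var_x j x) (var_xx j x) i - (j == 0)%:R * Vf a0 x i 0 -
   (j == 1)%:R * (J *m fam_x a0 x) i 0).
  (* The profile equation holds on the line of parameters only inside [P], that is for t near 0. *)
  apply: near_eq_is_derive H; apply: filterS (near_P j) => t; exact: fam_EL.
have := @derive_val _ _ _ _ _ _ _ H0; rewrite derive_cst => /eqP.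
by rewrite eq_sym -addrA -opprD subr_eq0 => /eqP.
Qed.

Definition mu_phi_lin (c : R) (u p a b : 'cV[R]_2) : R :=
  2 * g1 (sqnorm u) * dot u a * dot (J *m u) p
  + g (sqnorm u) * (dot (J *m a) p + dot (J *m u) b) + c * dot u a.

Definition mu_x_lin (omega : R) (u p a b : 'cV[R]_2) : R :=
  g1 (sqnorm u) * dot u a * sqnorm p + g (sqnorm u) * dot p b
  - 2 * w1 (sqnorm u) * dot u a + omega * dot u a.

Lemma is_derive_mu_phi (c c' : R -> R) (u p u' p' : R -> 'cV[R]_2) (x : R) :
  is_derive x 1 c (c' x) ->
  (forall i, is_derive x 1 (fun y => u y i 0) (u' x i 0)) ->
  (forall i, is_derive x 1 (fun y => p y i 0) (p' x i 0)) ->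
  is_derive x 1 (fun y => g (sqnorm (u y)) * dot (J *m u y) (p y) + c y / 2 * sqnorm (u y))
    (mu_phi_lin (c x) (u x) (p x) (u' x) (p' x) + c' x / 2 * sqnorm (u x)).
Proof.
move=> dc du dp; have duu := is_derive_dot_curve du du.
have dJu i : is_derive x 1 (fun y => (J *m u y) i 0) ((J *m u' x) i 0).
  exact: is_derive_J_curve.
have dJp := @is_derive_dot_curve R (fun y => J *m u y) p (fun y => J *m u' y) p' x dJu dp; have q0 := is_derive_fcomp (dg _) duu.
have -> : (fun y => g (sqnorm (u y)) * dot (J *m u y) (p y) + c y / 2 * sqnorm (u y)) =
  (fun y => g (dot (u y) (u y)) * dot (J *m u y) (p y) + c y * 2^-1 * dot (u y) (u y)).
  by apply/funext => y; rewrite !sqnorm_dot.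
eapply is_derive_eq; first by is_derive_auto.
rewrite /mu_phi_lin !sqnorm_dot (dot2E (u' x)) (dot2E (u x) (u' x)) /=.
by field.
Qed.

Lemma is_derive_mu_x (omega omega' : R -> R) (u p u' p' : R -> 'cV[R]_2) (x : R) :
  is_derive x 1 omega (omega' x) ->
  (forall i, is_derive x 1 (fun y => u y i 0) (u' x i 0)) ->
  (forall i, is_derive x 1 (fun y => p y i 0) (p' x i 0)) ->
  is_derive x 1 (fun y => 2^-1 * g (sqnorm (u y)) * sqnorm (p y) - w (sqnorm (u y))
      + omega y / 2 * sqnorm (u y))
    (mu_x_lin (omega x) (u x) (p x) (u' x) (p' x) + omega' x / 2 * sqnorm (u x)).
Proof.
move=> dc du dp; have duu := is_derive_dot_curve du du.
have dpp := is_derive_dot_curve dp dp; have q0 := is_derive_fcomp (dg _) duu.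
have q1 := is_derive_fcomp (dw _) duu.
have -> : (fun y => 2^-1 * g (sqnorm (u y)) * sqnorm (p y) - w (sqnorm (u y))
      + omega y / 2 * sqnorm (u y)) =
  (fun y => 2^-1 * g (dot (u y) (u y)) * dot (p y) (p y) - w (dot (u y) (u y))
      + omega y * 2^-1 * dot (u y) (u y)).
  by apply/funext => y; rewrite !sqnorm_dot.
eapply is_derive_eq; first by is_derive_auto.
rewrite /mu_x_lin !sqnorm_dot (dot2E (u' x)) (dot2E (u x) (u' x)) (dot2E (p' x)) (dot2E (p x) (p' x)) /=.
by field.
Qed.

(** Differentiating the identity [wf_mu_phi] in a_j; the explicit c_x in mu_phi accounts for the
    term in half the squared modulus. *)
Lemma var_mu_phi j x :
  mu_phi_lin (a0 0 1) (Vf a0 x) (fam_x a0 x) (var j x) (var_x j x) =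
  (j == 2)%:R - (j == 1)%:R / 2 * sqnorm (Vf a0 x).
Proof.
have := @is_derive_mu_phi (fun t => (t *: e j + a0) 0 1) (fun=> (j == 1)%:R)
  (fun t => Vf (t *: e j + a0) x) (fun t => fam_x (t *: e j + a0) x)
  (fun=> var j x) (fun=> var_x j x) 0 (param j 1) (fam_da j x) (fam_x_da j x).
rewrite at0 => H.
have H' : is_derive (0 : R) 1 (fun t : R => (t *: e j + a0) 0 2) (mu_phi_lin (a0 0 1) (Vf a0 x) (fam_x a0 x) (var j x) (var_x j x)
      + (j == 1)%:R / 2 * sqnorm (Vf a0 x)).
  apply: near_eq_is_derive H; apply: filterS (near_P j) => t Pt.
  rewrite -(wf_mu_phi hfam Pt x) /mu_phi.
  by rewrite kappaE ?WE ?sqnorm_ge0 // fam_derive1.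
have := @derive_val _ _ _ _ _ _ _ H'; rewrite (@derive_val _ _ _ _ _ _ _ (param j 2)).
by move=> ->; rewrite addrK.
Qed.

Lemma var_mu_x j x :
  mu_x_lin (a0 0 0) (Vf a0 x) (fam_x a0 x) (var j x) (var_x j x) =
  (j == 3)%:R - (j == 0)%:R / 2 * sqnorm (Vf a0 x).
Proof.
have := @is_derive_mu_x (fun t => (t *: e j + a0) 0 0) (fun=> (j == 0)%:R)
  (fun t => Vf (t *: e j + a0) x) (fun t => fam_x (t *: e j + a0) x)
  (fun=> var j x) (fun=> var_x j x) 0 (param j 0) (fam_da j x) (fam_x_da j x).
rewrite at0 => H.
have H' : is_derive (0 : R) 1 (fun t : R => (t *: e j + a0) 0 3) (mu_x_lin (a0 0 0) (Vf a0 x) (fam_x a0 x) (var j x) (var_x j x)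
      + (j == 0)%:R / 2 * sqnorm (Vf a0 x)).
  apply: near_eq_is_derive H; apply: filterS (near_P j) => t Pt.
  rewrite -(wf_mu_x hfam Pt x) /mu_x.
  by rewrite kappaE ?WE ?sqnorm_ge0 // fam_derive1.
have := @derive_val _ _ _ _ _ _ _ H'; rewrite (@derive_val _ _ _ _ _ _ _ (param j 3)).
by move=> ->; rewrite addrK.
Qed.

Lemma expJ_0E (theta : R) (v : 'cV[R]_2) :
  (expJ theta *m v) 0 0 = cos theta * v 0 0 + sin theta * v 1 0.
Proof. by rewrite mulmxDl mul_scalar_mx -scalemxAl addmxE !scalemxE J0E. Qed.

Lemma expJ_1E (theta : R) (v : 'cV[R]_2) :
  (expJ theta *m v) 1 0 = cos theta * v 1 0 - sin theta * v 0 0.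
Proof. by rewrite mulmxDl mul_scalar_mx -scalemxAl addmxE !scalemxE J1E mulrN. Qed.

Lemma is_derive_expJ (theta theta' : R -> R) (v v' : R -> 'cV[R]_2) (x : R) i :
  is_derive x 1 theta (theta' x) ->
  (forall i, is_derive x 1 (fun y => v y i 0) (v' x i 0)) ->
  is_derive x 1 (fun y => (expJ (theta y) *m v y) i 0)
    ((expJ (theta x) *m v' x) i 0 + theta' x * (J *m (expJ (theta x) *m v x)) i 0).
Proof.
move=> dt dv; have dv0 := dv 0; have dv1 := dv 1.
have dc := is_derive_fcomp (is_derive_cos (theta x)) dt.
have ds := is_derive_fcomp (is_derive_sin (theta x)) dt.
have [-> | ->] := ord2P i.
  have -> : (fun y => (expJ (theta y) *m v y) 0 0) =
    (fun y => cos (theta y) * v y 0 0 + sin (theta y) * v y 1 0).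
    by apply/funext => y; rewrite expJ_0E.
  by eapply is_derive_eq; [is_derive_auto|rewrite J0E expJ_0E expJ_1E /=; ring].
have -> : (fun y => (expJ (theta y) *m v y) 1 0) =
  (fun y => cos (theta y) * v y 1 0 - sin (theta y) * v y 0 0).
  by apply/funext => y; rewrite expJ_1E.
by eapply is_derive_eq; [is_derive_auto|rewrite J1E expJ_0E expJ_1E /=; ring].
Qed.

Lemma fam_x_shift a x : P a -> fam_x a (x + Xf a) = expJ (xif a) *m fam_x a x.
Proof.
move=> Pa; apply/colP => i.
have d1 : is_derive x 1 (fun y => Vf a (y + Xf a) i 0) (fam_x a (x + Xf a) i 0).
  have dl : is_derive x 1 (fun y => y + Xf a) 1.
    by eapply is_derive_eq; [is_derive_auto|rewrite addr0].
  have := @is_derive_fcomp R (fun y => y + Xf a) (fun y => Vf a y i 0) x _ _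
    (fam_dx (x + Xf a) i Pa) dl.
  by rewrite mulr1.
have d2 := @is_derive_expJ (fun=> xif a) (fun=> 0) (Vf a) (fam_x a) x i (is_deriveFcst _ _)
  (fun i => fam_dx x i Pa).
rewrite mul0r addr0 in d2.
have E : (fun y => Vf a (y + Xf a) i 0) = (fun y => (expJ (xif a) *m Vf a y) i 0).
  by apply/funext => y; rewrite (wp_shift (mp_wave (wf_profile hfam Pa))).
by rewrite -(@derive_val _ _ _ _ _ _ _ d1) E (@derive_val _ _ _ _ _ _ _ d2).
Qed.

Lemma fam_xx_shift a x : P a -> fam_xx a (x + Xf a) = expJ (xif a) *m fam_xx a x.
Proof.
move=> Pa; apply/colP => i.
have d1 : is_derive x 1 (fun y => fam_x a (y + Xf a) i 0) (fam_xx a (x + Xf a) i 0).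
  have dl : is_derive x 1 (fun y => y + Xf a) 1.
    by eapply is_derive_eq; [is_derive_auto|rewrite addr0].
  have := @is_derive_fcomp R (fun y => y + Xf a) (fun y => fam_x a y i 0) x _ _
    (fam_dxx (x + Xf a) i Pa) dl.
  by rewrite mulr1.
have d2 := @is_derive_expJ (fun=> xif a) (fun=> 0) (fam_x a) (fam_xx a) x i (is_deriveFcst _ _)
  (fun i => fam_dxx x i Pa).
rewrite mul0r addr0 in d2.
have E : (fun y => fam_x a (y + Xf a) i 0) = (fun y => (expJ (xif a) *m fam_x a y) i 0).
  by apply/funext => y; rewrite fam_x_shift.
by rewrite -(@derive_val _ _ _ _ _ _ _ d1) E (@derive_val _ _ _ _ _ _ _ d2).
Qed.

(** Total derivative of h(a, X(a)): the parameter moves both the profile and the endpoint. *)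
Let curve_derive (h : 'rV[R]_4 * R -> R) j : smooth_in D h ->
  is_derive (0 : R) 1 (fun t : R => h (t *: e j + a0, Xf (t *: e j + a0)))
    ('D_(ej j) h (a0, Xf a0) + 'D_ex h (a0, Xf a0) * 'D_(e j) Xf a0).
Proof.
move=> sh; pose phi (t x : R) := h (t *: e j + a0, x).
pose psi (t x : R) := 'D_ex h (t *: e j + a0, x).
pose Xt (t : R) := Xf (t *: e j + a0).
have X0 : Xt 0 = Xf a0 by rewrite /Xt at0.
have dX : is_derive (0 : R) 1 Xt ('D_(e j) Xf a0).
  by have /is_derive_lineP hd := smooth_is_derive (e j) (wf_X_smooth hfam) Pa0; exact: hd.
have psi0 : psi 0 (Xf a0) = 'D_ex h (a0, Xf a0) by rewrite /psi at0.
have H := @is_derive_along_curve R phi psi Xt ('D_(ej j) h (a0, Xf a0)) ('D_(e j) Xf a0).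
rewrite X0 psi0 in H; apply: H => //.
- exists ((fun t => P (t *: e j + a0)), setT) => /=.
    by split; [exact: near_P|exact: filterT].
  by move=> [t x] [/= Pt _]; exact: (dx x sh Pt).
- have := @continuous_comp _ _ _ (fun p : R * R => (p.1 *: e j + a0, p.2)) ('D_ex h) (0, Xf a0).
  apply.
    have c1 : (fun p : R * R => p.1 *: e j + a0) p @[p --> (0 : R, Xf a0)] --> 0 *: e j + a0.
      by apply: cvgD; [apply: cvgZr_tmp; exact: cvg_fst|exact: cvg_cst].
    have c2 : (fun p : R * R => p.2) p @[p --> (0 : R, Xf a0)] --> Xf a0 by exact: cvg_snd.
    exact: (cvg_pair c1 c2).
  by rewrite /= at0; exact: (smooth_continuous (smooth_derive ex sh) (DP (Xf a0) Pa0)).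
- exact: (da j (Xf a0) sh).
Qed.

(** Obtained by differentiating V_a(X_a) = exp(xi_a J) V_a(0) in a_j. *)
Lemma var_shift j : var j (Xf a0) + 'D_(e j) Xf a0 *: fam_x a0 (Xf a0) =
  expJ (xif a0) *m var j 0 + 'D_(e j) xif a0 *: (J *m (expJ (xif a0) *m Vf a0 0)).
Proof.
apply/colP => i; rewrite !addmxE !scalemxE.
have d1 := curve_derive j (sf i).
have dxi : is_derive (0 : R) 1 (fun t : R => xif (t *: e j + a0)) ('D_(e j) xif a0).
  by have /is_derive_lineP hd := smooth_is_derive (e j) (wf_xi_smooth hfam) Pa0; exact: hd.
have := @is_derive_expJ (fun t => xif (t *: e j + a0)) (fun=> 'D_(e j) xif a0)
  (fun t => Vf (t *: e j + a0) 0) (fun=> var j 0) 0 i dxi (fam_da j 0).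
rewrite at0 => d2.
have d3 : is_derive (0 : R) 1 (fun t => (expJ (xif (t *: e j + a0)) *m Vf (t *: e j + a0) 0) i 0)
   ('D_(ej j) (f i) (a0, Xf a0) + 'D_ex (f i) (a0, Xf a0) * 'D_(e j) Xf a0).
  apply: near_eq_is_derive d1; apply: filterS (near_P j) => t Pt.
  by rewrite -(wp_shift (mp_wave (wf_profile hfam Pt)) 0) add0r.
rewrite -(@derive_val _ _ _ _ _ _ _ d2) (@derive_val _ _ _ _ _ _ _ d3).
have E1 : var j (Xf a0) i 0 = 'D_(ej j) (f i) (a0, Xf a0) by rewrite mxE.
have E2 : fam_x a0 (Xf a0) i 0 = 'D_ex (f i) (a0, Xf a0) by exact: mxE.
exact: (f_equal2 (fun u v : R => u + v) E1
  (etrans (mulrC _ _) (congr1 (fun u : R => u * 'D_(e j) Xf a0) E2))).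
Qed.

Lemma var_x_shift j : var_x j (Xf a0) + 'D_(e j) Xf a0 *: fam_xx a0 (Xf a0) =
  expJ (xif a0) *m var_x j 0 + 'D_(e j) xif a0 *: (J *m (expJ (xif a0) *m fam_x a0 0)).
Proof.
apply/colP => i; rewrite !addmxE !scalemxE.
have d1 := curve_derive j (smooth_derive ex (sf i)).
have dxi : is_derive (0 : R) 1 (fun t : R => xif (t *: e j + a0)) ('D_(e j) xif a0).
  by have /is_derive_lineP hd := smooth_is_derive (e j) (wf_xi_smooth hfam) Pa0; exact: hd.
have := @is_derive_expJ (fun t => xif (t *: e j + a0)) (fun=> 'D_(e j) xif a0)
  (fun t => fam_x (t *: e j + a0) 0) (fun=> var_x j 0) 0 i dxi (fam_x_da j 0).
rewrite at0 => d2.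
have d3 : is_derive (0 : R) 1 (fun t => (expJ (xif (t *: e j + a0)) *m fam_x (t *: e j + a0) 0) i 0)
   ('D_(ej j) ('D_ex (f i)) (a0, Xf a0) + 'D_ex ('D_ex (f i)) (a0, Xf a0) * 'D_(e j) Xf a0).
  apply: near_eq_is_derive d1; apply: filterS (near_P j) => t Pt.
  by rewrite -(fam_x_shift 0 Pt) add0r mxE.
rewrite -(@derive_val _ _ _ _ _ _ _ d2) (@derive_val _ _ _ _ _ _ _ d3).
have E1 : var_x j (Xf a0) i 0 = 'D_(ej j) ('D_ex (f i)) (a0, Xf a0).
  apply: etrans (esym (@smooth_mixed R _ D (f i) ex (ej j) (a0, Xf a0) oD (sf i)
    (DP (Xf a0) Pa0))).
  by rewrite mxE.
have E2 : fam_xx a0 (Xf a0) i 0 = 'D_ex ('D_ex (f i)) (a0, Xf a0) by exact: mxE.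
exact: (f_equal2 (fun u v : R => u + v) E1
  (etrans (mulrC _ _) (congr1 (fun u : R => u * 'D_(e j) Xf a0) E2))).
Qed.

End WaveFamily.

(** * Antiderivatives, bounds on segments, and uniqueness for linear systems *)

Section Antiderivatives.
Variable R : realType.

Lemma antiderivative (f : R -> R) (X : R) : 0 < X -> continuous f ->
  exists F : R -> R, (forall x, 0 <= x <= X -> is_derive x 1 F (f x)) /\
    \int[lebesgue_measure]_(x in `[0, X]) f x = F X - F 0.
Proof.
move=> X0 cf.
have [F hF] : exists F : R -> R, forall x, 0 <= x <= X -> derivable F x 1 /\ derive1 F x = f x.
  (* Integrating from -1, inside a segment ending at X + 1, makes the primitive two-sidedly
     derivable at 0 and X as well. *)
  eexists => x /andP[x0 xX]; apply: (@continuous_FTC1_closed R f (-1) x (X + 1)).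
  - by rewrite (le_lt_trans xX) // ltrDl.
  - apply: continuous_compact_integrable; first exact: segment_compact.
    exact: continuous_subspaceT.
  - by rewrite (lt_le_trans _ x0) // ltrN10.
  - exact: cf.
have dF x : 0 <= x <= X -> is_derive x 1 F (f x).
  by move=> /hF[d1 d2]; split=> //; rewrite -derive1E.
exists F; split=> //.
have cF x : 0 <= x <= X -> {for x, continuous F} by move=> /dF /is_derive_continuous.
rewrite /Rintegral (@continuous_FTC2 R f F 0 X X0) //.
- exact: continuous_subspaceT.
- split.
  + by move=> x; rewrite in_itv /= => /andP[x0 xX]; have [] // := dF x; rewrite !ltW.
  + by apply: cvg_at_right_filter; apply: cF; rewrite lexx ltW.
  + by apply: cvg_at_left_filter; apply: cF; rewrite lexx ltW.
- move=> x; rewrite in_itv /= => /andP[x0 xX].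
  have xx : 0 <= x <= X by rewrite !ltW.
  by have [_ <-] := hF x xx.
Qed.

Lemma continuous_bounded (f : R -> R) (a b : R) : a <= b -> continuous f ->
  exists2 K, 0 <= K & forall x, a <= x <= b -> `|f x| <= K.
Proof.
move=> ab cf; have cf' : {within `[a, b], continuous (fun x => `|f x|)}.
  apply: continuous_subspaceT => x; apply: continuous_comp; first exact: cf.
  exact: norm_continuous.
have [c _ hc] := EVT_max ab cf'.
by exists `|f c| => // x hx; apply: hc; rewrite in_itv.
Qed.

Definition differentiable_everywhere (f : R -> R) := forall x : R, exists l, is_derive x 1 f l.

Lemma differentiable_everywhere_continuous (f : R -> R) :
  differentiable_everywhere f -> continuous f.
Proof. by move=> df x; have [l] := df x; exact: is_derive_continuous. Qed.

Lemma mxC_bounded m n (M : R -> 'M[R]_(m, n)) (a b : R) : a <= b ->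
  (forall i j, differentiable_everywhere (fun x => M x i j)) ->
  exists2 K, 0 <= K & forall x, a <= x <= b -> mnorm (mxC (M x)) <= K.
Proof.
move=> ab dM.
have /choice [Kf hK] : forall ij : 'I_m * 'I_n, exists K : R,
    0 <= K /\ forall x, a <= x <= b -> `|M x ij.1 ij.2| <= K.
  move=> [i j]; have [K K0 hK] := continuous_bounded ab
    (differentiable_everywhere_continuous (dM i j)).
  by exists K.
exists (\sum_i \sum_j Kf (i, j)).
  by apply: sumr_ge0 => i _; apply: sumr_ge0 => j _; exact: (hK (i, j)).1.
move=> x hx; apply: ler_sum => i _; apply: ler_sum => j _; rewrite mxE normcR.
exact: ((hK (i, j)).2 x hx).
Qed.

End Antiderivatives.

Section Uniqueness.
Variable R : realType.
Local Notation C := R[i].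

(** Gronwall's inequality with zero forcing, and the reflection x -> - x for negative times. All of
    the line is covered, since the point where V . V_x is nonzero is not localized. *)
Lemma linear_ode_unique m n (A : R -> 'M[C]_m) (Y : R -> 'M[C]_(m, n)) :
  (forall T : R, 0 <= T -> exists2 K, 0 <= K & forall x, - T <= x <= T -> mnorm (A x) <= K) ->
  (forall x, mxderiv Y x (A x *m Y x)) -> Y 0 = 0 -> forall x, Y x = 0.
Proof.
move=> bA dY Y0 x; have [K K0 hK] := bA `|x| (normr_ge0 x).
have [K' K'0 gron] := gronwall m n (normr_ge0 x) K0.
have zero (M : 'M[C]_(m, n)) : mnorm M <= K' * 0 -> M = 0.
  rewrite mulr0 => h; apply/matrixP => i j; rewrite mxE; apply: Normc.eq0_normc.
  by apply/eqP; rewrite eq_le normc_ge0 (le_trans (normc_le_mnorm _ _ _)).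
have m0 : mnorm (0 : 'M[C]_(m, n)) <= 0.
  by rewrite -[0 in X in mnorm X](scale0r 0) mnormZ Normc.normc0 mul0r.
have [x0|x0] := leP 0 x.
  apply: zero; apply: (gron A Y (fun=> 0) 0) => //.
  - by move=> y hy; rewrite addr0.
  - by move=> y /andP[y0 yx]; apply: hK; rewrite yx andbT (le_trans _ y0) // oppr_le0.
  - by rewrite ger0_norm // x0 lexx.
rewrite -[x]opprK; apply: zero.
apply: (gron (fun y => - A (- y)) (fun y => Y (- y)) (fun=> 0) 0) => //.
- move=> y hy; rewrite addr0 mulNmx => i j; rewrite mxE.
  have dn : is_derive y 1 (fun y : R => - y) (-1).
    by eapply is_derive_eq; [is_derive_auto|].
  have [d1 d2] := dY (- y) i j.
  split; [have := @is_derive_fcomp R (fun y => - y) (fun y => complex.Re (Y y i j)) y _ _ d1 dn|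
          have := @is_derive_fcomp R (fun y => - y) (fun y => complex.Im (Y y i j)) y _ _ d2 dn];
    by rewrite mulrN1 raddfN.
- move=> y /andP[y0 yx]; rewrite mnormN; apply: hK.
  by rewrite lerN2 yx (le_trans _ (normr_ge0 x)) // oppr_le0.
- by rewrite oppr0.
- by rewrite ltr0_norm // lexx andbT oppr_ge0 ltW.
Qed.

End Uniqueness.

(** * Symmetries and conservation of the linearized invariants *)

Section Functionals.
Variables (R : realType) (g g1 g2 w1 w2 : R -> R).
Implicit Types u p s a b d : 'cV[R]_2.
Local Notation mphi := (mu_phi_lin g g1).
Local Notation mx := (mu_x_lin g g1 w1).
Local Notation L := (LEL g g1 g2 w1 w2).
Local Notation L0 := (LEL0 g1 g2 w1 w2).

(** The profile equation commutes with rotations; infinitesimally, the linearization at (J u, J p, J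
    s) is J applied to [EL], which vanishes on a profile. *)
Lemma LEL_rotation omega c u p s i : (forall j, EL g g1 w1 omega c u p s j = 0) ->
  L omega c u p s (J *m u) (J *m p) (J *m s) i = 0.
Proof.
move=> h; have h0 := h 0; have h1 := h 1; move: h0 h1; rewrite /EL /LEL /LEL0 !sqnorm2E !dot2E.
have [-> | ->] := ord2P i; rewrite ?J0E ?J1E ?J0E ?J1E ?sqnorm2E => h0 h1.
  by rewrite -[RHS]h1; ring.
by rewrite -[RHS]oppr0 -[in RHS]h0; ring.
Qed.

Lemma LELN omega c u p s a b d i :
  L omega c u p s (- a) (- b) (- d) i = - L omega c u p s a b d i.
Proof.
have N (v : 'cV[R]_2) k : (- v) k 0 = - v k 0 by rewrite mxE.
rewrite /LEL /LEL0 !dot2E.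
by have [-> | ->] := ord2P i; rewrite ?J0E ?J1E !N; ring.
Qed.

(** mu_phi is invariant under rotations, so its differential kills the rotation mode. *)
Lemma mu_phi_lin_rot c u p : mphi c u p (J *m u) (J *m p) = 0.
Proof. by rewrite /mu_phi_lin !dot2E !J0E !J1E !J0E; ring. Qed.

Lemma mu_x_lin_rot omega u p : mx omega u p (J *m u) (J *m p) = 0.
Proof. by rewrite /mu_x_lin !dot2E !J0E !J1E; ring. Qed.

Lemma mu_phi_linN c u p a b : mphi c u p (- a) (- b) = - mphi c u p a b.
Proof.
have N (v : 'cV[R]_2) k : (- v) k 0 = - v k 0 by rewrite mxE.
by rewrite /mu_phi_lin !dot2E !J0E !J1E !N; ring.
Qed.

Lemma mu_x_linN omega u p a b : mx omega u p (- a) (- b) = - mx omega u p a b.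
Proof.
have N (v : 'cV[R]_2) k : (- v) k 0 = - v k 0 by rewrite mxE.
by rewrite /mu_x_lin !dot2E !N; ring.
Qed.

Section Derivatives.
Variables (omega c : R) (V p s : R -> 'cV[R]_2) (x : R).
Hypothesis dg : forall r : R, is_derive r 1 g (g1 r).
Hypothesis dg1 : forall r : R, is_derive r 1 g1 (g2 r).
Hypothesis dw1 : forall r : R, is_derive r 1 w1 (w2 r).
Hypothesis dV : forall i, is_derive x 1 (fun y => V y i 0) (p x i 0).
Hypothesis dp : forall i, is_derive x 1 (fun y => p y i 0) (s x i 0).
Hypothesis EL0 : forall j, EL g g1 w1 omega c (V x) (p x) (s x) j = 0.
Hypothesis g_neq0 : g (sqnorm (V x)) != 0.
Local Notation d a b := (\col_i (L0 omega c (V x) (p x) (s x) a b i / g (sqnorm (V x)))).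

(* Off shell, [(mu_phi)_x = - JU . EL] and [(mu_x)_x = - U_x . EL]: linearizing
   these identities at a solution of EL = 0 gives the next two lemmas. *)
Lemma is_derive_mu_phi_lin a b :
  is_derive x 1 (fun y => mphi c (V y) (p y) a b) (- mphi c (V x) (p x) b (d a b)).
Proof.
have da i : is_derive x 1 (fun _ : R => a i 0) ((0 : 'cV[R]_2) i 0).
  by rewrite mx0E; exact: is_deriveFcst.
have db i : is_derive x 1 (fun _ : R => b i 0) ((0 : 'cV[R]_2) i 0).
  by rewrite mx0E; exact: is_deriveFcst.
have dVV := is_derive_dot_curve dV dV.
have dVa := @is_derive_dot_curve R V (fun=> a) p (fun=> 0) x dV da.
have dJV i := is_derive_J_curve i dV.
have dJVp := @is_derive_dot_curve R (fun y => J *m V y) p (fun y => J *m p y) s x dJV dp.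
have dJVb := @is_derive_dot_curve R (fun y => J *m V y) (fun=> b) (fun y => J *m p y) (fun=> 0) x dJV db.
have dJa i : is_derive x 1 (fun _ : R => (J *m a) i 0) ((0 : 'cV[R]_2) i 0).
  by rewrite mx0E; exact: is_deriveFcst.
have dJap := @is_derive_dot_curve R (fun=> J *m a) p (fun=> 0) s x dJa dp.
have q0 := is_derive_fcomp (dg _) dVV; have q1 := is_derive_fcomp (dg1 _) dVV.
have -> : (fun y => mphi c (V y) (p y) a b) = (fun y =>
  2 * g1 (dot (V y) (V y)) * dot (V y) a * dot (J *m V y) (p y)
  + g (dot (V y) (V y)) * (dot (J *m a) (p y) + dot (J *m V y) b) + c * dot (V y) a).
  by apply/funext => y; rewrite /mu_phi_lin !sqnorm_dot.
eapply is_derive_eq; first by is_derive_auto.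
apply/eqP; rewrite -subr_eq0; apply/eqP.
(* Linearizing - JU . EL also gives - J a . EL. It vanishes on the profile, but must be restored in
   the goal for the two sides to agree as rational expressions. *)
rewrite -[RHS]oppr0 -[in RHS](mulr0 (a 1 0)) -[in RHS](EL0 0).
rewrite -[X in _ = - X]subr0 -[in RHS](mulr0 (a 0 0)) -[in RHS](EL0 1).
move: g_neq0; rewrite /EL /mu_phi_lin /LEL0 -!sqnorm_dot !dot2E !mx0E !J0E !J1E !sqnorm2E ![(\col__ _) _ _]mxE !J0E !J1E => gn.
by field.
Qed.

Lemma is_derive_mu_x_lin a b :
  is_derive x 1 (fun y => mx omega (V y) (p y) a b) (- mx omega (V x) (p x) b (d a b)).
Proof.
have da i : is_derive x 1 (fun _ : R => a i 0) ((0 : 'cV[R]_2) i 0).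
  by rewrite mx0E; exact: is_deriveFcst.
have db i : is_derive x 1 (fun _ : R => b i 0) ((0 : 'cV[R]_2) i 0).
  by rewrite mx0E; exact: is_deriveFcst.
have dVV := is_derive_dot_curve dV dV; have dpp := is_derive_dot_curve dp dp.
have dVa := @is_derive_dot_curve R V (fun=> a) p (fun=> 0) x dV da.
have dpb := @is_derive_dot_curve R p (fun=> b) s (fun=> 0) x dp db.
have q0 := is_derive_fcomp (dg _) dVV; have q1 := is_derive_fcomp (dg1 _) dVV.
have q2 := is_derive_fcomp (dw1 _) dVV.
have -> : (fun y => mx omega (V y) (p y) a b) = (fun y =>
  g1 (dot (V y) (V y)) * dot (V y) a * dot (p y) (p y) + g (dot (V y) (V y)) * dot (p y) b
  - 2 * w1 (dot (V y) (V y)) * dot (V y) a + omega * dot (V y) a).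
  by apply/funext => y; rewrite /mu_x_lin !sqnorm_dot.
eapply is_derive_eq; first by is_derive_auto.
apply/eqP; rewrite -subr_eq0; apply/eqP.
(* Likewise, the term restored here is - b . EL. *)
rewrite -[RHS]oppr0 -[in RHS](mulr0 (b 0 0)) -[in RHS](EL0 0).
rewrite -[X in _ = - X]addr0 -[in RHS](mulr0 (b 1 0)) -[in RHS](EL0 1).
move: g_neq0; rewrite /EL /mu_x_lin /LEL0 -!sqnorm_dot !dot2E !mx0E !J0E !J1E !sqnorm2E ![(\col__ _) _ _]mxE !J0E !J1E => gn.
by field.
Qed.

End Derivatives.

Lemma dot_expJ (theta : R) u v : dot (expJ theta *m u) (expJ theta *m v) = dot u v.
Proof.
rewrite !dot2E !expJ_0E !expJ_1E.
have := cos2Dsin2 theta; move: (cos theta) (sin theta) => co si h.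
have -> : u 0 0 * v 0 0 + u 1 0 * v 1 0 = (co ^+ 2 + si ^+ 2) * (u 0 0 * v 0 0 + u 1 0 * v 1 0).
  by rewrite h mul1r.
ring.
Qed.

Lemma sqnorm_expJ (theta : R) u : sqnorm (expJ theta *m u) = sqnorm u.
Proof. by rewrite !sqnorm_dot dot_expJ. Qed.

Lemma J_expJ (theta : R) m (M : 'M[R]_(2, m)) : J *m (expJ theta *m M) = expJ theta *m (J *m M).
Proof.
by rewrite !mulmxA; congr (_ *m _); rewrite mulmxDl mulmxDr mul_scalar_mx mul_mx_scalar
  -scalemxAl -scalemxAr.
Qed.

Lemma mu_phi_lin_expJ (theta c : R) u p a b :
  mphi c (expJ theta *m u) (expJ theta *m p) (expJ theta *m a) (expJ theta *m b) = mphi c u p a b.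
Proof. by rewrite /mu_phi_lin !J_expJ !dot_expJ sqnorm_expJ. Qed.

Lemma mu_x_lin_expJ (theta omega : R) u p a b :
  mx omega (expJ theta *m u) (expJ theta *m p) (expJ theta *m a) (expJ theta *m b) =
  mx omega u p a b.
Proof. by rewrite /mu_x_lin !dot_expJ !sqnorm_expJ. Qed.

End Functionals.

(** Brings Sigma_t and Sigma_y, given entry by entry, to block form. *)
Lemma block_mx_columns (R : nzRingType) (q t : 'I_4 -> 'cV[R]_2) (M : 'M[R]_(2 + 2)) :
  (forall i j : 'I_4, M i j = [:: q j 0 0; q j 1 0; t j 0 0; t j 1 0]`_i) ->
  M = @block_mx _ 2 2 2 2 (row_mx (q 0) (q 1)) (row_mx (q 2) (q 3))
       (row_mx (t 0) (t 1)) (row_mx (t 2) (t 3)).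
Proof.
move=> ME.
have colE (u v : 'cV[R]_2) i (l : 'I_(1 + 1)) : row_mx u v i l = if l == 0 then u i 0 else v i 0.
  case: (@split_ordP 1 1 l) => m ->; rewrite ?row_mxEl ?row_mxEr ord1 //.
have e0 : lshift 2 (0 : 'I_2) = 0 :> 'I_4 by apply/val_inj.
have e1 : lshift 2 (1 : 'I_2) = 1 :> 'I_4 by apply/val_inj.
have e2 : rshift 2 (0 : 'I_2) = 2 :> 'I_4 by apply/val_inj.
have e3 : rshift 2 (1 : 'I_2) = 3 :> 'I_4 by apply/val_inj.
apply/matrixP => i j; case: (ord22P i) => -[i' [-> _]]; case: (ord22P j) => -[j' [-> _]];
  rewrite ?block_mxEul ?block_mxEur ?block_mxEdl ?block_mxEdr colE ME;
  by have [-> | ->] := ord2P i'; have [-> | ->] := ord2P j'; rewrite ?e0 ?e1 ?e2 ?e3.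
Qed.

Lemma Rintegral_mx_columns (R : realType) (X : R) (F : R -> 'M[R]_(2, 1 + 1)) (a b a' b' : R -> R) :
  (forall x, F x = row_mx (\col_i (if i == 0 then a x else b x))
                          (\col_i (if i == 0 then a' x else b' x))) ->
  \matrix_(i, j) \int[lebesgue_measure]_(x in `[0, X]) F x i j =
  row_mx (\col_i (if i == 0 then \int[lebesgue_measure]_(x in `[0, X]) a x
                  else \int[lebesgue_measure]_(x in `[0, X]) b x))
         (\col_i (if i == 0 then \int[lebesgue_measure]_(x in `[0, X]) a' x
                  else \int[lebesgue_measure]_(x in `[0, X]) b' x)).
Proof.
move=> FE; apply/matrixP => i l; rewrite mxE.
case: (@split_ordP 1 1 l) => m ->; rewrite ?row_mxEl ?row_mxEr ord1 mxE.
  have -> : (fun x => F x i (lshift 1 0)) = (fun x => if i == 0 then a x else b x).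
    by apply/funext => x; rewrite FE row_mxEl mxE.
  by case: ifP.
have -> : (fun x => F x i (rshift 1 0)) = (fun x => if i == 0 then a' x else b' x).
  by apply/funext => x; rewrite FE row_mxEr mxE.
by case: ifP.
Qed.

Section LinearizedMomenta.
Variables (R : realType) (n : nat) (U p v v' : R -> 'cV[R]_2).
Hypothesis dU : forall (x : R) i, is_derive x 1 (fun y => U y i 0) (p x i 0).
Hypothesis dv : forall (x : R) i, is_derive x 1 (fun y => v y i 0) (v' x i 0).

Lemma on_axisE (x : R) : on_axis n x 0 0 = x.
Proof. by rewrite /on_axis scalemxE mxE !eqxx mulr1. Qed.

Let col_grad (q q' : R -> 'cV[R]_2) z :
  (forall (x : R) i, is_derive x 1 (fun y => q y i 0) (q' x i 0)) ->
  col 0 (grad (@planar R n q) z) = q' (z 0 0).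
Proof. by move=> dq; apply/colP => i; rewrite mxE (grad_planar dq) eqxx. Qed.

Lemma functional_Mass x : functional (@Mass R n) (planar U) (on_axis n x) = 2^-1 * sqnorm (U x).
Proof. by rewrite /functional /Mass /planar on_axisE. Qed.

Lemma functional_Q1 x : functional (@Q1 R n) (planar U) (on_axis n x) = 2^-1 * dot (J *m U x) (p x).
Proof. by rewrite /functional /Q1 (col_grad (q := U) _ dU) /planar on_axisE. Qed.

Let is_derive_ray (u w : 'cV[R]_2) i (s : R) : is_derive s 1 (fun s => (u + s *: w) i 0) (w i 0).
Proof.
have -> : (fun s => (u + s *: w) i 0) = (fun s => u i 0 + s * w i 0).
  by apply/funext => t; rewrite addmxE scalemxE.
by eapply is_derive_eq; [is_derive_auto|rewrite /=; ring].
Qed.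

Lemma lin_Mass x : lin (functional (@Mass R n)) (planar U) (planar v) (on_axis n x) = dot (U x) (v x).
Proof.
rewrite /lin derive1E.
have -> : (fun s => functional (@Mass R n) (fun z' => planar U z' + s *: planar v z') (on_axis n x)) =
    (fun s => 2^-1 * dot (U x + s *: v x) (U x + s *: v x)).
  by apply/funext => s; rewrite /functional /Mass /planar on_axisE sqnorm_dot.
have d0 i := is_derive_ray (U x) (v x) i 0.
have := @is_derive_dot_curve R (fun s => U x + s *: v x) (fun s => U x + s *: v x)
  (fun=> v x) (fun=> v x) 0 d0 d0.
rewrite scale0r addr0 => d1.
have d2 := is_deriveFM (is_deriveFcst 2^-1 0) d1.
by rewrite (@derive_val _ _ _ _ _ _ _ d2) !dot2E; field.
Qed.

Lemma lin_Q1 x : lin (functional (@Q1 R n)) (planar U) (planar v) (on_axis n x) =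
  2^-1 * (dot (J *m U x) (v' x) + dot (J *m v x) (p x)).
Proof.
rewrite /lin derive1E.
have -> : (fun s => functional (@Q1 R n) (fun z' => planar U z' + s *: planar v z') (on_axis n x)) =
    (fun s => 2^-1 * dot (J *m (U x + s *: v x)) (p x + s *: v' x)).
  apply/funext => s; rewrite /functional /Q1.
  have dq (y : R) i : is_derive y 1 (fun y => (U y + s *: v y) i 0) ((p y + s *: v' y) i 0).
    have -> : (fun y => (U y + s *: v y) i 0) = (fun y => U y i 0 + s * v y i 0).
      by apply/funext => t; rewrite addmxE scalemxE.
    have h1 := dU y i; have h2 := dv y i.
    by eapply is_derive_eq; [is_derive_auto|rewrite addmxE scalemxE; ring].
  by rewrite [col 0 _](col_grad (q := fun y => U y + s *: v y) _ dq) /planar on_axisE.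
have d0 i := is_derive_ray (U x) (v x) i 0.
have d1 i := is_derive_ray (p x) (v' x) i 0.
have := @is_derive_dot_curve R (fun s => J *m (U x + s *: v x)) (fun s => p x + s *: v' x)
  (fun=> J *m v x) (fun=> v' x) 0 (fun i => @is_derive_J_curve R (fun s => U x + s *: v x) (fun=> v x) 0 i d0) d1.
rewrite !scale0r !addr0 => d2.
have d3 := is_deriveFM (is_deriveFcst 2^-1 0) d2.
by rewrite (@derive_val _ _ _ _ _ _ _ d3); ring.
Qed.

End LinearizedMomenta.

(** * The spectral problem of a modulated profile *)

Section RealMatrixCurves.
Variable R : realType.

Definition rmxderiv m n (F : R -> 'M[R]_(m, n)) (x : R) (F' : 'M[R]_(m, n)) :=
  forall i j, is_derive x 1 (fun y => F y i j) (F' i j).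

Lemma rmxderiv_mxC m n (F : R -> 'M[R]_(m, n)) x F' :
  rmxderiv F x F' -> mxderiv (fun y => mxC (F y)) x (mxC F').
Proof.
move=> dF i j; rewrite mxE; apply: cderiv_ext (cderivR (dF i j)) => y.
by rewrite mxE.
Qed.

Lemma mxCM m n q (M : 'M[R]_(m, n)) (N : 'M[R]_(n, q)) : mxC (M *m N) = mxC M *m mxC N.
Proof. by rewrite /mxC map_mxM. Qed.

Lemma rmxderivMr m n q (F : R -> 'M[R]_(m, n)) x F' (M : 'M[R]_(n, q)) :
  rmxderiv F x F' -> rmxderiv (fun y => F y *m M) x (F' *m M).
Proof.
move=> dF i j; rewrite mxE.
have -> : (fun y => (F y *m M) i j) = (fun y => \sum_k (F y i k * M k j)).
  by apply/funext => y; rewrite mxE.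
apply: is_derive_fsum => k.
by apply: is_derive_eq (is_deriveFM (dF i k) (is_deriveFcst (M k j) x)) _; rewrite mulr0 addr0.
Qed.

Lemma rmxderiv_eq m n (F : R -> 'M[R]_(m, n)) x F' F'' :
  rmxderiv F x F' -> F' = F'' -> rmxderiv F x F''.
Proof. by move=> h <-. Qed.

Lemma rmxderiv_row m n1 n2 (F : R -> 'M[R]_(m, n1)) (G : R -> 'M[R]_(m, n2)) x F' G' :
  rmxderiv F x F' -> rmxderiv G x G' ->
  rmxderiv (fun y => row_mx (F y) (G y)) x (row_mx F' G').
Proof.
move=> dF dG i j; case: (split_ordP j) => k ->; rewrite ?row_mxEl ?row_mxEr.
  have -> : (fun y => row_mx (F y) (G y) i (lshift n2 k)) = (fun y => F y i k).
    by apply/funext => y; rewrite row_mxEl.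
  exact: dF.
have -> : (fun y => row_mx (F y) (G y) i (rshift n1 k)) = (fun y => G y i k).
  by apply/funext => y; rewrite row_mxEr.
exact: dG.
Qed.

Lemma rmxderiv_col m1 m2 n (F : R -> 'M[R]_(m1, n)) (G : R -> 'M[R]_(m2, n)) x F' G' :
  rmxderiv F x F' -> rmxderiv G x G' ->
  rmxderiv (fun y => col_mx (F y) (G y)) x (col_mx F' G').
Proof.
move=> dF dG i j; case: (split_ordP i) => k ->; rewrite ?col_mxEu ?col_mxEd.
  have -> : (fun y => col_mx (F y) (G y) (lshift m2 k) j) = (fun y => F y k j).
    by apply/funext => y; rewrite col_mxEu.
  exact: dF.
have -> : (fun y => col_mx (F y) (G y) (rshift m1 k) j) = (fun y => G y k j).
  by apply/funext => y; rewrite col_mxEd.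
exact: dG.
Qed.

Definition mx_differentiable m n (F : R -> 'M[R]_(m, n)) :=
  forall i j, differentiable_everywhere (fun x => F x i j).

Lemma rmxderiv_differentiable m n (F F' : R -> 'M[R]_(m, n)) :
  (forall x, rmxderiv F x (F' x)) -> mx_differentiable F.
Proof. by move=> dF i j x; exists (F' x i j); exact: dF. Qed.

Lemma mx_differentiableM m n r (F : R -> 'M[R]_(m, n)) (G : R -> 'M[R]_(n, r)) :
  mx_differentiable F -> mx_differentiable G -> mx_differentiable (fun x => F x *m G x).
Proof.
move=> dF dG i j x.
have /choice [l hl] : forall k, exists l, is_derive x 1 (fun y => F y i k * G y k j) l.
  move=> k; have [a ha] := dF i k x; have [b hb] := dG k j x.
  by exists (a * G x k j + F x i k * b); exact: is_deriveFM.
exists (\sum_k l k).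
have -> : (fun y => (F y *m G y) i j) = (fun y => \sum_k (F y i k * G y k j)).
  by apply/funext => y; rewrite mxE.
exact: is_derive_fsum.
Qed.

Lemma mx_antiderivative m n (F : R -> 'M[R]_(m, n)) (X : R) : 0 < X -> mx_differentiable F ->
  exists G : R -> 'M[R]_(m, n), (forall x, 0 <= x <= X -> rmxderiv G x (F x)) /\
    forall i j, \int[lebesgue_measure]_(x in `[0, X]) F x i j = G X i j - G 0 i j.
Proof.
move=> X0 dF.
have /choice [G hG] : forall ij : 'I_m * 'I_n, exists G : R -> R,
    (forall x, 0 <= x <= X -> is_derive x 1 G (F x ij.1 ij.2)) /\
    \int[lebesgue_measure]_(x in `[0, X]) F x ij.1 ij.2 = G X - G 0.
  move=> [i j]; apply: antiderivative => //.
  exact: differentiable_everywhere_continuous.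
exists (fun x => \matrix_(i, j) G (i, j) x); split=> [x hx i j|i j].
  have -> : (fun y => (\matrix_(i, j) G (i, j) y) i j) = G (i, j).
    by apply/funext => y; rewrite mxE.
  exact: (hG (i, j)).1.
by rewrite !mxE (hG (i, j)).2.
Qed.

End RealMatrixCurves.

Section SpectralProblem.
Local Opaque fam_x fam_xx fam_xxx var var_x var_xx.
Variables (R : realType) (n : nat) (kappa W g g1 g2 g3 w w1 w2 w3 : R -> R).
Hypothesis kappaE : forall r : R, 0 <= r -> kappa r = g r.
Hypothesis WE : forall r : R, 0 <= r -> W r = w r.
Hypothesis dg : forall r : R, is_derive r 1 g (g1 r).
Hypothesis dg1 : forall r : R, is_derive r 1 g1 (g2 r).
Hypothesis dg2 : forall r : R, is_derive r 1 g2 (g3 r).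
Hypothesis dw : forall r : R, is_derive r 1 w (w1 r).
Hypothesis dw1 : forall r : R, is_derive r 1 w1 (w2 r).
Hypothesis dw2 : forall r : R, is_derive r 1 w2 (w3 r).
Hypothesis g_neq0 : forall u : 'cV[R]_2, g (sqnorm u) != 0.
Variables (P : set 'rV[R]_4) (Vf : 'rV[R]_4 -> R -> 'cV[R]_2) (Xf xif : 'rV[R]_4 -> R).
Hypothesis hfam : wave_family n kappa W P Vf Xf xif.
Variable a0 : 'rV[R]_4.
Hypothesis Pa0 : P a0.

Local Notation V := (Vf a0).
Local Notation p := (fam_x Vf a0).
Local Notation s := (fam_xx Vf a0).
Local Notation s' := (fam_xxx Vf a0).
Local Notation vr := (var Vf a0).
Local Notation vrx := (var_x Vf a0).
Local Notation vrxx := (var_xx Vf a0).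
Local Notation omega := (a0 0 0).
Local Notation c := (a0 0 1).
Local Notation k x := (g (sqnorm (V x))).
Local Notation Am := (Amx g g1 g2 w1 w2 omega c V p s).
Local Notation Bm := (Bmx g V).
Local Notation Dm := (@Dmx R).
Local Notation L := (LEL g g1 g2 w1 w2).
Local Notation L0 := (LEL0 g1 g2 w1 w2).

Let dV (x : R) i : is_derive x 1 (fun y => V y i 0) (p x i 0).
Proof. exact: (fam_dx hfam). Qed.
Let dp (x : R) i : is_derive x 1 (fun y => p y i 0) (s x i 0).
Proof. exact: (fam_dxx hfam). Qed.
Let ds (x : R) i : is_derive x 1 (fun y => s y i 0) (s' x i 0).
Proof. exact: (fam_dxxx hfam). Qed.
Let dvr j (x : R) i : is_derive x 1 (fun y => vr j y i 0) (vrx j x i 0).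
Proof. exact: (var_dx hfam). Qed.
Let dvrx j (x : R) i : is_derive x 1 (fun y => vrx j y i 0) (vrxx j x i 0).
Proof. exact: (var_dxx hfam). Qed.
Let ELV x i : EL g g1 w1 omega c (V x) (p x) (s x) i = 0.
Proof. exact: (fam_EL kappaE WE dg dw hfam). Qed.

(** As [LEL] is [LEL0] minus g times the second derivative, a right-hand side r of the linearized
    equation becomes a forcing - r / g. It is applied with r = 0 for Y1 and Y2, and with r = V and r
    = J V_x for Z. *)
Lemma first_order_column (a b : R -> 'cV[R]_2) (d r : 'cV[R]_2) (x : R) :
  (forall i, is_derive x 1 (fun y => a y i 0) (b x i 0)) ->
  (forall i, is_derive x 1 (fun y => b y i 0) (d i 0)) ->
  (forall i, L omega c (V x) (p x) (s x) (a x) (b x) d i = r i 0) ->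
  rmxderiv (fun y => col_mx (a y) (b y)) x
    (Am x *m col_mx (a x) (b x) - col_mx 0 ((k x)^-1 *: r)).
Proof.
move=> da db hL.
have h : rmxderiv (fun y => col_mx (a y) (b y)) x (col_mx (b x) d).
  by apply: rmxderiv_col => i j; rewrite ord1.
apply: rmxderiv_eq h _; rewrite Amx_col // opp_col_mx add_col_mx oppr0 addr0.
congr col_mx; apply/colP => i; rewrite addmxE mxE [X in _ + X]mxE scalemxE -hL /LEL.
by field; exact: g_neq0.
Qed.

(* [Y1m]: infinitesimal rotation and (backward) translation; [Y2m], [Zm]: derivatives
   in (mu_phi, mu_x) and (omega_phi, c_x). *)
Definition Y1m x : 'M[R]_(2 + 2, 1 + 1) :=
  row_mx (col_mx (J *m V x) (J *m p x)) (col_mx (- p x) (- s x)).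
Definition Y2m x : 'M[R]_(2 + 2, 1 + 1) :=
  row_mx (col_mx (vr 2 x) (vrx 2 x)) (col_mx (vr 3 x) (vrx 3 x)).
Definition Zm x : 'M[R]_(2 + 2, 1 + 1) :=
  row_mx (col_mx (vr 0 x) (vrx 0 x)) (col_mx (vr 1 x) (vrx 1 x)).

(** The first column uses rotation invariance, and the second is the derivative of the profile
    equation in x. *)
Lemma dY1m x : rmxderiv Y1m x (Am x *m Y1m x).
Proof.
rewrite /Y1m mul_mx_row; apply: rmxderiv_row.
  have := @first_order_column (fun y => J *m V y) (fun y => J *m p y) (J *m s x) 0 x
    (fun i => is_derive_J_curve i (dV x)) (fun i => is_derive_J_curve i (dp x)).
  rewrite scaler0 col_mx0 subr0; apply => i.
  by rewrite mx0E; exact: LEL_rotation.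
have dN (a b : R -> 'cV[R]_2) i : is_derive x 1 (fun y => a y i 0) (b x i 0) ->
    is_derive x 1 (fun y => (- a y) i 0) ((- b x) i 0).
  move=> h; have -> : (fun y => (- a y) i 0) = (fun y => - a y i 0).
    by apply/funext => y; rewrite mxE.
  by rewrite [(- b x) i 0]mxE; exact: is_deriveFN.
have := @first_order_column (fun y => - p y) (fun y => - s y) (- s' x) 0 x
  (fun i => dN _ _ i (dp x i)) (fun i => dN _ _ i (ds x i)).
rewrite scaler0 col_mx0 subr0; apply => i; rewrite mx0E LELN.
have H := @is_derive_EL R g g1 g2 w1 w2 dg dg1 dw1 (fun=> omega) (fun=> c) (fun=> 0) (fun=> 0)
  V p s p s s' x i (is_deriveFcst _ _) (is_deriveFcst _ _) (dV x) (dp x) (ds x).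
have H0 : (fun y => EL g g1 w1 omega c (V y) (p y) (s y) i) = (fun=> 0).
  by apply/funext => y.
rewrite H0 !mul0r !subr0 in H.
by rewrite -(@derive_val _ _ _ _ _ _ _ H) derive_cst oppr0.
Qed.

Let dvar_column j x : (j == 0) = false -> (j == 1) = false ->
  rmxderiv (fun y => col_mx (vr j y) (vrx j y)) x (Am x *m col_mx (vr j x) (vrx j x)).
Proof.
move=> j0 j1; have := @first_order_column (vr j) (vrx j) (vrxx j x) 0 x (dvr j x) (dvrx j x).
rewrite scaler0 col_mx0 subr0; apply => i.
by rewrite (var_LEL kappaE WE dg dg1 dw dw1 hfam Pa0) j0 j1 !mul0r addr0 mx0E.
Qed.

Lemma dY2m x : rmxderiv Y2m x (Am x *m Y2m x).
Proof. by rewrite /Y2m mul_mx_row; apply: rmxderiv_row; exact: dvar_column. Qed.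

Lemma JJ (u : 'cV[R]_2) : J *m (J *m u) = - u.
Proof.
apply/colP => i; rewrite [RHS]mxE.
by have [-> | ->] := ord2P i; rewrite ?J0E ?J1E ?J0E ?J1E.
Qed.

(** The forcings are - V = J (J V) and - J V_x = J (- V_x): the second one is why the translation
    mode is taken backward in [Y1m]. *)
Lemma dZm x : rmxderiv Zm x (Am x *m Zm x + Bm x *m Y1m x).
Proof.
rewrite /Zm /Y1m !mul_mx_row !Bmx_col add_row_mx; apply: rmxderiv_row.
  have H := @first_order_column (vr 0) (vrx 0) (vrxx 0 x) (V x) x (dvr 0 x) (dvrx 0 x).
  apply: rmxderiv_eq (H _) _.
    move=> i; rewrite (var_LEL kappaE WE dg dg1 dw dw1 hfam Pa0) /=.
    by rewrite mul1r mul0r addr0.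
  by rewrite JJ opp_col_mx oppr0 scalerN.
have H := @first_order_column (vr 1) (vrx 1) (vrxx 1 x) (J *m p x) x (dvr 1 x) (dvrx 1 x).
apply: rmxderiv_eq (H _) _.
  move=> i; rewrite (var_LEL kappaE WE dg dg1 dw dw1 hfam Pa0) /=.
  by rewrite mul1r mul0r add0r.
by rewrite opp_col_mx oppr0 mulmxN scalerN.
Qed.

(* Row i of [ellm] is the differential of mu_phi (i = 0) or mu_x (i = 1) at (V, V_x). *)
Definition fn (i : 'I_2) x (a b : 'cV[R]_2) : R :=
  if i == 0 then mu_phi_lin g g1 c (V x) (p x) a b else mu_x_lin g g1 w1 omega (V x) (p x) a b.

Definition ellm x : 'M[R]_(2, 2 + 2) :=
  row_mx (\matrix_(i, j) fn i x (delta_mx j 0) 0) (\matrix_(i, j) fn i x 0 (delta_mx j 0)).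

Lemma ellm_col x a b : ellm x *m col_mx a b = \col_i fn i x a b.
Proof.
rewrite mul_row_col; apply/colP => i; rewrite addmxE !mulmx2E !mxE /fn.
rewrite /mu_phi_lin /mu_x_lin !dot2E !J0E !J1E !mxE /=.
by have [-> | ->] := ord2P i; rewrite /=; ring.
Qed.

Lemma dellm x : rmxderiv ellm x (- (ellm x *m Am x)).
Proof.
have key a b i : is_derive x 1 (fun y => fn i y a b) (- (ellm x *m (Am x *m col_mx a b)) i 0).
  rewrite Amx_col // ellm_col [(\col__ _) _ _]mxE /fn; case: ifP => _.
    by apply: (is_derive_mu_phi_lin w2 dg dg1 (dV x) (dp x) (ELV x) (g_neq0 _)).
  by apply: (is_derive_mu_x_lin dg dg1 dw1 (dV x) (dp x) (ELV x) (g_neq0 _)).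
move=> i j; rewrite [X in is_derive _ _ _ X]mxE.
have cj (M : 'M[R]_(2, 2 + 2)) (v : 'cV[R]_(2 + 2)) : v = delta_mx j 0 -> M i j = (M *m v) i 0.
  by move=> ->; rewrite -colE mxE.
case: (split_ordP j) cj => l -> cj.
  rewrite (cj _ (col_mx (delta_mx l 0) 0)); last first.
    by apply/colP => i'; case: (split_ordP i') => m ->; rewrite ?col_mxEu ?col_mxEd !mxE
      ?eq_lshift ?eq_rshift ?eq_lrshift ?eq_rlshift.
  have -> : (fun y => ellm y i (lshift 2 l)) = (fun y => fn i y (delta_mx l 0) 0).
    by apply/funext => y; rewrite row_mxEl mxE.
  by rewrite -mulmxA; exact: key.
rewrite (cj _ (col_mx 0 (delta_mx l 0))); last first.
  by apply/colP => i'; case: (split_ordP i') => m ->; rewrite ?col_mxEu ?col_mxEd !mxE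
      ?eq_lshift ?eq_rshift ?eq_lrshift ?eq_rlshift.
have -> : (fun y => ellm y i (rshift 2 l)) = (fun y => fn i y 0 (delta_mx l 0)).
  by apply/funext => y; rewrite row_mxEr mxE.
by rewrite -mulmxA; exact: key.
Qed.

Lemma ellB_col x a b : ellm x *m Bm x *m col_mx a b =
  \col_i (if i == 0 then dot (V x) a else dot (p x) (J *m a)).
Proof.
have gn := g_neq0 (V x).
rewrite -mulmxA Bmx_col ellm_col; apply/colP => i; rewrite !mxE /fn.
by case: ifP => _; rewrite /mu_phi_lin /mu_x_lin !dot2E ?J0E ?J1E !scalemxE !mx0E ?J0E ?J1E ?mx0E;
  field.
Qed.

Lemma ellD_col x a b : ellm x *m Dm *m col_mx a b =
  \col_i (k x * (if i == 0 then dot (J *m V x) a else dot (p x) a)).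
Proof.
rewrite -mulmxA Dmx_col ellm_col; apply/colP => i; rewrite !mxE /fn.
by case: ifP => _; rewrite /mu_phi_lin /mu_x_lin !dot2E ?J0E ?J1E !mx0E; ring.
Qed.

Let dsq (x : R) : is_derive x 1 (fun y => sqnorm (V y)) (2 * dot (V x) (p x)).
Proof. exact: is_derive_sqnorm_curve. Qed.

Let dkinv (x : R) : exists l, is_derive x 1 (fun y => (k y)^-1) l.
Proof.
eexists; apply: is_deriveFV; first exact: g_neq0.
exact: is_derive_fcomp (dg _) (dsq x).
Qed.

Lemma Bm_differentiable : mx_differentiable Bm.
Proof.
move=> i j x; have [l hl] := dkinv x.
case: (ord22P i) => -[i' [-> _]]; case: (ord22P j) => -[j' [-> _]].
- exists 0; have -> : (fun y => Bm y (lshift 2 i') (lshift 2 j')) = (fun=> 0).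
    by apply/funext => y; rewrite block_mxEul mxE.
  exact: is_deriveFcst.
- exists 0; have -> : (fun y => Bm y (lshift 2 i') (rshift 2 j')) = (fun=> 0).
    by apply/funext => y; rewrite block_mxEur mxE.
  exact: is_deriveFcst.
- have -> : (fun y => Bm y (rshift 2 i') (lshift 2 j')) = (fun y => (k y)^-1 * J i' j').
    by apply/funext => y; rewrite block_mxEdl mxE.
  by eexists; is_derive_auto.
- exists 0; have -> : (fun y => Bm y (rshift 2 i') (rshift 2 j')) = (fun=> 0).
    by apply/funext => y; rewrite block_mxEdr mxE.
  exact: is_deriveFcst.
Qed.

(** Used to bound the coefficients on segments, through continuity; it involves third derivatives of
    kappa, W and V. *)
Lemma Am_differentiable : mx_differentiable Am.
Proof.
have key (a b : 'cV[R]_2) i (x : R) : exists l, is_derive x 1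
    (fun y => L0 omega c (V y) (p y) (s y) a b i / k y) l.
  have [l hl] := dkinv x.
  have q1 := is_derive_fcomp (dg1 _) (dsq x); have q2 := is_derive_fcomp (dg2 _) (dsq x).
  have q3 := is_derive_fcomp (dw1 _) (dsq x); have q4 := is_derive_fcomp (dw2 _) (dsq x).
  have V0 := dV x 0; have V1 := dV x 1; have p0 := dp x 0; have p1 := dp x 1.
  have s0 := ds x 0; have s1 := ds x 1.
  have Vi := dV x i; have pi := dp x i; have si := ds x i.
  have -> : (fun y => L0 omega c (V y) (p y) (s y) a b i / k y) = (fun y =>
     ((2 * g2 (sqnorm (V y)) * (V y 0 0 * a 0 0 + V y 1 0 * a 1 0) * (p y 0 0 ^+ 2 + p y 1 0 ^+ 2)
       + 2 * g1 (sqnorm (V y)) * (p y 0 0 * b 0 0 + p y 1 0 * b 1 0)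
    + 4 * w2 (sqnorm (V y)) * (V y 0 0 * a 0 0 + V y 1 0 * a 1 0)) * V y i 0
  + (g1 (sqnorm (V y)) * (p y 0 0 ^+ 2 + p y 1 0 ^+ 2) + 2 * w1 (sqnorm (V y)) - omega) * a i 0
  - (2 * g1 (sqnorm (V y)) * (V y 0 0 * a 0 0 + V y 1 0 * a 1 0) * s y i 0
     + 4 * g2 (sqnorm (V y)) * (V y 0 0 * a 0 0 + V y 1 0 * a 1 0) * (V y 0 0 * p y 0 0 + V y 1 0 * p y 1 0) * p y i 0
     + 2 * g1 (sqnorm (V y)) * ((a 0 0 * p y 0 0 + a 1 0 * p y 1 0) + (V y 0 0 * b 0 0 + V y 1 0 * b 1 0)) * p y i 0
     + 2 * g1 (sqnorm (V y)) * (V y 0 0 * p y 0 0 + V y 1 0 * p y 1 0) * b i 0)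
  - c * (J *m b) i 0) * (k y)^-1).
    by apply/funext => y; rewrite /LEL0 !dot2E (sqnorm2E (p y)).
  by eexists; is_derive_auto.
move=> i j x.
case: (ord22P i) => -[i' [-> _]]; case: (ord22P j) => -[j' [-> _]].
- exists 0; have -> : (fun y => Am y (lshift 2 i') (lshift 2 j')) = (fun=> 0).
    by apply/funext => y; rewrite block_mxEul mxE.
  exact: is_deriveFcst.
- exists 0; have -> : (fun y => Am y (lshift 2 i') (rshift 2 j')) = (fun=> (i' == j')%:R).
    by apply/funext => y; rewrite block_mxEur mxE.
  exact: is_deriveFcst.
- have -> : (fun y => Am y (rshift 2 i') (lshift 2 j')) =
    (fun y => L0 omega c (V y) (p y) (s y) (delta_mx j' 0) 0 i' / k y).
    by apply/funext => y; rewrite block_mxEdl mxE.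
  exact: key.
- have -> : (fun y => Am y (rshift 2 i') (rshift 2 j')) =
    (fun y => L0 omega c (V y) (p y) (s y) 0 (delta_mx j' 0) i' / k y).
    by apply/funext => y; rewrite block_mxEdr mxE.
  exact: key.
Qed.

Local Notation X := (Xf a0).
Local Notation xi := (xif a0).
Let mw : modulated_profile n kappa W omega c V X xi := wf_profile hfam Pa0.
Let dpar (f : 'rV[R]_4 -> R) (j : 'I_4) : R := 'D_(delta_mx 0 j) f a0.

Lemma X_gt0 : 0 < X. Proof. exact: wp_period (mp_wave mw). Qed.

Definition rot (theta : R) : 'M[R]_(2 + 2) := block_mx (expJ theta) 0 0 (expJ theta).

Lemma rot_col theta (a b : 'cV[R]_2) :
  rot theta *m col_mx a b = col_mx (expJ theta *m a) (expJ theta *m b).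
Proof. by rewrite mul_block_col !mul0mx addr0 add0r. Qed.

Lemma mulmx_cV_inj q m (M N : 'M[R]_(q, m)) :
  (forall v : 'cV[R]_m, M *m v = N *m v) -> M = N.
Proof.
move=> h; apply/matrixP => i j; have := congr1 (fun v : 'cV__ => v i 0) (h (delta_mx j 0)).
by rewrite -!colE !mxE.
Qed.

Lemma expJ_mulN (theta : R) : expJ theta *m expJ (- theta) = 1%:M.
Proof.
apply: mulmx_cV_inj => v; rewrite mul1mx -mulmxA; apply/colP => i.
have := cos2Dsin2 theta; move: (cosN theta) (sinN theta) => cN sN h.
have [-> | ->] := ord2P i; rewrite ?expJ_0E ?expJ_1E ?expJ_0E ?expJ_1E cN sN.
  by rewrite -[RHS]mul1r -h; ring.
by rewrite -[RHS]mul1r -h; ring.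
Qed.

Lemma rot_mulN (theta : R) : rot theta *m rot (- theta) = 1%:M.
Proof.
rewrite /rot mulmx_block !mulmx0 !mul0mx !addr0 !add0r expJ_mulN.
by rewrite -scalar_mx_block.
Qed.

Let V_X : V X = expJ xi *m V 0.
Proof. by have := wp_shift (mp_wave mw) 0; rewrite add0r. Qed.
Let p_X : p X = expJ xi *m p 0.
Proof. by have := fam_x_shift hfam 0 Pa0; rewrite add0r. Qed.
Let s_X : s X = expJ xi *m s 0.
Proof. by have := fam_xx_shift hfam 0 Pa0; rewrite add0r. Qed.

Definition qcol j : 'cV[R]_2 := \col_i (if i == 0 then dpar xif j else dpar Xf j).
Definition Pm : 'M[R]_(2, 1 + 1) := row_mx (qcol 0) (qcol 1).
Definition Qm : 'M[R]_(2, 1 + 1) := row_mx (qcol 2) (qcol 3).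

Lemma row_mx_mul2 m (u v : 'cV[R]_m) (q : 'cV[R]_(1 + 1)) :
  row_mx u v *m q = q 0 0 *: u + q 1 0 *: v.
Proof.
apply/colP => i; rewrite mulmx2E addmxE !scalemxE.
have -> : row_mx u v i 0 = u i 0.
  by rewrite -[0 in LHS](_ : lshift 1 (0 : 'I_1) = 0) ?row_mxEl //; apply/val_inj.
have -> : row_mx u v i 1 = v i 0.
  by rewrite -[1 in LHS](_ : rshift 1 (0 : 'I_1) = 1) ?row_mxEr //; apply/val_inj.
by rewrite mulrC [v i 0 * _]mulrC.
Qed.

Lemma Y1m_col x (q : 'cV[R]_(1 + 1)) : Y1m x *m q =
  q 0 0 *: col_mx (J *m V x) (J *m p x) - q 1 0 *: col_mx (p x) (s x).
Proof. by rewrite row_mx_mul2 -scalerN opp_col_mx. Qed.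

Lemma Y1m_X : Y1m X = rot xi *m Y1m 0.
Proof.
by rewrite /Y1m mul_mx_row !rot_col V_X p_X s_X !J_expJ !mulmxN.
Qed.

Let shift_column (theta dX dxi : R) (vX vxX v vx v0 p0 s0 pX sX : 'cV[R]_2) :
  pX = expJ theta *m p0 -> sX = expJ theta *m s0 ->
  vX + dX *: pX = expJ theta *m v + dxi *: (J *m (expJ theta *m v0)) ->
  vxX + dX *: sX = expJ theta *m vx + dxi *: (J *m (expJ theta *m p0)) ->
  col_mx vX vxX = rot theta *m (col_mx v vx
     + (dxi *: col_mx (J *m v0) (J *m p0) - dX *: col_mx p0 s0)).
Proof.
move=> -> -> /(canRL (addrK _)) -> /(canRL (addrK _)) ->.
rewrite mulmxDr mulmxBr -!scalemxAr !rot_col !J_expJ.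
by rewrite !scale_col_mx opp_col_mx !add_col_mx !addrA.
Qed.

Let var_col_X j : col_mx (vr j X) (vrx j X) =
  rot xi *m (col_mx (vr j 0) (vrx j 0) + Y1m 0 *m qcol j).
Proof.
have q0 : qcol j 0 0 = dpar xif j by exact: mxE.
have q1 : qcol j 1 0 = dpar Xf j by exact: mxE.
rewrite Y1m_col q0 q1.
exact: (shift_column p_X s_X (var_shift hfam Pa0 j) (var_x_shift hfam Pa0 j)).
Qed.

Let row_shift (M : 'M[R]_(2 + 2)) (y : 'M[R]_(2 + 2, 1 + 1)) (u1 u2 v1 v2 : 'cV[R]_(2 + 2))
    (q1 q2 : 'cV[R]_(1 + 1)) :
  u1 = M *m (v1 + y *m q1) -> u2 = M *m (v2 + y *m q2) ->
  row_mx u1 u2 = M *m (row_mx v1 v2 + y *m row_mx q1 q2).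
Proof. by move=> -> ->; rewrite !mul_mx_row add_row_mx mul_mx_row. Qed.

Lemma Y2m_X : Y2m X = rot xi *m (Y2m 0 + Y1m 0 *m Qm).
Proof. exact: (row_shift (var_col_X 2) (var_col_X 3)). Qed.

Lemma Zm_X : Zm X = rot xi *m (Zm 0 + Y1m 0 *m Pm).
Proof. exact: (row_shift (var_col_X 0) (var_col_X 1)). Qed.

Lemma ellm_X : ellm X *m rot xi = ellm 0.
Proof.
apply: mulmx_cV_inj => v; rewrite -mulmxA -[v](@vsubmxK R 2 2 1) rot_col !ellm_col.
apply/colP => i; rewrite !mxE /fn V_X p_X.
by case: ifP => _; rewrite ?mu_phi_lin_expJ ?mu_x_lin_expJ.
Qed.

Let ell_px i x : fn i x (p x) (s x) = 0.
Proof.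
rewrite /fn; case: ifP => _.
  have H := @is_derive_mu_phi R g g1 dg (fun=> c) (fun=> 0) V p p s x
    (is_deriveFcst _ _) (dV x) (dp x).
  have E : (fun y => g (sqnorm (V y)) * dot (J *m V y) (p y) + c / 2 * sqnorm (V y)) = (fun=> a0 0 2).
    apply/funext => y; rewrite -(wf_mu_phi hfam Pa0 y) /mu_phi kappaE ?sqnorm_ge0 //.
    by rewrite (fam_derive1 hfam).
  rewrite E !mul0r addr0 in H.
  by rewrite -(@derive_val _ _ _ _ _ _ _ H) derive_cst.
have H := @is_derive_mu_x R g g1 w w1 dg dw (fun=> omega) (fun=> 0) V p p s x
  (is_deriveFcst _ _) (dV x) (dp x).
have E : (fun y => 2^-1 * g (sqnorm (V y)) * sqnorm (p y) - w (sqnorm (V y))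
      + omega / 2 * sqnorm (V y)) = (fun=> a0 0 3).
  apply/funext => y; rewrite -(wf_mu_x hfam Pa0 y) /mu_x kappaE ?WE ?sqnorm_ge0 //.
  by rewrite (fam_derive1 hfam).
rewrite E !mul0r addr0 in H.
by rewrite -(@derive_val _ _ _ _ _ _ _ H) derive_cst.
Qed.

(** mu_phi and mu_x are invariant under rotations and constant along the profile, so their
    differentials kill both modes. *)
Lemma ellm_Y1m x : ellm x *m Y1m x = 0.
Proof.
rewrite /Y1m mul_mx_row !ellm_col -[RHS]row_mx0; congr row_mx; apply/colP => i.
  by rewrite !mxE /fn; case: ifP => _; rewrite ?mu_phi_lin_rot ?mu_x_lin_rot.
have := ell_px i x; rewrite !mxE /fn; case: ifP => _ h.
  by rewrite mu_phi_linN h oppr0.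
by rewrite mu_x_linN h oppr0.
Qed.

Let ell_var x j : ellm x *m col_mx (vr j x) (vrx j x) =
  \col_i (if i == 0 then (j == 2)%:R - (j == 1)%:R / 2 * sqnorm (V x)
          else (j == 3)%:R - (j == 0)%:R / 2 * sqnorm (V x)).
Proof.
rewrite ellm_col; apply/colP => i; rewrite !mxE /fn.
by case: ifP => _; rewrite ?(var_mu_phi kappaE dg hfam Pa0) ?(var_mu_x kappaE WE dg dw hfam Pa0).
Qed.

Let evar x (j : 'I_4) : 'cV[R]_2 := \col_i (if i == 0 then (j == 2)%:R - (j == 1)%:R / 2 * sqnorm (V x)
          else (j == 3)%:R - (j == 0)%:R / 2 * sqnorm (V x)).

Let ell_var2 x j j' : ellm x *m row_mx (col_mx (vr j x) (vrx j x)) (col_mx (vr j' x) (vrx j' x)) =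
  row_mx (evar x j) (evar x j').
Proof.
exact: etrans (mul_mx_row _ _ _) (f_equal2 (@row_mx R 2 1 1) (ell_var x j) (ell_var x j')).
Qed.

(** mu_phi and mu_x are themselves the last two coordinates of the family. *)
Lemma ellm_Y2m x : ellm x *m Y2m x = 1%:M.
Proof.
rewrite [LHS](ell_var2 x 2 3) /evar; apply/matrixP => i j; rewrite [RHS]mxE.
case: (@split_ordP 1 1 j) => k ->; rewrite ?row_mxEl ?row_mxEr ord1 mxE /= !mul0r !subr0.
  by have [-> | ->] := ord2P i.
by have [-> | ->] := ord2P i.
Qed.

Definition mass0 : R := 2^-1 * sqnorm (V 0).
Definition mSm : 'M[R]_(2, 1 + 1) :=
  row_mx (\col_i (if i == 0 then 0 else mass0)) (\col_i (if i == 0 then mass0 else 0)).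

(** mu_phi contains c_x and mu_x contains omega_phi, each times half the squared modulus; hence the
    exchange of the two indices in [mSm]. *)
Lemma ellm_Zm : ellm 0 *m Zm 0 = - mSm.
Proof.
rewrite [LHS](ell_var2 0 0 1) /evar /mSm opp_row_mx; congr row_mx; apply/colP => i;
  by rewrite !mxE -!val_eqE /=; case: ifP => _; rewrite /mass0 /=; field.
Qed.

(** Applying [ellm] kills the Y2 part of a kernel vector. The Y1 part then vanishes for all x by
    uniqueness, so that al0 J V = al1 V_x. The product with V gives al1 = 0 at a point where V . V_x
    is nonzero, and al0 = 0 follows as V does not vanish. *)
Lemma Y_unit : row_mx (Y1m 0) (Y2m 0) \in unitmx.
Proof.
set Y := row_mx _ _.
suff ker (v : 'cV[R]_(2 + 2)) : Y *m v = 0 -> v = 0.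
  rewrite -unitmx_tr -row_free_unit -kermx_eq0; apply/eqP/row_matrixP => i.
  rewrite row0; apply: trmx_inj; rewrite trmx0; apply: ker.
  by apply: trmx_inj; rewrite trmx_mul trmxK -row_mul mulmx_ker row0 trmx0.
rewrite -[v](@vsubmxK R 2 2 1); move: (usubmx v) (dsubmx v) => al be; rewrite /Y mul_row_col => H.
have be0 : be = 0.
  have := congr1 (mulmx (ellm 0)) H.
  by rewrite mulmxDr !mulmxA ellm_Y1m ellm_Y2m mul0mx mul1mx add0r mulmx0.
rewrite be0 mulmx0 addr0 in H.
have bA (T : R) : 0 <= T -> exists2 K, 0 <= K & forall x, - T <= x <= T -> mnorm (mxC (Am x)) <= K.
  move=> T0; apply: mxC_bounded; first by rewrite (le_trans _ T0) // oppr_le0.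
  exact: Am_differentiable.
have zero x : Y1m x *m al = 0.
  have dY y : mxderiv (fun y => mxC (Y1m y *m al)) y (mxC (Am y) *m mxC (Y1m y *m al)).
    by rewrite -mxCM mulmxA; exact: rmxderiv_mxC (rmxderivMr al (dY1m y)).
  have Y00 : mxC (Y1m 0 *m al) = 0 by rewrite H /mxC map_mx0.
  have h := linear_ode_unique bA dY Y00 x.
  by apply/matrixP => i j; have := congr1 (fun M : 'cV[R[i]]_(2 + 2) => M i j) h; rewrite !mxE => -[].
have top x : al 0 0 *: (J *m V x) - al 1 0 *: p x = 0.
  have := zero x; rewrite Y1m_col !scale_col_mx opp_col_mx add_col_mx -[in RHS]col_mx0.
  by move/eq_col_mx => [].
have top0 x : al 0 0 * V x 1 0 - al 1 0 * p x 0 0 = 0.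
  have := congr1 (fun v : 'cV__ => v 0 0) (top x).
  by rewrite addmxE scalemxE J0E mx0E mxE scalemxE.
have top1 x : - (al 0 0 * V x 0 0) - al 1 0 * p x 1 0 = 0.
  have := congr1 (fun v : 'cV__ => v 1 0) (top x).
  by rewrite addmxE scalemxE J1E mx0E mxE scalemxE mulrN.
have al1 : al 1 0 = 0.
  have [x hx] := mp_nonconst mw; rewrite (fam_derive1 hfam) // dot2E in hx.
  apply/eqP; move: hx; apply: contraNT => al0; apply/eqP.
  apply: (mulfI al0); rewrite mulr0.
  have E : al 1 0 * (V x 0 0 * p x 0 0 + V x 1 0 * p x 1 0) =
    - (V x 0 0 * (al 0 0 * V x 1 0 - al 1 0 * p x 0 0)
       + V x 1 0 * (- (al 0 0 * V x 0 0) - al 1 0 * p x 1 0)) by ring.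
  by rewrite E top0 top1 !mulr0 addr0 oppr0.
have al0 : al 0 0 = 0.
  apply/eqP; have := mp_nonzero mw 0; apply: contraNT => al0; apply/eqP/colP => i.
  rewrite mx0E; apply: (mulfI al0); rewrite mulr0.
  have := top0 0; have := top1 0; rewrite al1 !mul0r !subr0 => h1 h0.
  by have [-> | ->] := ord2P i => //; apply/eqP; rewrite -oppr_eq0 h1.
suff -> : al = 0 by rewrite be0 col_mx0.
by apply/colP => i; rewrite mx0E; have [-> | ->] := ord2P i.
Qed.

Lemma integral_derivative (F f : R -> R) : continuous f ->
  (forall x, 0 <= x <= X -> is_derive x 1 F (f x)) ->
  \int[lebesgue_measure]_(x in `[0, X]) f x = F X - F 0.
Proof.
move=> cf dF; have [G [dG ->]] := antiderivative X_gt0 cf.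
have dFG x : 0 <= x <= X -> is_derive x 1 (fun y => F y - G y) 0.
  by move=> hx; apply: is_derive_eq (is_deriveFB (dF x hx) (dG x hx)) _; rewrite subrr.
have [y _] := mean_value (ltW X_gt0) dFG.
rewrite mul0r => /eqP; rewrite subr_eq0 => /eqP h.
by rewrite -[F X](subrK (G X)) h; ring.
Qed.

Let intm q m (F : R -> 'M[R]_(q, m)) : 'M[R]_(q, m) :=
  \matrix_(i, j) \int[lebesgue_measure]_(x in `[0, X]) F x i j.

Definition NZm : 'M[R]_(2, 1 + 1) := intm (fun x => ellm x *m Bm x *m Zm x).
Definition N2m : 'M[R]_(2, 1 + 1) := intm (fun x => ellm x *m Bm x *m Y2m x).
Definition NDm : 'M[R]_(2, 1 + 1) := intm (fun x => ellm x *m Dm *m Y1m x).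

Let J1m x : 'M[R]_(2, 1 + 1) :=
  row_mx (\col_i (if i == 0 then 0 else - (2^-1 * sqnorm (V x))))
         (\col_i (if i == 0 then - (2^-1 * sqnorm (V x)) else 0)).

(** V . J V and V_x . J V_x vanish, and the other two entries are - V . V_x, the derivative of minus
    the mass. This explicit primitive yields the periodicity that [J1X] demands. *)
Let dJ1m x : rmxderiv J1m x (ellm x *m Bm x *m Y1m x).
Proof.
have dm : is_derive x 1 (fun y => - (2^-1 * sqnorm (V y))) (- dot (V x) (p x)).
  have h := dsq x; eapply is_derive_eq; first by is_derive_auto.
  by rewrite /=; field.
rewrite [X in rmxderiv _ _ X](_ : _ = row_mx (ellm x *m Bm x *m col_mx (J *m V x) (J *m p x))
  (ellm x *m Bm x *m col_mx (- p x) (- s x))); last by rewrite /Y1m mul_mx_row.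
apply: rmxderiv_row => i j; rewrite ord1 ellB_col [(\col__ _) i 0]mxE.
  have -> : (fun y => (\col_i0 (if i0 == 0 then 0 else - (2^-1 * sqnorm (V y)))) i 0) =
    (fun y => if i == 0 then 0 else - (2^-1 * sqnorm (V y))).
    by apply/funext => y; rewrite mxE.
  case: ifP => _.
    by apply: is_derive_eq (is_deriveFcst _ _) _; rewrite dot2E J0E J1E; ring.
  by apply: is_derive_eq dm _; rewrite JJ !dot2E !mxE; ring.
have -> : (fun y => (\col_i0 (if i0 == 0 then - (2^-1 * sqnorm (V y)) else 0)) i 0) =
  (fun y => if i == 0 then - (2^-1 * sqnorm (V y)) else 0).
  by apply/funext => y; rewrite mxE.
case: ifP => _; first by apply: is_derive_eq dm _; rewrite !dot2E !mxE; ring.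
apply: is_derive_eq (is_deriveFcst _ _) _.
by rewrite dot2E J0E J1E !mxE; ring.
Qed.

Let J1m_X : J1m X = J1m 0.
Proof. by rewrite /J1m V_X sqnorm_expJ. Qed.

Let dif_Y1 : mx_differentiable Y1m. Proof. exact: rmxderiv_differentiable dY1m. Qed.
Let dif_Y2 : mx_differentiable Y2m. Proof. exact: rmxderiv_differentiable dY2m. Qed.
Let dif_Z : mx_differentiable Zm. Proof. exact: rmxderiv_differentiable dZm. Qed.
Let dif_ell : mx_differentiable ellm. Proof. exact: rmxderiv_differentiable dellm. Qed.
Let dif_D : mx_differentiable (fun _ : R => Dm).
Proof. by move=> i j x; exists 0; exact: is_deriveFcst. Qed.

Let det_rot (theta : R) : \det (mxC (rot theta)) = 1.
Proof.
rewrite /mxC det_map_mx /rot det_ublock.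
have -> : \det (expJ theta) = 1.
  by rewrite det_mx2 !mxE -!val_eqE /= -[RHS](cos2Dsin2 theta); ring.
by rewrite mulr1 rmorph1.
Qed.

(** Here z stands for exp(i xi) - 1 and t for |xi|; only |z| <= t <= 4 matters at this stage. *)
Lemma evans_estimate : exists K' delta : R, [/\ 0 <= K', 0 < delta &
  forall (lambda z : R[i]) (eta : 'rV[R]_n) (t : R) (S : R -> 'M[R[i]]_(2 + 2)),
  solution_operator kappa W omega c V lambda eta S ->
  Normc.normc lambda <= delta -> sqnorm eta <= 1 -> Normc.normc z <= t -> t <= 4 ->
  let h := sqnorm eta in
  let r := Normc.normc lambda + t + h in
  let q := Normc.normc lambda * (Normc.normc lambda + t) + h in
  Normc.normc (\det (S X - (1 + z) *: mxC (rot xi))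
    - \det (block_mx (main_ul (mxC Pm) lambda z) (mxC Qm)
       (main_dl (mxC Pm) (mxC mSm) (mxC NZm) (mxC NDm) lambda h%:C)
       (main_dr (mxC Qm) (mxC mSm) (mxC N2m) lambda z)))
  <= K' * (r * q * (r ^+ 2 + q))].
Proof.
have X0 := X_gt0; have X0' := ltW X0.
have [KA KA0 hA] := mxC_bounded X0' Am_differentiable.
have [KB KB0 hB] := mxC_bounded X0' Bm_differentiable.
have [KD KD0 hD] := mxC_bounded X0' dif_D.
have [K1 K10 h1] := mxC_bounded X0' dif_Y1.
have [K2 K20 h2] := mxC_bounded X0' dif_Y2.
have [KZ KZ0 hZ] := mxC_bounded X0' dif_Z.
have [Ke Ke0 he] := mxC_bounded X0' dif_ell.
pose K := KA + KB + KD + K1 + K2 + KZ + Ke.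
have dif_eB := mx_differentiableM dif_ell Bm_differentiable.
have [GZ [dGZ iGZ]] := mx_antiderivative X0 (mx_differentiableM dif_eB dif_Z).
have [G2 [dG2 iG2]] := mx_antiderivative X0 (mx_differentiableM dif_eB dif_Y2).
have [GD [dGD iGD]] := mx_antiderivative X0 (mx_differentiableM (mx_differentiableM dif_ell dif_D) dif_Y1).
have intE q m (F G : R -> 'M[R]_(q, m)) :
    (forall i j, \int[lebesgue_measure]_(x in `[0, X]) F x i j = G X i j - G 0 i j) ->
    mxC (intm F) = mxC (G X) - mxC (G 0).
  by move=> h; apply/matrixP => i j; rewrite !mxE h rmorphB.
have C1 x : mxderiv (fun y => mxC (Y1m y)) x (mxC (Am x) *m mxC (Y1m x)).
  by rewrite -mxCM; exact: rmxderiv_mxC (dY1m x).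
have C2 x : mxderiv (fun y => mxC (Y2m y)) x (mxC (Am x) *m mxC (Y2m x)).
  by rewrite -mxCM; exact: rmxderiv_mxC (dY2m x).
have CZ x : mxderiv (fun y => mxC (Zm y)) x (mxC (Am x) *m mxC (Zm x) + mxC (Bm x) *m mxC (Y1m x)).
  by rewrite -!mxCM -[X in mxderiv _ _ X]raddfD; exact: rmxderiv_mxC (dZm x).
have Ce x : mxderiv (fun y => mxC (ellm y)) x (- (mxC (ellm x) *m mxC (Am x))).
  by rewrite -mxCM -[X in mxderiv _ _ X]raddfN; exact: rmxderiv_mxC (dellm x).
have prod3 q1 q2 q3 q4 (M1 : 'M[R]_(q1, q2)) (M2 : 'M[R]_(q2, q3)) (M3 : 'M[R]_(q3, q4)) :
  mxC (M1 *m M2 *m M3) = mxC M1 *m mxC M2 *m mxC M3 by rewrite !mxCM.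
have [kA kB kD k1 k2] : [/\ KA <= K, KB <= K, KD <= K, K1 <= K & K2 <= K].
  by rewrite /K; split; lra.
have [kZ ke] : KZ <= K /\ Ke <= K by rewrite /K; split; lra.
have bA x (hx : 0 <= x <= X) := le_trans (hA x hx) kA.
have bB x (hx : 0 <= x <= X) := le_trans (hB x hx) kB.
have bD x (hx : 0 <= x <= X) := le_trans (hD x hx) kD.
have b1 x (hx : 0 <= x <= X) := le_trans (h1 x hx) k1.
have b2 x (hx : 0 <= x <= X) := le_trans (h2 x hx) k2.
have bZ x (hx : 0 <= x <= X) := le_trans (hZ x hx) kZ.
have be x (hx : 0 <= x <= X) := le_trans (he x hx) ke.
have c1 x (hx : 0 <= x <= X) : mxderiv (fun y => mxC (J1m y)) x
    (mxC (ellm x) *m mxC (Bm x) *m mxC (Y1m x)).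
  by rewrite -prod3; exact: rmxderiv_mxC (dJ1m x).
have cZ x (hx : 0 <= x <= X) : mxderiv (fun y => mxC (GZ y)) x
    (mxC (ellm x) *m mxC (Bm x) *m mxC (Zm x)).
  by rewrite -prod3; exact: rmxderiv_mxC (dGZ x hx).
have c2 x (hx : 0 <= x <= X) : mxderiv (fun y => mxC (G2 y)) x
    (mxC (ellm x) *m mxC (Bm x) *m mxC (Y2m x)).
  by rewrite -prod3; exact: rmxderiv_mxC (dG2 x hx).
have cD x (hx : 0 <= x <= X) : mxderiv (fun y => mxC (GD y)) x
    (mxC (ellm x) *m mxC Dm *m mxC (Y1m x)).
  by rewrite -prod3; exact: rmxderiv_mxC (dGD x hx).
have r1 : mxC (J1m X) = mxC (J1m 0) by rewrite J1m_X.
have r2 : mxC (rot xi) *m mxC (rot (- xi)) = 1%:M.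
  by rewrite -mxCM rot_mulN /mxC map_mx1.
have r3 : row_mx (mxC (Y1m 0)) (mxC (Y2m 0)) \in unitmx.
  by rewrite /mxC -map_row_mx map_unitmx; exact: Y_unit.
have r4 : mxC (ellm 0) *m mxC (Y1m 0) = 0 by rewrite -mxCM ellm_Y1m /mxC map_mx0.
have r5 : mxC (ellm 0) *m mxC (Y2m 0) = 1%:M by rewrite -mxCM ellm_Y2m /mxC map_mx1.
have r6 : mxC (ellm 0) *m mxC (Zm 0) = - mxC mSm by rewrite -mxCM ellm_Zm /mxC map_mxN.
have r7 : mxC (ellm X) *m mxC (rot xi) = mxC (ellm 0) by rewrite -mxCM ellm_X.
have r8 : mxC (Y1m X) = mxC (rot xi) *m mxC (Y1m 0) by rewrite -mxCM Y1m_X.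
have r9 : mxC (Y2m X) = mxC (rot xi) *m (mxC (Y2m 0) + mxC (Y1m 0) *m mxC Qm).
  by rewrite Y2m_X mxCM; congr (_ *m _); rewrite /mxC map_mxD map_mxM.
have r10 : mxC (Zm X) = mxC (rot xi) *m (mxC (Zm 0) + mxC (Y1m 0) *m mxC Pm).
  by rewrite Zm_X mxCM; congr (_ *m _); rewrite /mxC map_mxD map_mxM.
have [K' [delta [K'0 d0 est]]] := @det_expansion R X
  (fun x => mxC (Am x)) (fun x => mxC (Bm x)) (fun _ => mxC Dm)
  (fun x => mxC (Y1m x)) (fun x => mxC (Y2m x)) (fun x => mxC (Zm x)) (fun x => mxC (ellm x))
  (fun x => mxC (J1m x)) (fun x => mxC (GZ x)) (fun x => mxC (G2 x)) (fun x => mxC (GD x))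
  (mxC (rot xi)) (mxC (rot (- xi))) (mxC Pm) (mxC Qm) (mxC mSm) K X0'
  (fun x _ => C1 x) (fun x _ => C2 x) (fun x _ => CZ x) (fun x _ => Ce x)
  bA bB bD b1 b2 bZ be c1 cZ c2 cD r1 r2 (det_rot xi) r3 r4 r5 r6 r7 r8 r9 r10.
exists K', delta; split=> // lambda z eta t S hS hl h1' zt t4 /=.
have S0 := so_init hS.
have h01 : 0 <= sqnorm eta <= 1 by rewrite sqnorm_ge0.
have := est lambda z (sqnorm eta) t S hl h01 zt t4 S0 (fun x _ =>
  solution_mxderiv kappaE WE dg dg1 dw dw1 g_neq0 dV dp hS x).
by rewrite -(intE _ _ _ _ iGZ) -(intE _ _ _ _ iG2) -(intE _ _ _ _ iGD).
Qed.

(** The last two rows of Sigma_t in the form supplied by [ellm]. In the row of Q1 the boundary term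
    involves the derivative of xi instead of that of X. *)
Let tcol (j : 'I_4) : 'cV[R]_2 := \col_i (if i == 0
  then \int[lebesgue_measure]_(x in `[0, X]) dot (V x) (vr j x) + mass0 * dpar Xf j
  else \int[lebesgue_measure]_(x in `[0, X]) dot (p x) (J *m vr j x) + mass0 * dpar xif j).

Let row_Mass j (v : R -> 'cV[R]_2) : v = vr j ->
  \int[lebesgue_measure]_(x in `[0, X])
     lin (functional (@Mass R n)) (planar V) (planar v) (on_axis n x)
  + functional (@Mass R n) (planar V) (on_axis n 0) * dpar Xf j = tcol j 0 0.
Proof.
move=> ->; rewrite functional_Mass mxE eqxx; apply: (f_equal2 +%R) => //.
apply: (f_equal (fun f : R -> R => \int[lebesgue_measure]_(x in `[0, X]) f x)).
by apply/funext => x; exact: (lin_Mass n V (vr j)).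
Qed.

Let dJV (x : R) i : is_derive x 1 (fun y => (J *m V y) i 0) ((J *m p x) i 0).
Proof. exact: is_derive_J_curve. Qed.
Let dJvr j (x : R) i : is_derive x 1 (fun y => (J *m vr j y) i 0) ((J *m vrx j x) i 0).
Proof. exact: is_derive_J_curve. Qed.
Let dJp (x : R) i : is_derive x 1 (fun y => (J *m p y) i 0) ((J *m s x) i 0).
Proof. exact: is_derive_J_curve. Qed.

Let lin3 (u u1 u2 u3 : 'cV[R]_2) (b d : R) :
  dot u (u1 + b *: u2 - d *: u3) = dot u u1 + b * dot u u2 - d * dot u u3.
Proof. by rewrite -scaleNr !dot2E !addmxE !scalemxE; ring. Qed.

Let dot_JJ (u : 'cV[R]_2) : dot (J *m u) (J *m u) = sqnorm u.
Proof. by rewrite sqnorm2E dot2E !J0E !J1E; ring. Qed.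

Let dot_J_parts (u u' v v' : 'cV[R]_2) (d : R) :
  dot u' (J *m v) + (0 * d + 2^-1 * (dot (J *m u') v + dot (J *m u) v')) =
  2^-1 * (dot (J *m u) v' + dot (J *m v) u').
Proof. by rewrite !dot2E !J0E !J1E; field. Qed.

Let boundary_sum (F0 FX a b dxi dX m : R) :
  FX + 2^-1 * (a + dxi * m - dX * b) - (F0 + 2^-1 * a) + 2^-1 * b * dX = FX - F0 + 2^-1 * m * dxi.
Proof. by field. Qed.

Let boundary_vectors (theta dX dxi : R) (u q v uX qX vX : 'cV[R]_2) :
  uX = expJ theta *m u -> qX = expJ theta *m q ->
  vX + dX *: qX = expJ theta *m v + dxi *: (J *m (expJ theta *m u)) ->
  dot (J *m uX) vX = dot (J *m u) v + dxi * sqnorm u - dX * dot (J *m u) q.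
Proof. by move=> -> -> /(canRL (addrK _)) ->; rewrite !J_expJ lin3 !dot_expJ dot_JJ. Qed.

Let boundary j : dot (J *m V X) (vr j X) =
  dot (J *m V 0) (vr j 0) + dpar xif j * sqnorm (V 0) - dpar Xf j * dot (J *m V 0) (p 0).
Proof. exact: boundary_vectors V_X p_X (var_shift hfam Pa0 j). Qed.

(** The linearized momentum is V_x . J v plus half the derivative of J V . v. By [boundary], the
    increment of the latter contributes the mass times the derivative of xi, together with a term in
    the derivative of X that cancels Q1(0) times it. *)
Let row_Q1 j (v : R -> 'cV[R]_2) : v = vr j ->
  \int[lebesgue_measure]_(x in `[0, X])
     lin (functional (@Q1 R n)) (planar V) (planar v) (on_axis n x)
  + functional (@Q1 R n) (planar V) (on_axis n 0) * dpar Xf j = tcol j 1 0.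
Proof.
move=> ->; rewrite (functional_Q1 n dV) mxE /=.
have dpJ (x : R) := @is_derive_dot_curve R p (fun y => J *m vr j y) s (fun y => J *m vrx j y) x (dp x) (dJvr j x).
have cpJ : continuous (fun x => dot (p x) (J *m vr j x)).
  by move=> x; exact: is_derive_continuous (dpJ x).
have [F [dF ->]] := antiderivative X_gt0 cpJ.
have dB (x : R) := @is_derive_dot_curve R (fun y => J *m V y) (vr j) (fun y => J *m p y) (vrx j) x (dJV x) (dvr j x).
have cL : continuous (fun x => lin (functional (@Q1 R n)) (planar V) (planar (vr j)) (on_axis n x)).
  move=> x.
  have -> : (fun x => lin (functional (@Q1 R n)) (planar V) (planar (vr j)) (on_axis n x)) =
     (fun x => 2^-1 * (dot (J *m V x) (vrx j x) + dot (J *m vr j x) (p x))).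
    by apply/funext => y; exact: (lin_Q1 n dV (dvr j)).
  have h1 := @is_derive_dot_curve R (fun y => J *m V y) (vrx j) (fun y => J *m p y) (vrxx j) x (dJV x) (dvrx j x).
  have h2 := @is_derive_dot_curve R (fun y => J *m vr j y) p (fun y => J *m vrx j y) s x (dJvr j x) (dp x).
  by eapply is_derive_continuous; is_derive_auto.
have dT (x : R) : 0 <= x <= X -> is_derive x 1 (fun x => F x + 2^-1 * dot (J *m V x) (vr j x))
    (lin (functional (@Q1 R n)) (planar V) (planar (vr j)) (on_axis n x)).
  move=> hx; have hF := dF x hx; have hB := dB x.
  eapply is_derive_eq; first by is_derive_auto.
  exact: etrans (dot_J_parts _ _ _ _ _) (esym (lin_Q1 n dV (dvr j) x)).
by rewrite (integral_derivative cL dT) boundary; exact: boundary_sum.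
Qed.

Let Sigma_t_entry (i j : 'I_4) : Sigma_t n V X a0 Vf Xf xif i j =
  [:: qcol j 0 0; qcol j 1 0; tcol j 0 0; tcol j 1 0]`_i.
Proof.
have E : (fun x => 'D_(delta_mx 0 j) (Vf ^~ x) a0) = vr j.
  by apply/funext => x; exact: (var_derive hfam Pa0 j x).
rewrite mxE; case: i => -[|[|[|[|//]]]] hi.
- by apply: esym; exact: mxE.
- by apply: esym; exact: mxE.
- exact: row_Mass E.
- exact: row_Q1 E.
Qed.

Let Zcol x j : ellm x *m Bm x *m col_mx (vr j x) (vrx j x) =
  \col_i (if i == 0 then dot (V x) (vr j x) else dot (p x) (J *m vr j x)).
Proof. exact: ellB_col. Qed.

Let ncol j : 'cV[R]_2 := \col_i (if i == 0
  then \int[lebesgue_measure]_(x in `[0, X]) dot (V x) (vr j x)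
  else \int[lebesgue_measure]_(x in `[0, X]) dot (p x) (J *m vr j x)).

Let intm_cols (j j' : 'I_4) (F : R -> 'M[R]_(2 + 2, 1 + 1)) :
  (forall x, F x = row_mx (col_mx (vr j x) (vrx j x)) (col_mx (vr j' x) (vrx j' x))) ->
  intm (fun x => ellm x *m Bm x *m F x) = row_mx (ncol j) (ncol j').
Proof.
move=> FE; apply: Rintegral_mx_columns => x.
exact: etrans (f_equal (mulmx (ellm x *m Bm x)) (FE x))
  (etrans (mul_mx_row _ _ _) (f_equal2 (@row_mx R 2 1 1) (Zcol x j) (Zcol x j'))).
Qed.

Lemma NZmE : NZm = row_mx (ncol 0) (ncol 1). Proof. exact: intm_cols. Qed.
Lemma N2mE : N2m = row_mx (ncol 2) (ncol 3). Proof. exact: intm_cols. Qed.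

Let tcolE j : tcol j = ncol j + mSm *m qcol j.
Proof.
apply/colP => i; rewrite addmxE row_mx_mul2 addmxE !scalemxE /tcol /ncol /qcol !mxE.
by have [-> | ->] := ord2P i; rewrite /=; ring.
Qed.

Let row_sum (N S : 'M[R]_(2, 1 + 1)) (n0 n1 t0 t1 q0 q1 : 'cV[R]_2) :
  N = row_mx n0 n1 -> t0 = n0 + S *m q0 -> t1 = n1 + S *m q1 ->
  row_mx t0 t1 = N + S *m row_mx q0 q1.
Proof. by move=> -> -> ->; rewrite mul_mx_row add_row_mx. Qed.

Lemma Sigma_tE : Sigma_t n V X a0 Vf Xf xif =
  block_mx Pm Qm (NZm + mSm *m Pm) (N2m + mSm *m Qm).
Proof.
exact: etrans (@block_mx_columns _ qcol tcol _ Sigma_t_entry)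
  (f_equal2 (@block_mx R 2 2 2 2 Pm Qm) (row_sum NZmE (tcolE 0) (tcolE 1))
     (row_sum N2mE (tcolE 2) (tcolE 3))).
Qed.

Let RintegralN (f : R -> R) : continuous f ->
  \int[lebesgue_measure]_(x in `[0, X]) (- f x) = - \int[lebesgue_measure]_(x in `[0, X]) f x.
Proof.
move=> cf; have [F [dF ->]] := antiderivative X_gt0 cf.
have cNf : continuous (fun x => - f x) by move=> x; apply: continuousN; exact: cf.
rewrite (integral_derivative cNf (fun x hx => is_deriveFN (dF x hx))).
by rewrite opprB opprK addrC.
Qed.

Let intk (f : R -> R) : R := \int[lebesgue_measure]_(x in `[0, X]) (kappa (sqnorm (V x)) * f x).

Let ycol (j : 'I_4) : 'cV[R]_2 := \col_i
  (nth [::] [:: [:: intk (fun x => sqnorm (V x)); - intk (fun x => dot (J *m V x) (p x)); 0; 0];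
                [:: intk (fun x => dot (p x) (J *m V x)); - intk (fun x => sqnorm (p x)); 0; 0]] i)`_j.

Let ksmooth (u v u' v' : R -> 'cV[R]_2) (x : R) :
  (forall i, is_derive x 1 (fun y => u y i 0) (u' x i 0)) ->
  (forall i, is_derive x 1 (fun y => v y i 0) (v' x i 0)) ->
  {for x, continuous (fun y => k y * dot (u y) (v y))}.
Proof.
move=> du dv; have h1 := is_derive_dot_curve du dv.
have h2 := is_derive_fcomp (dg _) (dsq x).
exact: is_derive_continuous (is_deriveFM h2 h1).
Qed.

Let intkE (f : R -> R) : intk f = \int[lebesgue_measure]_(x in `[0, X]) (k x * f x).
Proof.
rewrite /intk; have -> // : (fun x => kappa (sqnorm (V x)) * f x) = (fun x => k x * f x).
by apply/funext => x; rewrite kappaE ?sqnorm_ge0.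
Qed.

Let Dcol x a b : ellm x *m Dm *m col_mx a b =
  \col_i (k x * (if i == 0 then dot (J *m V x) a else dot (p x) a)).
Proof. exact: ellD_col. Qed.

Let dotvN (u v : 'cV[R]_2) : dot u (- v) = - dot u v.
Proof. by rewrite !dot2E !mxE; ring. Qed.

Lemma NDmE : NDm = row_mx (ycol 0) (ycol 1).
Proof.
have FE x : ellm x *m Dm *m Y1m x = row_mx
   (\col_i (if i == 0 then k x * sqnorm (V x) else k x * dot (p x) (J *m V x)))
   (\col_i (if i == 0 then - (k x * dot (J *m V x) (p x)) else - (k x * sqnorm (p x)))).
  have h1 : ellm x *m Dm *m col_mx (J *m V x) (J *m p x) =
      \col_i (if i == 0 then k x * sqnorm (V x) else k x * dot (p x) (J *m V x)).
    by rewrite Dcol; apply/colP => i; rewrite !mxE; case: ifP => _; rewrite ?dot_JJ.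
  have h2 : ellm x *m Dm *m col_mx (- p x) (- s x) =
      \col_i (if i == 0 then - (k x * dot (J *m V x) (p x)) else - (k x * sqnorm (p x))).
    by rewrite Dcol; apply/colP => i; rewrite !mxE; case: ifP => _; rewrite dotvN mulrN ?sqnorm_dot.
  exact: etrans (mul_mx_row _ _ _) (f_equal2 (@row_mx R 2 1 1) h1 h2).
apply: etrans (Rintegral_mx_columns X FE) _; apply: (f_equal2 (@row_mx R 2 1 1)); apply/colP => i.
  rewrite !mxE; have [-> | ->] := ord2P i; exact: esym (intkE _).
rewrite !mxE; have [-> | ->] := ord2P i.
  have c1 : continuous (fun x : R => k x * dot (J *m V x) (p x)).
    by move=> x; exact: (@ksmooth (fun y => J *m V y) p (fun y => J *m p y) s x (dJV x) (dp x)).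
  exact: etrans (RintegralN c1) (f_equal -%R (esym (intkE _))).
have c2 : continuous (fun x : R => k x * sqnorm (p x)).
  have -> : (fun x : R => k x * sqnorm (p x)) = (fun x => k x * dot (p x) (p x)).
    by apply/funext => y; rewrite (sqnorm_dot (p y)).
  by move=> x; exact: (@ksmooth p p s s x (dp x) (dp x)).
exact: etrans (RintegralN c2) (f_equal -%R (esym (intkE _))).
Qed.

Lemma Sigma_yE : Sigma_y kappa V X = @block_mx R 2 2 2 2 0 0 NDm 0.
Proof.
have E (i j : 'I_4) : Sigma_y kappa V X i j =
    [:: (0 : 'cV[R]_2) 0 0; (0 : 'cV[R]_2) 1 0; ycol j 0 0; ycol j 1 0]`_i.
  have dE : derive1 V = p by apply/funext => x; exact: (fam_derive1 hfam).
  rewrite /Sigma_y dE mxE /ycol !mxE.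
  by case: i => -[|[|[|[|//]]]] hi; case: j => -[|[|[|[|//]]]] hj.
have y0 (j : 'I_4) : (1 < j)%N -> ycol j = 0.
  move=> hj; apply/colP => i; rewrite mx0E mxE; move: hj.
  by case: j => -[|[|[|[|//]]]] hj // _; have [-> | ->] := ord2P i.
have cong (Z1 Z2 N Z3 : 'M[R]_(2, 1 + 1)) : Z1 = 0 -> Z2 = 0 -> N = NDm -> Z3 = 0 ->
    @block_mx R 2 2 2 2 Z1 Z2 N Z3 = @block_mx R 2 2 2 2 0 0 NDm 0 by move=> -> -> -> ->.
have z0 : row_mx 0 0 = 0 :> 'M[R]_(2, 1 + 1) by rewrite row_mx0.
apply: etrans (@block_mx_columns _ (fun=> 0) ycol _ E) (cong _ _ _ _ z0 z0 (esym NDmE) _).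
by apply: etrans (f_equal2 (@row_mx R 2 1 1) (y0 2 _) (y0 3 _)) z0.
Qed.

End SpectralProblem.

(** * The expansion *)

Section MapMainBlocks.
Variables (T U : comNzRingType) (phi : {rmorphism T -> U}).
Variables (P Q mS NZ N2 ND : 'M[T]_2) (lambda z h : T).
Local Notation mp := (map_mx phi).

Lemma map_main_ul : mp (main_ul P lambda z) = main_ul (mp P) (phi lambda) (phi z).
Proof. by rewrite /main_ul map_mxB map_mxZ map_scalar_mx. Qed.

Lemma map_main_dl : mp (main_dl P mS NZ ND lambda h) =
  main_dl (mp P) (mp mS) (mp NZ) (mp ND) (phi lambda) (phi h).
Proof. by rewrite /main_dl map_mxD !map_mxZ map_mxD map_mxM rmorphXn. Qed.

Lemma map_main_dr : mp (main_dr Q mS N2 lambda z) =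
  main_dr (mp Q) (mp mS) (mp N2) (phi lambda) (phi z).
Proof. by rewrite /main_dr map_mxB map_mxZ map_mxD map_mxM map_scalar_mx. Qed.

End MapMainBlocks.

Section MainPolynomial.
Variables (F : fieldType) (P Q mS NZ N2 ND : 'M[F]_2).
Local Notation T := {poly {poly {poly F}}}.
Local Notation cst M := (map_mx (fun a : F => a%:P%:P%:P : T) M).

(** The outer variable is h, the middle one z, the inner one lambda. Starting from the conjugated
    blocks, which contain no division by lambda, builds in the extension to lambda = 0. *)
Definition main_poly : T := \det (block_mx
  (main_ul (cst P) 'X%:P%:P 'X%:P) (cst Q)
  (main_dl (cst P) (cst mS) (cst NZ) (cst ND) 'X%:P%:P 'X)
  (main_dr (cst Q) (cst mS) (cst N2) 'X%:P%:P 'X%:P)).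

(** The triple evaluation is a ring morphism, hence commutes with the determinant. *)
Lemma main_polyE lambda z h : main_poly.[h%:P%:P].[z%:P].[lambda] =
  \det (block_mx (main_ul P lambda z) Q (main_dl P mS NZ ND lambda h) (main_dr Q mS N2 lambda z)).
Proof.
pose phi : {rmorphism T -> F} := horner_eval lambda \o horner_eval z%:P \o horner_eval h%:P%:P.
have phiE p : phi p = p.[h%:P%:P].[z%:P].[lambda] by [].
rewrite -phiE -det_map_mx map_block_mx.
have phiC m n (M : 'M[F]_(m, n)) : map_mx phi (cst M) = M.
  by apply/matrixP => i j; rewrite !mxE phiE !hornerC.
have e1 : phi 'X%:P%:P = lambda by rewrite phiE !hornerE.
have e2 : phi 'X%:P = z by rewrite phiE !hornerE.
have e3 : phi 'X = h by rewrite phiE !hornerE.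
by rewrite map_main_ul map_main_dl map_main_dr !phiC e1 e2 e3.
Qed.

Lemma det_rescaled lambda z h : lambda != 0 ->
  \det (lambda *: block_mx P Q (NZ + mS *m P) (N2 + mS *m Q) - z%:M
        + (h / lambda) *: block_mx 0 0 ND 0) =
  \det (block_mx (main_ul P lambda z) Q (main_dl P mS NZ ND lambda h) (main_dr Q mS N2 lambda z)).
Proof.
move=> l0; set M := (X in \det X = _); set N := (X in _ = \det X).
have -> : N = block_mx 1%:M 0 0 lambda%:M *m M *m block_mx 1%:M 0 0 lambda^-1%:M.
  have ME : M = block_mx (main_ul P lambda z) (lambda *: Q)
      (lambda *: (NZ + mS *m P) + (h / lambda) *: ND) (main_dr Q mS N2 lambda z).
    rewrite /M (@scalar_mx_block _ 2 2) !scale_block_mx opp_block_mx !add_block_mx.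
    by rewrite !scaler0 !oppr0 !addr0.
  rewrite ME !mulmx_block !mul1mx !mulmx1 !mul0mx !mulmx0 !addr0 !add0r.
  rewrite !mul_mx_scalar !mul_scalar_mx !scalerA mulVf // !scale1r.
  by rewrite scalerDr !scalerA -expr2 mulrCA divff // mulr1.
rewrite !det_mulmx det_lblock det_ublock !det_scalar !expr1n !mul1r.
by rewrite mulrAC -exprMn divff // expr1n mul1r.
Qed.

Lemma main_poly_det lambda z h (T0 Y : 'M[F]_(2 + 2)) : lambda != 0 ->
  T0 = block_mx P Q (NZ + mS *m P) (N2 + mS *m Q) -> Y = block_mx 0 0 ND 0 ->
  main_poly.[h%:P%:P].[z%:P].[lambda] = \det (lambda *: T0 - z%:M + (h / lambda) *: Y).
Proof. by move=> l0 -> ->; rewrite main_polyE det_rescaled. Qed.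

End MainPolynomial.

Section UnitCircle.
Variable R : realType.

(** From sin y <= y for y >= 0, integrated once more through the mean value theorem; the case x < 0
    follows by parity. The left-hand side is the squared modulus of exp(i x) - 1. *)
Lemma one_subr_cos_le (x : R) : 2 * (1 - cos x) <= x ^+ 2.
Proof.
wlog x0 : x / 0 <= x => [hwlog|].
  have [/hwlog//|/ltW x0] := leP 0 x.
  by rewrite -cosN -sqrrN hwlog // oppr_ge0.
have sin_le (y : R) : 0 <= y -> sin y <= y.
  move=> y0; have dh (t : R) : 0 <= t <= y -> is_derive t 1 (fun t => t - sin t) (1 - cos t).
    by move=> _; exact: is_deriveFB (is_deriveFid t) (is_derive_sin t).
  have [t /andP[t0 _]] := mean_value y0 dh.
  by rewrite sin0 !subr0 => h; rewrite -subr_ge0 h mulr_ge0 //.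
have dh (t : R) : 0 <= t <= x -> is_derive t 1 (fun t => t ^+ 2 + 2 * cos t) (2 * (t - sin t)).
  move=> _; have dc := is_derive_cos t.
  by eapply is_derive_eq; [is_derive_auto|rewrite /=; ring].
have [t /andP[t0 _]] := mean_value x0 dh.
rewrite cos0 expr0n subr0 => h.
have : 0 <= 2 * (t - sin t) * x by rewrite !mulr_ge0 // subr_ge0 sin_le.
rewrite -h /=; lra.
Qed.

Lemma normc_expi_subr1 (x : R) : Normc.normc (expi x - 1) <= `|x|.
Proof.
rewrite /expi /Normc.normc /= -sqrtr_sqr; apply: ler_wsqrtr.
rewrite subr0; apply: le_trans (one_subr_cos_le x).
by have := cos2Dsin2 x; lra.
Qed.

End UnitCircle.

Lemma smooth_nonneg_extension (R : realType) (f : R -> R) : smooth_nonneg f ->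
  exists g g1 g2 g3 : R -> R, [/\ forall r, 0 <= r -> f r = g r,
    forall r : R, is_derive r 1 g (g1 r), forall r : R, is_derive r 1 g1 (g2 r) &
    forall r : R, is_derive r 1 g2 (g3 r)].
Proof.
move=> [g sg fE]; have s1 := smooth_derive (1 : R) sg; have s2 := smooth_derive (1 : R) s1.
exists g, ('D_1 g), ('D_1 ('D_1 g)), ('D_1 ('D_1 ('D_1 g))).
by split=> // r; exact: (@smooth_is_derive _ _ _ setT).
Qed.

(** It suffices that (L + t + h)^2 <= 3 (L^2 + t^2 + h^2), that L t <= (L^2 + t^2) / 2 and that h^2
    <= h; the constant 5 leaves some room. *)
Lemma error_orders (R : realType) (K L t t2 h : R) :
  0 <= K -> 0 <= L -> 0 <= t -> t2 = t ^+ 2 -> 0 <= h -> h <= 1 ->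
  K * ((L + t + h) * (L * (L + t) + h) * ((L + t + h) ^+ 2 + (L * (L + t) + h))) <=
  5 * K * ((L + t + h) * (L ^+ 2 + t2 + h) * (L * (L + t) + h)).
Proof.
move=> K0 L0 t0 -> h0 h1; set r := L + t + h; set q := L * (L + t) + h.
have -> : 5 * K * (r * (L ^+ 2 + t ^+ 2 + h) * q) =
  K * (r * q * (5 * (L ^+ 2 + t ^+ 2 + h))) by ring.
have r0 : 0 <= r by rewrite !addr_ge0.
have q0 : 0 <= q by rewrite addr_ge0 // mulr_ge0 // addr_ge0.
apply: ler_wpM2l => //; apply: ler_wpM2l; first exact: mulr_ge0.
have a1 := sqr_ge0 (L - t); have a2 := sqr_ge0 (L - h); have a3 := sqr_ge0 (t - h).
have a4 : h ^+ 2 <= h by rewrite expr2 ler_piMr.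
rewrite /r /q; nra.
Qed.

Theorem theorem3p2 (R : realType) (d : nat) (hd : (1 <= d)%N)
  (kappa W : R -> R)
  (hkappa : smooth_nonneg kappa) (hW : smooth_nonneg W)
  (hkappa_pos : exists2 k0 : R, 0 < k0 & forall r, 0 <= r -> k0 <= kappa r)
  (omega c mphi mx : R) (V : R -> 'cV[R]_2) (X xi_phi : R)
  (hV : modulated_profile d.-1 kappa W omega c V X xi_phi)
  (hmphi : forall x, mu_phi kappa c V x = mphi)
  (hmx : forall x, mu_x kappa W omega V x = mx)
  (P : set 'rV[R]_4) (Vf : 'rV[R]_4 -> R -> 'cV[R]_2)
  (Xf xif : 'rV[R]_4 -> R)
  (hfam : wave_family d.-1 kappa W P Vf Xf xif)
  (a0 : 'rV[R]_4) (ha0 : a0 = \row_(j < 4) [:: omega; c; mphi; mx]`_j)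
  (hP : P a0) (hVf : Vf a0 = V) (hXf : Xf a0 = X) (hxif : xif a0 = xi_phi)
  (S : R[i] -> 'rV[R]_d.-1 -> R -> 'M[R[i]]_(2 + 2))
  (hS : forall lambda eta,
     solution_operator kappa W omega c V lambda eta (S lambda eta)) :
  exists main : {poly {poly {poly R[i]}}},
    (forall lambda z h : R[i], lambda != 0 ->
       main.[h%:P%:P].[z%:P].[lambda] =
       \det (lambda *: mxC (Sigma_t d.-1 V X a0 Vf Xf xif) - z%:M
             + (h / lambda) *: mxC (Sigma_y kappa V X))) /\
    exists K delta : R, 0 < delta /\
      forall (lambda : R[i]) (eta : 'rV[R]_d.-1) (xi : R),
        Normc.normc lambda < delta -> Num.sqrt (sqnorm eta) < delta ->
        - pi <= xi <= pi ->
        Normc.normc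
          (Evans X xi_phi (S lambda eta) xi
           - main.[(sqnorm eta)%:C%:P%:P].[(expi xi - 1)%:P].[lambda])
        <= K * ((Normc.normc lambda + `|xi| + sqnorm eta)
                * (Normc.normc lambda ^+ 2 + xi ^+ 2 + sqnorm eta)
                * (Normc.normc lambda * (Normc.normc lambda + `|xi|)
                   + sqnorm eta)).
Proof.
have om : omega = a0 0 0 by rewrite ha0 mxE.
have cc : c = a0 0 1 by rewrite ha0 mxE.
clear ha0; subst omega c V X xi_phi.
have [g [g1 [g2 [g3 [kappaE dg dg1 dg2]]]]] := smooth_nonneg_extension hkappa.
have [w [w1 [w2 [w3 [WE dw dw1 dw2]]]]] := smooth_nonneg_extension hW.
have g_neq0 (u : 'cV[R]_2) : g (sqnorm u) != 0.
  have [k0 k00 hk] := hkappa_pos; have u0 := sqnorm_ge0 u.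
  by rewrite -kappaE // gt_eqF // (lt_le_trans k00) // hk.
have [K' [delta [K'0 d0 est]]] :=
  evans_estimate kappaE WE dg dg1 dg2 dw dw1 dw2 g_neq0 hfam hP.
exists (main_poly (mxC (Pm Xf xif a0)) (mxC (Qm Xf xif a0)) (mxC (mSm Vf a0))
  (mxC (NZm g g1 w1 Vf Xf a0)) (mxC (N2m g g1 w1 Vf Xf a0)) (mxC (NDm g g1 w1 Vf Xf a0))).
have mxCS (N N' M : 'M[R]_2) : mxC (N + N' *m M) = mxC N + mxC N' *m mxC M.
  by rewrite /mxC map_mxD map_mxM.
have mxCblock (a b b' d' : 'M[R]_2) :
  mxC (@block_mx R 2 2 2 2 a b b' d') = block_mx (mxC a) (mxC b) (mxC b') (mxC d').
  by rewrite /mxC map_block_mx.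
have mxC0 : mxC (0 : 'M[R]_2) = 0 by rewrite /mxC map_mx0.
split=> [lambda z h l0|].
  have Et := f_equal (@mxC R 4 4) (Sigma_tE g1 w1 g_neq0 hfam hP).
  have Ey := f_equal (@mxC R 4 4) (Sigma_yE w1 kappaE dg hfam hP).
  have Et' := etrans Et (etrans (mxCblock _ _ _ _)
    (f_equal2 (@block_mx R[i] 2 2 2 2 _ _) (mxCS _ _ _) (mxCS _ _ _))).
  have Ey' := etrans Ey (etrans (mxCblock _ _ _ _) (f_equal4 (@block_mx R[i] 2 2 2 2)
    mxC0 mxC0 erefl mxC0)).
  exact: main_poly_det l0 Et' Ey'.
(* The factor 5 is that of [error_orders]; the bound 1 on the radius ensures that the squared norm
   of eta is at most 1. *)
exists (5 * K'), (Num.min delta 1); split; first by rewrite lt_min d0 ltr01.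
move=> lambda eta xi0; rewrite !lt_min => /andP[ld _] /andP[_ e1] /andP[xi1 xi2].
have e0 := sqnorm_ge0 eta.
have eta1 : sqnorm eta <= 1.
  by rewrite -(sqr_sqrtr e0) expr_le1 ?sqrtr_ge0 // ltW.
(* pi / 2 < 2 gives |xi| <= pi < 4, the bound that makes the estimate uniform in xi. *)
have xi4 : `|xi0| <= 4.
  rewrite ler_norml; have := pihalf_lt2 R; lra.
have H := est lambda (expi xi0 - 1) eta `|xi0| (S lambda eta) (hS lambda eta) (ltW ld) eta1
  (normc_expi_subr1 xi0) xi4.
have EvE : Evans (Xf a0) (xif a0) (S lambda eta) xi0 =
    \det (S lambda eta (Xf a0) - (1 + (expi xi0 - 1)) *: mxC (rot (xif a0))).
  by rewrite /Evans /rot mxCblock mxC0 [1 + _]addrC subrK.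
have rw (a b a' b' : R[i]) (B : R) : a = a' -> b = b' ->
    Normc.normc (a' - b') <= B -> Normc.normc (a - b) <= B by move=> -> ->.
apply: le_trans (rw _ _ _ _ _ EvE (main_polyE _ _ _ _ _ _ _ _ _) H) _.
have t2 : xi0 ^+ 2 = `|xi0| ^+ 2 by rewrite real_normK ?num_real.
exact: error_orders K'0 (normc_ge0 _) (normr_ge0 _) t2 e0 eta1.
Qed.
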